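(* Let $k\ge2$. For every $2\le i\le k$ in the oriented case (respectively, every $3\le i\le k$ in the unoriented case), the basis element $\alpha_i\in\mathrm{Cob}^1_{SO}(2,k)$ (respectively, $\alpha_i\in\mathrm{Cob}^1_O(2,k)$) has a representative $f_i$ for which the number of singular points is minimal, i.e. $f_i$ has exactly $2$ singular points if $i$ is even, and exactly $1$ singular point if $i$ is odd.
   Context: **Conventions.** All manifolds and maps between them are smooth. $D^2\subset\mathbb C$ is the closed unit disk; for $j\ge2$, $z^j:D^2\to D^2$ is $z\mapsto z^j$. Let $\tau=\mathrm{diag}(1,-1)\in O_2$ and let $\mu^j:O_2\to O_2$ be the unique homomorphism with $\mu^j(A)=A^j$ for $A\in SO_2$ and $\mu^j(\tau)=\tau$; then $z^j\circ A=\mu^j(A)\circ z^j$. For a bundle $\xi$ with fibre $D^2$ and structure group $SO_2$ or $O_2$ (total space $E\xi$), $\mu^j_*(\xi)$ is the bundle obtained by composing the transition maps with $\mu^j$, and $z^j_*:E\xi\to E\mu^j_*(\xi)$ is the map over the identity which is $z^j$ in each fibre. **Branched coverings.** A map $f:\widetilde M\to M$ between closed oriented $n$-manifolds is an *oriented $k$-fold simple branched covering* ($k\ge2$) if for every $2\le j\le k$ there exist: closed oriented codimension-2 submanifolds $\widetilde V_j\subset\widetilde M$, $V_j\subset M$ (disjoint for different $j$); oriented bundles $\tilde\xi_j$ over $\widetilde V_j$ and $\xi_j$ over $V_j$ with fibre $D^2$ and structure group $SO_2$; a bundle isomorphism $I_j:E\mu^j_*(\tilde\xi_j)\to E\xi_j$;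 and orientation-preserving embeddings $\tilde e_j:E\tilde\xi_j\to\widetilde M$, $e_j:E\xi_j\to M$ which are the identity on the zero sections $\widetilde V_j,V_j$; such that (B1) $f$ has degree $k$ over each connected component of $M$; (B2) $f$ is a local diffeomorphism at each point of $\widetilde M\setminus\bigsqcup_j\widetilde V_j$; (B3) $f$ is orientation-preserving at each regular point; (B4) $e_i(E\xi_i)\cap e_j(E\xi_j)=\emptyset$ for $i\ne j$; (B5) $f\circ\tilde e_j=e_j\circ I_j\circ z^j_*$ for each $j$. The orientations of $\widetilde M,M,\widetilde V_j,V_j$ are part of the data (an orientation of a point is a sign). In the *unoriented case*, $\widetilde M,M$ are still oriented and (B1)–(B5) still hold, but $\widetilde V_j,V_j,\tilde\xi_j,\xi_j$ need not be oriented, the structure group is $O_2$, and $\tilde e_j,e_j$ are not required to be orientation-preserving. For compact manifolds with boundary one requires in addition that $f|_{\partial\widetilde M}:\partial\widetilde M\to\partial M$ is a branched covering of closed manifolds, and that on collars $f$ is the product $f|_{\partial\widetilde M}\times\mathrm{id}_I:\partial\widetilde M\times I\to\partial M\times I$ with $f^{-1}(\partial M\times I)=\partial\widetilde M\times I$. **Cobordism.** Two $k$-fold simple branched coverings $f_i:\widetilde M_i\to M_i$ ($i=1,2$) of $n$-manifolds are cobordant if there are oriented cobordisms $\widetilde W$ between $\widetilde M_1,\widetilde M_2$ and $W$ between $M_1,M_2$, and a $k$-fold simple branched covering $h:\widetilde W\to W$ with $h|_{\widetilde M_i}=f_i$, whose singular submanifolds are cobordisms (oriented ones, in the oriented case)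 between those of $f_1$ and $f_2$. The cobordism classes form an abelian group under disjoint union, denoted $\mathrm{Cob}^1_{SO}(n,k)$ (oriented case) or $\mathrm{Cob}^1_O(n,k)$ (unoriented case). **Counting singular points.** Let $n=2$. The singular points of $f$ of type $z^j$ are the points of the finite set $\widetilde V_j$. In the oriented case $c_j(f)\in\mathbb Z$ is the algebraic number (sum of signs) of the points of $\widetilde V_j$; in the unoriented case $c_j(f)\in\mathbb Z/2$ is the parity of the number of points of $\widetilde V_j$. The map $c=(c_2,\dots,c_k)$ is a well-defined injective homomorphism $\mathrm{Cob}^1_{SO}(2,k)\to\mathbb Z^{k-1}$, respectively $\mathrm{Cob}^1_O(2,k)\to(\mathbb Z/2)^{k-1}$, whose image is the subgroup of those $(c_2,\dots,c_k)$ for which $\sum_i c_{2i}$ is even (respectively $0$). ''Number of singular points'' in the claim means the actual (unsigned) number of points of $\bigsqcup_j\widetilde V_j$. **The basis.** For $2\le i\le k$ let $g_i=(g_{i,2},\dots,g_{i,k})$ in $\mathbb Z^{k-1}$ (or $(\mathbb Z/2)^{k-1}$) be: $g_{2,2}=2$ and $g_{2,j}=0$ for $j>2$; for $i$ odd, $g_{i,i}=1$ and $g_{i,j}=0$ for $j\ne i$; for $i>2$ even, $g_{i,2}=g_{i,i}=1$ and $g_{i,j}=0$ for $j\ne2,i$. $\alpha_i$ is the unique cobordism class with $c(\alpha_i)=g_i$, for $2\le i\le k$ in $\mathrm{Cob}^1_{SO}(2,k)$ and for $3\le i\le k$ in $\mathrm{Cob}^1_O(2,k)$; these classes form a basis of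 $\mathrm{Cob}^1_{SO}(2,k)$, respectively $\mathrm{Cob}^1_O(2,k)$. *)

(* Defs.v *)
From HB Require Import structures.
From mathcomp Require Import all_boot all_order all_algebra.
From mathcomp Require Import all_classical all_reals all_analysis.
From mathcomp Require Import complex.

Set Implicit Arguments.
Unset Strict Implicit.
Unset Printing Implicit Defensive.

Import Order.TTheory GRing.Theory Num.Theory.
Import numFieldNormedType.Exports.
Local Open Scope classical_set_scope.
Local Open Scope ring_scope.

Fixpoint Ck_on (R : realType) (n m r : nat) (G : 'rV[R]_n -> 'rV[R]_m)
    (U : set 'rV[R]_n) : Prop :=
  (forall u, U u -> {for u, continuous G}) /\
  match r with
  | 0%N => True
  | r'.+1 => forall i : 'I_n,
      (forall u, U u -> derivable G u (delta_mx 0 i)) /\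
      Ck_on r' (fun u => 'D_(delta_mx 0 i) G u) U
  end.

(* On a set that is not open, smoothness means the existence of local smooth
   extensions; this covers boundary and corner points. *)
Definition smooth_on (R : realType) (n m : nat) (F : 'rV[R]_n -> 'rV[R]_m)
    (A : set 'rV[R]_n) : Prop :=
  forall u, A u -> exists (U : set 'rV[R]_n) (G : 'rV[R]_n -> 'rV[R]_m),
    [/\ open U, U u, (forall r, Ck_on r G U)
      & forall v, A v -> U v -> F v = G v].

(* J (acting on row vectors from the right) is the differential at u of F
   restricted to A.  All sets A used below are locally contained in the closure
   of their interior, so that J is unique. *)
Definition jac_within (R : realType) (n m : nat) (F : 'rV[R]_n -> 'rV[R]_m)
    (A : set 'rV[R]_n) (u : 'rV[R]_n) (J : 'M[R]_(n, m)) : Prop :=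
  forall eps : R, 0 < eps ->
    \forall v \near within A (nbhs u),
      `|F v - F u - (v - u) *m J| <= eps * `|v - u|.

(* All of R^0 if n = 0. *)
Definition halfspace (R : realType) (n : nat) : set 'rV[R]_n :=
  [set u | forall i : 'I_n, i = 0%N :> nat -> 0 <= u 0 i].

(* [param a] is the inverse of [chart a]; its values outside the image of
   [chart a] are irrelevant. *)
Record manifold (R : realType) (n : nat) := Manifold {
  pts :> topologicalType;
  cidx : Type;
  dom : cidx -> set pts;
  chart : cidx -> pts -> 'rV[R]_n;
  param : cidx -> 'rV[R]_n -> pts;
  mfd_hausdorff : hausdorff_space pts;
  mfd_second_countable : @second_countable pts;
  dom_open : forall a, open (dom a);
  dom_cover : forall p, exists a, dom a p;
  chartK : forall a p, dom a p -> param a (chart a p) = p;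
  chart_image : forall a, exists2 U : set 'rV[R]_n, open U &
    chart a @` dom a = U `&` @halfspace R n;
  chart_continuous : forall a, {within dom a, continuous (chart a)};
  param_continuous : forall a,
    {within chart a @` dom a, continuous (param a)};
  transition_smooth : forall a b,
    smooth_on (chart b \o param a) (chart a @` (dom a `&` dom b))
}.

Definition boundary (R : realType) (n : nat) (M : manifold R n) : set M :=
  [set p | exists a : cidx M, dom a p /\
     exists2 i : 'I_n, i = 0%N :> nat & chart a p 0 i = 0].

Arguments boundary {R n} M _.

Definition closed_mfd (R : realType) (n : nat) (M : manifold R n) : Prop :=
  compact [set: M] /\ boundary M = set0.

Section Maps.
Variables (R : realType) (n m : nat) (N : manifold R n) (M : manifold R m).

Definition local_rep (f : N -> M) (a : cidx N) (b : cidx M) :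
  'rV[R]_n -> 'rV[R]_m := fun u => chart b (f (param a u)).

Definition coords (a : cidx N) (S : set N) : set 'rV[R]_n :=
  chart a @` (dom a `&` S).

Definition smooth_map_on (f : N -> M) (S : set N) : Prop :=
  {within S, continuous f} /\
  forall a b, smooth_on (local_rep f a b) (coords a (S `&` f @^-1` dom b)).

Definition smooth_map (f : N -> M) : Prop := smooth_map_on f setT.

Definition diff_at (f : N -> M) (p : N) (a : cidx N) (b : cidx M)
    (J : 'M[R]_(n, m)) : Prop :=
  [/\ dom a p, dom b (f p)
    & jac_within (local_rep f a b) (coords a (f @^-1` dom b)) (chart a p) J].

End Maps.

Definition diffeo (R : realType) (n : nat) (N M : manifold R n) (f : N -> M) :
    Prop :=
  smooth_map f /\
  exists g : M -> N, [/\ cancel f g, cancel g f & smooth_map g].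

Definition local_diffeo (R : realType) (n : nat) (N M : manifold R n)
    (f : N -> M) (p : N) : Prop :=
  exists (U : set N) (g : M -> N),
    [/\ open U /\ U p, open (f @` U), forall q, U q -> g (f q) = q,
        smooth_map_on f U & smooth_map_on g (f @` U)].

(* An orientation tells, for each chart and each point of its domain, whether
   the chart reverses ([true]) or preserves ([false]) the orientation there.
   In dimension 0 the Jacobian determinants are 1, so that an orientation is a
   sign at each point; using signs instead of oriented atlases also avoids the
   lack of oriented half-line charts in dimension 1. *)
Definition orientation_data (R : realType) (n : nat) (M : manifold R n) :=
  cidx M -> M -> bool.

Definition is_orientation (R : realType) (n : nat) (M : manifold R n)
    (o : orientation_data M) : Prop :=
  (forall a p, dom a p -> \forall q \near p, o a q = o a p) /\
  (forall a b p (J : 'M[R]_n), diff_at (idfun : M -> M) p a b J ->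
     0 < (-1) ^+ o a p * (-1) ^+ o b p * \det J).

Inductive str_group := SO2 | O2.

(* A manifold which is oriented if G = SO2; if G = O2, [orient] carries no
   information. *)
Record gmanifold (R : realType) (G : str_group) (n : nat) := GManifold {
  mfd :> manifold R n;
  orient : orientation_data mfd;
  orientP : G = SO2 -> is_orientation orient
}.

Notation omanifold R n := (gmanifold R SO2 n).

Definition osign (R : realType) (G : str_group) (n : nat)
    (M : gmanifold R G n) (a : cidx M) (p : M) : R := (-1) ^+ orient a p.

Section Degree.
Variables (R : realType) (n : nat) (N M : omanifold R n) (f : N -> M).

Definition regular_at (p : N) : Prop :=
  exists a b (J : 'M[R]_n), diff_at f p a b J /\ J \in unitmx.

Definition preserves_at (p : N) : Prop :=
  exists a b (J : 'M[R]_n), diff_at f p a b J /\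
    0 < osign a p * osign b (f p) * \det J.

Definition reverses_at (p : N) : Prop :=
  exists a b (J : 'M[R]_n), diff_at f p a b J /\
    osign a p * osign b (f p) * \det J < 0.

Definition local_degree (p : N) : int :=
  if `[< preserves_at p >] then 1
  else if `[< reverses_at p >] then -1 else 0.

(* The degree over C is computed at the regular values in C; they exist in
   every component by Sard's theorem. *)
Definition has_degree_over (C : set M) (k : int) : Prop :=
  forall y, C y -> (forall p, f p = y -> regular_at p) ->
    \sum_(p \in f @^-1` [set y]) local_degree p = k.

End Degree.

(* Points of the fibre are row vectors, so a matrix A acts by z |-> z A^T. *)
Definition act (R : realType) (A : 'M[R]_2) (z : 'rV[R]_2) : 'rV[R]_2 :=
  z *m A^T.

Definition in_group (R : realType) (G : str_group) (A : 'M[R]_2) : Prop :=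
  A *m A^T = 1%:M /\ (G = SO2 -> \det A = 1).

Definition disk (R : realType) : set 'rV[R]_2 :=
  [set z | z 0 0 ^+ 2 + z 0 1 ^+ 2 <= 1].

Definition zpow (R : realType) (j : nat) (z : 'rV[R]_2) : 'rV[R]_2 :=
  let w := (Complex (z 0 0) (z 0 1)) ^+ j in
  \row_(l < 2) (if l == 0 then complex.Re w else complex.Im w).

Definition tau (R : realType) : 'M[R]_2 := diag_mx (\row_(l < 2) (-1) ^+ l).

Definition mu (R : realType) (j : nat) (A : 'M[R]_2) : 'M[R]_2 :=
  if \det A == 1 then A ^+ j else (A *m tau R) ^+ j *m tau R.

(* [trans a b x] takes the fibre coordinate over x in the trivialization b to
   the one in the trivialization a. *)
Record disk_bundle (R : realType) (G : str_group) (m : nat)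
    (V : manifold R m) := DiskBundle {
  bidx : Type;
  bdom : bidx -> set V;
  trans : bidx -> bidx -> V -> 'M[R]_2;
  bdom_open : forall a, open (bdom a);
  bdom_cover : forall x, exists a, bdom a x;
  trans_group : forall a b x, bdom a x -> bdom b x -> in_group G (trans a b x);
  trans_cocycle : forall a b c x, bdom a x -> bdom b x -> bdom c x ->
    trans a c x = trans a b x *m trans b c x;
  trans_smooth : forall a b (c : cidx V),
    smooth_on (fun u => mxvec (trans a b (param c u)))
              (coords c (bdom a `&` bdom b))
}.

Arguments bidx {R G m V} _.
Arguments bdom {R G m V _} _ _.
Arguments trans {R G m V} _ _ _ _.

(* The total space of xi consists of the triples (a, x, z) with x in [bdom a]
   and z in D^2, where (b, x, z) and (a, x, trans a b x z) are identified.  In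
   these terms z^j_* is (a, x, z) |-> (a, x, z^j), the cocycle of mu^j_* xi is
   [mu j (trans a b x)], and a map from the total space to M is a function
   e a x z compatible with the identifications. *)
Section Embeddings.
Variables (R : realType) (G : str_group) (m : nat).
Variables (V : gmanifold R G m) (xi : disk_bundle G V) (M : omanifold R m.+2).
Variable e : bidx xi -> V -> 'rV[R]_2 -> M.

(* Coordinates on the total space: a point of the fibre followed by a point of
   the base.  The fibre being 2-dimensional, this defines the same orientation
   as the opposite order. *)
Definition tube_rep (a : bidx xi) (c : cidx V) (b : cidx M) :
    'rV[R]_(m.+2) -> 'rV[R]_(m.+2) :=
  fun u => chart b (e a (param c (@rsubmx R 1 2 m u)) (@lsubmx R 1 2 m u)).

Definition tube_coords (a : bidx xi) (c : cidx V) (b : cidx M) :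
    set 'rV[R]_(m.+2) :=
  [set u | exists x z, [/\ u = row_mx z (chart c x), dom c x, bdom a x,
                           @disk R z & dom b (e a x z)]].

Record tube_embedding : Prop := TubeEmbedding {
  (* the direction <- says that e is well defined, -> that it is injective *)
  tube_inj : forall a b x y z w,
    bdom a x -> disk z -> bdom b y -> disk w ->
    (e a x z = e b y w <-> x = y /\ z = act (trans xi a b x) w);
  tube_continuous : forall a,
    {within [set p : V * 'rV[R]_2 | bdom a p.1 /\ disk p.2],
     continuous (fun p : V * 'rV[R]_2 => e a p.1 p.2)};
  tube_smooth : forall a c b, smooth_on (tube_rep a c b) (tube_coords a c b);
  tube_immersion : forall a c b u (J : 'M[R]_(m.+2)), tube_coords a c b u ->
    jac_within (tube_rep a c b) (tube_coords a c b) u J -> J \in unitmx;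
  tube_oriented : G = SO2 ->
    forall a c b x (z : 'rV[R]_2) (J : 'M[R]_(m.+2)),
      tube_coords a c b (row_mx z (chart c x)) -> dom c x ->
      jac_within (tube_rep a c b) (tube_coords a c b)
                 (row_mx z (chart c x)) J ->
      0 < osign c x * osign b (e a x z) * \det J
}.

Definition tube : set M :=
  [set y | exists a x z, [/\ bdom a x, @disk R z & y = e a x z]].

Definition zero_section : set M :=
  [set y | exists a x, bdom a x /\ y = e a x 0].

End Embeddings.

(* A bundle isomorphism from mu^j_* xit to xi, covering beta; it is given by
   (a, x, z) |-> (b, beta x, act (h b a x) z). *)
Record bundle_iso (R : realType) (G : str_group) (m : nat)
    (Vt V : manifold R m) (xit : disk_bundle G Vt) (xi : disk_bundle G V)
    (j : nat) (beta : Vt -> V)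
    (h : bidx xi -> bidx xit -> Vt -> 'M[R]_2) : Prop := BundleIso {
  iso_base : diffeo beta;
  iso_group : forall b a x, bdom a x -> bdom b (beta x) -> in_group G (h b a x);
  iso_compat : forall b b' a a' x, bdom a x -> bdom a' x ->
    bdom b (beta x) -> bdom b' (beta x) ->
    h b' a' x *m mu j (trans xit a' a x) = trans xi b' b (beta x) *m h b a x;
  iso_smooth : forall b a (c : cidx Vt),
    smooth_on (fun u => mxvec (h b a (param c u)))
              (coords c (bdom a `&` beta @^-1` bdom b))
}.

(* The singularities of type z^j.  The submanifolds of Mt and M are the images
   of [brVt] and [brV] under the zero sections of the tubes. *)
Record branch (R : realType) (G : str_group) (m : nat) (Mt M : omanifold R m.+2)
    (f : Mt -> M) (j : nat) := Branch {
  brVt : gmanifold R G m;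
  brV : gmanifold R G m;
  brVt_compact : compact [set: brVt];
  brV_compact : compact [set: brV];
  brxit : disk_bundle G brVt;
  brxi : disk_bundle G brV;
  bret : bidx brxit -> brVt -> 'rV[R]_2 -> Mt;
  bre : bidx brxi -> brV -> 'rV[R]_2 -> M;
  bret_emb : tube_embedding bret;
  bre_emb : tube_embedding bre;
  brbeta : brVt -> brV;
  brh : bidx brxi -> bidx brxit -> brVt -> 'M[R]_2;
  br_iso : bundle_iso j brbeta brh;
  br_normal_form : forall a b x z,
    bdom a x -> bdom b (brbeta x) -> disk z ->
    f (bret a x z) = bre b (brbeta x) (act (brh b a x) (zpow j z))
}.

Arguments bret {R G m Mt M f j} _ _ _ _.
Arguments bre {R G m Mt M f j} _ _ _ _.

(* k-fold simple branched coverings between compact manifolds of dimension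
   m + 2.  The index j : 'I_k.-1 stands for the exponent j + 2, which runs
   through 2, ..., k.  The conditions near the boundary are part of
   [cobordism]. *)
Record branched_covering (R : realType) (G : str_group) (k m : nat)
    (Mt M : omanifold R m.+2) := BranchedCovering {
  cov :> Mt -> M;
  cov_smooth : smooth_map cov;
  cov_branch : forall j : 'I_k.-1, branch G cov j.+2;
  cov_degree : forall x : M,
    has_degree_over cov (connected_component [set: M] x) k%:Z;
  cov_local_diffeo : forall p : Mt,
    (forall j, ~ zero_section (bret (cov_branch j)) p) ->
    local_diffeo cov p;
  cov_preserves : forall p : Mt, regular_at cov p -> preserves_at cov p;
  cov_tubes_disjoint : forall i j, i != j ->
    tube (bre (cov_branch i)) `&`
    tube (bre (cov_branch j)) = set0;
  cov_sing_disjoint : forall i j, i != j ->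
    zero_section (bret (cov_branch i)) `&`
    zero_section (bret (cov_branch j)) = set0
}.

Record surface_covering (R : realType) (G : str_group) (k : nat) :=
  SurfaceCovering {
  src : omanifold R 2;
  tgt : omanifold R 2;
  src_closed : closed_mfd src;
  tgt_closed : closed_mfd tgt;
  scov : branched_covering G k src tgt
}.

Section SurfaceCovering.
Variables (R : realType) (G : str_group) (k : nat) (f : surface_covering R G k).

Definition sbranch (j : 'I_k.-1) := cov_branch (scov f) j.
Definition singt (j : 'I_k.-1) : gmanifold R G 0 := brVt (sbranch j).
Definition sing (j : 'I_k.-1) : gmanifold R G 0 := brV (sbranch j).

Definition singular_points : set (src f) :=
  \bigcup_(j in [set: 'I_k.-1]) zero_section (bret (sbranch j)).

End SurfaceCovering.

Arguments singular_points {R G k} f _.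

(* kappa is a collar N_0 x [0,1] + N_1 x [0,1] -> W of the boundary of W, the
   boundary being at time 0.  Coordinates on N_s x [0,1] have the time first. *)
Section Collar.
Variables (R : realType) (G : str_group) (n : nat).
Variables (N : bool -> gmanifold R G n) (W : gmanifold R G n.+1).
Variable kappa : forall s, N s -> R -> W.

Definition collar_rep (s : bool) (c : cidx (N s)) (b : cidx W) :
    'rV[R]_(n.+1) -> 'rV[R]_(n.+1) :=
  fun u => chart b (kappa (param c (@rsubmx R 1 1 n u))
                          (@lsubmx R 1 1 n u 0 0)).

Definition collar_coords (s : bool) (c : cidx (N s)) (b : cidx W) :
    set 'rV[R]_(n.+1) :=
  [set u | exists (x : N s) (t : R),
     [/\ u = row_mx (t%:M : 'rV[R]_1) (chart c x),
         dom c x, 0 <= t <= 1 & dom b (kappa x t)]].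

Record collar : Prop := Collar {
  collar_inj : forall s (x y : N s) (t t' : R), 0 <= t <= 1 -> 0 <= t' <= 1 ->
    kappa x t = kappa y t' -> x = y /\ t = t';
  collar_disjoint : forall (x : N false) (y : N true) (t t' : R),
    0 <= t <= 1 -> 0 <= t' <= 1 -> kappa x t <> kappa y t';
  collar_boundary : forall w : W,
    boundary W w <-> exists s (x : N s), w = kappa x 0;
  collar_continuous : forall s,
    {within [set p : N s * R | 0 <= p.2 <= 1],
     continuous (fun p : N s * R => kappa p.1 p.2)};
  collar_smooth : forall s (c : cidx (N s)) b,
    smooth_on (collar_rep c b) (collar_coords c b);
  collar_immersion : forall s (c : cidx (N s)) b u (J : 'M[R]_(n.+1)),
    collar_coords c b u ->
    jac_within (collar_rep c b) (collar_coords c b) u J -> J \in unitmx;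
  (* With the outward normal first, the oriented boundary of W is
     (- N_0) + N_1: the time points inwards, so kappa preserves the orientation
     on N_0 x [0,1] and reverses it on N_1 x [0,1]. *)
  collar_oriented : G = SO2 ->
    forall s (c : cidx (N s)) b (x : N s) (t : R) (J : 'M[R]_(n.+1)),
      let u := row_mx (t%:M : 'rV[R]_1) (chart c x) in
      collar_coords c b u -> dom c x ->
      jac_within (collar_rep c b) (collar_coords c b) u J ->
      0 < (-1) ^+ s * osign c x * osign b (kappa x t) * \det J
}.

End Collar.

(* A cobordism between f false and f true.  Since the boundary of h is the
   disjoint union of the f s, its being a branched covering is automatic. *)
Record cobordism (R : realType) (G : str_group) (k : nat)
    (f : bool -> surface_covering R G k) := Cobordism {
  cobWt : omanifold R 3;
  cobW : omanifold R 3;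
  cobWt_compact : compact [set: cobWt];
  cobW_compact : compact [set: cobW];
  cobh : branched_covering G k cobWt cobW;
  cobkt : forall s, src (f s) -> R -> cobWt;
  cobk : forall s, tgt (f s) -> R -> cobW;
  cobkt_collar : collar cobkt;
  cobk_collar : collar cobk;
  cob_product : forall s (x : src (f s)) (t : R), 0 <= t <= 1 ->
    cobh (@cobkt s x t) = @cobk s (scov (f s) x) t;
  cob_preimage : forall p s (y : tgt (f s)) (t : R), 0 <= t <= 1 ->
    cobh p = @cobk s y t ->
    exists s' (x : src (f s')) (t' : R), 0 <= t' <= 1 /\ p = @cobkt s' x t';
  cobVt : forall j s, singt (f s) j -> R -> brVt (cov_branch cobh j);
  cobV : forall j s, sing (f s) j -> R -> brV (cov_branch cobh j);
  cobVt_collar : forall j, collar (@cobVt j);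
  cobV_collar : forall j, collar (@cobV j);
  cobVt_compat : forall j s (x : singt (f s) j) (t : R) a b, 0 <= t <= 1 ->
    bdom a x -> bdom b (@cobVt j s x t) ->
    bret (cov_branch cobh j) b (@cobVt j s x t) 0 =
    @cobkt s (bret (sbranch (f s) j) a x 0) t;
  cobV_compat : forall j s (x : sing (f s) j) (t : R) a b, 0 <= t <= 1 ->
    bdom a x -> bdom b (@cobV j s x t) ->
    bre (cov_branch cobh j) b (@cobV j s x t) 0 =
    @cobk s (bre (sbranch (f s) j) a x 0) t
}.

Definition cobordant (R : realType) (G : str_group) (k : nat)
    (f0 f1 : surface_covering R G k) : Prop :=
  inhabited (cobordism (fun s : bool => if s then f1 else f0)).

Definition Cob1 (R : realType) (G : str_group) (k : nat) :=
  {alpha : surface_covering R G k -> Prop | exists f, alpha = cobordant f}.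

Definition cob_class (R : realType) (G : str_group) (k : nat)
    (f : surface_covering R G k) : Cob1 R G k :=
  exist _ (cobordant f) (ex_intro _ f erefl).

(* The entry j of a vector in A^(k-1) corresponds to the exponent j + 2. *)

Definition point_sign (R : realType) (V : omanifold R 0) (p : V) : int :=
  if `[< exists2 a : cidx V, dom a p & orient a p >] then -1 else 1.

Definition c_SO (R : realType) (k : nat) (f : surface_covering R SO2 k) :
    'rV[int]_(k.-1) :=
  \row_j \sum_(p \in [set: singt f j]) point_sign p.

Definition c_O (R : realType) (k : nat) (f : surface_covering R O2 k) :
    'rV['F_2]_(k.-1) :=
  \row_j \sum_(p \in [set: singt f j]) (1 : 'F_2).

Definition g_vec (A : nzRingType) (k i : nat) : 'rV[A]_(k.-1) :=
  \row_(j < k.-1)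
    (if i == 2 then (j.+2 == 2)%:R *+ 2
     else if odd i then (j.+2 == i)%:R
     else ((j.+2 == 2) || (j.+2 == i))%:R).

(* alpha is the unique cobordism class with c(alpha) = g_i.  That a class has a
   given value of c is expressed through a representative, which does not
   presuppose that c is constant on classes. *)
Definition is_alpha (R : realType) (G : str_group) (k : nat) (A : nzRingType)
    (c : surface_covering R G k -> 'rV[A]_(k.-1)) (i : nat)
    (alpha : Cob1 R G k) : Prop :=
  unique (fun beta => exists2 f, cob_class f = beta & c f = g_vec A k i) alpha.

(* Main.v *)
(* A k-sheeted covering of a torus, tiled by four squares, is given by a
   permutation of the sheets for each of the eight edges.  Around a vertex the
   sheets are permuted by a monodromy, and a cycle of length n of it becomes one
   point of the covering surface, with the coordinate w |-> w^n.  Hence the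
   singular points are the nontrivial cycles of the four monodromies.

   With two reflections of a set of N sheets, N odd, and a transposition, the
   commutator relation of the torus is solved by one i-cycle if i = N is odd, and
   by an i-cycle and a transposition if i = N + 1 is even.  All signs being
   positive, this gives c = g_i with one, respectively two singular points.

   Conversely, each nonzero entry of g_i forces a singular point of that type; the
   only case where this is not enough is i = 2 in the oriented case, where a sum of
   signs equal to 2 needs two points. *)
Require Import Defs.
From HB Require Import structures.
From mathcomp Require Import all_boot all_order all_algebra.
From mathcomp Require Import all_classical all_reals all_analysis.
From mathcomp Require Import fingroup perm.
From mathcomp Require Import complex ring lra zify.

Set Implicit Arguments.
Unset Strict Implicit.
Unset Printing Implicit Defensive.

Import Order.TTheory GRing.Theory Num.Theory.
Import numFieldNormedType.Exports.
Local Open Scope classical_set_scope.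
Local Open Scope ring_scope.

(** * Complex calculus *)

(** The main obstacle is to meet all smoothness, orientation and degree conditions at once. Hence
    everything is holomorphic: transitions are built from powers, translations and roots, and a
    nonzero complex derivative has a positive real Jacobian, which settles orientations, signs and
    (B3). The surface is not formed as a quotient. A point is a normal form (square, position in it,
    sheet), and only at a vertex must the sheet be the chosen representative of its monodromy cycle.
    Each cycle at a vertex gives one chart, and these charts cover the surface. Two squares in each
    direction keep the star of a vertex from overlapping itself; the side 4 leaves room for disjoint
    unit disks around the vertices. The torus offers a commutator to absorb the monodromy. An
    i-cycle with i even is an odd permutation, hence no commutator, which explains the additional
    transposition. For N = 2h + 1 the reflections h - x and 2h - x of Z/N compose to the rotation by
    h + 1, the half of 1 modulo N; their commutator is its square, the rotation by 1. This is why N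
    is odd. *)

Definition cplx (R : realType) : numFieldType := R[i]%C.

Section ComplexPlane.
Variable R : realType.
Local Notation K := (cplx R).
Local Notation Re := (@complex.Re R).
Local Notation Im := (@complex.Im R).

Lemma ReB (z w : K) : Re (z - w) = Re z - Re w.
Proof. by case: z w => [a b] [c d]. Qed.
Lemma ImB (z w : K) : Im (z - w) = Im z - Im w.
Proof. by case: z w => [a b] [c d]. Qed.
Lemma ReD (z w : K) : Re (z + w) = Re z + Re w.
Proof. by case: z w => [a b] [c d]. Qed.

Lemma ReM (z w : K) : Re (z * w) = Re z * Re w - Im z * Im w.
Proof. by case: z w => [a b] [c d]. Qed.
Lemma ImM (z w : K) : Im (z * w) = Re z * Im w + Im z * Re w.
Proof. by case: z w => [a b] [c d]. Qed.

Lemma complex_eqP (z w : K) : Re z = Re w -> Im z = Im w -> z = w.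
Proof. by case: z w => [a b] [c d] /= -> ->. Qed.

Lemma complex_pos (e : K) : 0 < e -> exists2 r : R, 0 < r & e = Complex r 0.
Proof.
by case: e => a b; rewrite ltcE /= => /andP[/eqP-> a0]; exists a.
Qed.

Lemma norm_ltP (z : K) (e : R) : 0 < e ->
  (`|z| < (Complex e 0 : K)) = (Re z ^+ 2 + Im z ^+ 2 < e ^+ 2).
Proof.
move=> e0; rewrite normc_def ltcR -[X in _ < X]gtr0_norm // -sqrtr_sqr.
by rewrite ltr_sqrt // exprn_gt0.
Qed.

Definition box (z : K) (e : R) : set K :=
  [set x | `|Re x - Re z| < e /\ `|Im x - Im z| < e].

(** The norm of [K] takes its values in [K] itself, so balls have complex radii. Boxes turn
    neighbourhoods into pairs of real inequalities: a box of half-width [e / 2] fits into the ball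
    of radius [e]. *)
Lemma nbhs_box (z : K) (A : set K) :
  nbhs z A <-> exists2 e : R, 0 < e & box z e `<=` A.
Proof.
rewrite nbhs_ballP; split.
  move=> [e' /= /complex_pos[e e0 ->] bA]; exists (e / 2); first by lra.
  move=> x [h1 h2]; apply: bA; rewrite -ball_normE /= norm_ltP // ReB ImB.
  move: h1 h2; rewrite !ltr_norml => /andP[? ?] /andP[? ?]; nra.
move=> [e e0 bA]; exists (Complex e 0); first by rewrite /= ltcE /= eqxx.
move=> x; rewrite -ball_normE /= norm_ltP // ReB ImB => h; apply: bA.
by split; rewrite -(@ltr_pXn2r _ 2) ?nnegrE ?normr_ge0 ?ltW //;
  rewrite real_normK ?num_real // -sqrrN opprB; apply: le_lt_trans h;
  rewrite ?lerDl ?lerDr sqr_ge0.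
Qed.

Lemma continuous_Re (z : K) : {for z, continuous (Re : K -> R)}.
Proof.
move=> A /nbhs_ballP[e /= e0 eA]; apply/nbhs_box; exists e => // x [h _].
by apply: eA; rewrite -ball_normE /= distrC.
Qed.

Lemma continuous_Im (z : K) : {for z, continuous (Im : K -> R)}.
Proof.
move=> A /nbhs_ballP[e /= e0 eA]; apply/nbhs_box; exists e => // x [_ h].
by apply: eA; rewrite -ball_normE /= distrC.
Qed.

Lemma cvg_complex (T : Type) (F : set_system T) (FF : Filter F)
    (f g : T -> R) (z : K) :
  f @ F --> Re z -> g @ F --> Im z -> (fun t => Complex (f t) (g t) : K) @ F --> z.
Proof.
move=> /cvgrPdist_lt fz /cvgrPdist_lt gz A /nbhs_box[e e0 eA].
rewrite nbhs_simpl; near=> t; apply: eA; split=> /=; rewrite distrC.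
  by near: t; exact: fz.
by near: t; exact: gz.
Unshelve. all: by end_near. Qed.

Lemma continuousC_ext (T : topologicalType) (f g : T -> R) (t : T) :
  {for t, continuous f} -> {for t, continuous g} ->
  {for t, continuous (fun t => Complex (f t) (g t) : K)}.
Proof. by move=> cf cg; apply: cvg_complex; [exact: cf|exact: cg]. Qed.

Lemma open_box (z : K) (e : R) : open (box z e).
Proof.
rewrite (_ : box z e = (Re : K -> R) @^-1` (ball (Re z) e) `&` (Im : K -> R) @^-1` (ball (Im z) e)).
  by apply: openI; apply: open_comp => [x _|];
    [exact: continuous_Re|exact: ball_open|exact: continuous_Im|exact: ball_open].
by apply/seteqP; split=> x; rewrite /box /= -!ball_normE /= (distrC (Re z)) (distrC (Im z)).
Qed.

Lemma compact_box_closed (B : R) : 0 <= B ->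
  compact [set z : K | `|Re z| <= B /\ `|Im z| <= B].
Proof.
move=> B0; rewrite (_ : mkset _ =
  (fun p : R * R => Complex p.1 p.2 : K) @` (`[- B, B] `*` `[- B, B])).
  apply: continuous_compact.
    apply: continuous_subspaceT => p; apply: cvg_complex; [exact: cvg_fst|exact: cvg_snd].
  by apply: compact_setX; exact: segment_compact.
apply/seteqP; split=> [[a b] /= [ha hb]|z [[a b] /= [ha hb] <-]] /=.
  by exists (a, b) => //=; rewrite !in_itv /= -!ler_norml.
by move: ha hb; rewrite !in_itv /= -!ler_norml.
Qed.

End ComplexPlane.

Lemma near_eq_cvgto (T U : topologicalType) (F : set_system T) (FF : Filter F)
    (f g : T -> U) (l : U) :
  (\forall x \near F, f x = g x) -> f @ F --> l -> g @ F --> l.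
Proof.
move=> fg fl; apply: cvg_trans fl; apply: (@near_eq_cvg _ _ F FF f g).
exact: fg.
Qed.

Lemma continuous_at_id (T : topologicalType) (t : T) : {for t, continuous id}.
Proof. by []. Qed.

Lemma near_eq_continuous (T U : topologicalType) (f g : T -> U) (t : T) :
  (\forall x \near t, f x = g x) -> {for t, continuous f} ->
  {for t, continuous g}.
Proof.
move=> fg cf; rewrite /prop_for /continuous_at -(nbhs_singleton fg).
exact: near_eq_cvgto cf.
Qed.

Section Holomorphic.
Variable K : numFieldType.
Implicit Types (F G : K -> K) (U V : set K) (z d c : K).

(* Caratheodory's definition of the derivative: the slope extends
   continuously. *)
Definition cder F z d : Prop :=
  exists2 phi : K -> K, {for z, continuous phi} &
    phi z = d /\ forall x, F x = F z + phi x * (x - z).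

(** The derivatives are total functions, constrained on [U] only. Smoothness is
    [forall r, hol r F U]; keeping the order as an index lets each closure property be proved by
    induction on it. *)
Fixpoint hol (r : nat) F U : Prop :=
  if r is r'.+1 then
    exists2 F' : K -> K, (forall z, U z -> cder F z (F' z)) & hol r' F' U
  else True.

Lemma hol_sub r F U V : U `<=` V -> hol r F V -> hol r F U.
Proof.
by move=> UV; elim: r F => //= r IH F [F' dF hF]; exists F'; [move=> z /UV/dF|exact: IH].
Qed.

Lemma hol_pred r F U : hol r.+1 F U -> hol r F U.
Proof.
elim: r F => // r IH F [F' dF hF]; exists F' => //; exact: IH.
Qed.

(** [cder] asks for the slope identity at every point, but only points near [z] count: elsewhere the
    slope can be taken to be the difference quotient, which agrees with [phi] near [z]. *)
Lemma cder_slope F z (phi : K -> K) : {for z, continuous phi} ->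
  (\forall x \near z, F x = F z + phi x * (x - z)) -> cder F z (phi z).
Proof.
move=> cphi nF; pose psi x := if x == z then phi z else (F x - F z) / (x - z).
exists psi; last first.
  split=> [|x]; rewrite /psi; first by rewrite eqxx.
  by case: (x =P z) => [->|/eqP xz];
     rewrite ?subrr ?mulr0 ?addr0 // mulfVK ?subr_eq0 // addrC subrK.
apply: near_eq_continuous cphi; near=> x.
rewrite /psi; have [E|xz] := eqVneq x z; first by rewrite E.
have -> : F x = F z + phi x * (x - z) by near: x.
by rewrite addrC addKr mulfK // subr_eq0.
Unshelve. all: by end_near. Qed.

Lemma cder_continuous F z d : cder F z d -> {for z, continuous F}.
Proof.
move=> [phi cphi [_ E]].
apply: (@near_eq_continuous _ _ (fun x => F z + phi x * (x - z))).
  by near=> x; rewrite -E.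
apply: continuousD; first exact: cst_continuous.
apply: continuousM => //.
by apply: continuousB; [exact: continuous_at_id|exact: cst_continuous].
Unshelve. all: by end_near. Qed.

Lemma cder_near F G z d : (\forall x \near z, F x = G x) ->
  cder F z d -> cder G z d.
Proof.
move=> FG [phi cphi [<- E]]; apply: cder_slope => //; near=> x.
have <- : F x = G x by near: x.
have <- // : F z = G z by apply: nbhs_singleton FG.
Unshelve. all: by end_near. Qed.

Lemma cder_uniq F z d d' : cder F z d -> cder F z d' -> d = d'.
Proof.
move=> [p cp [<- Ep]] [q cq [<- Eq]].
have cp' : p x @[x --> z^'] --> p z by apply: cvg_trans cp; apply: cvg_app; exact: cvg_within.
have cq' : q x @[x --> z^'] --> q z by apply: cvg_trans cq; apply: cvg_app; exact: cvg_within.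
apply: (cvg_unique _ cp'); first exact: norm_hausdorff.
apply: near_eq_cvgto cq'; near=> x.
have xz : x - z != 0 by rewrite subr_eq0; near: x; exact: nbhs_dnbhs_neq.
by apply: (mulIf xz); apply: (addrI (F z)); rewrite -Ep -Eq.
Unshelve. all: by end_near. Qed.

Lemma cder_comp F G z d d' : cder F z d -> cder G (F z) d' ->
  cder (G \o F) z (d' * d).
Proof.
move=> dF; have cF := cder_continuous dF; case: dF => [p cp [<- Ep]] [q cq [<- Eq]].
exists (fun x => q (F x) * p x).
  by apply: continuousM => //; apply: continuous_comp.
by split=> // x /=; rewrite Eq -mulrA; congr (_ + _ * _); rewrite Ep addrAC subrr add0r.
Qed.

Lemma cderM F G z d d' : cder F z d -> cder G z d' ->
  cder (fun x => F x * G x) z (F z * d' + d * G z).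
Proof.
move=> dF; have cF := cder_continuous dF; case: dF => [p cp [<- Ep]] [q cq [<- Eq]].
exists (fun x => F x * q x + p x * G z).
  by apply: continuousD; apply: continuousM => //; exact: cst_continuous.
split=> // x; rewrite [in LHS]Eq mulrDr [X in X * G z + _]Ep; ring.
Qed.

Lemma cderD F G z d d' : cder F z d -> cder G z d' ->
  cder (fun x => F x + G x) z (d + d').
Proof.
move=> [p cp [<- Ep]] [q cq [<- Eq]]; exists (fun x => p x + q x).
  exact: continuousD.
by split=> // x; rewrite [in LHS]Eq [in LHS]Ep; ring.
Qed.

Lemma cder_id z : cder id z 1.
Proof.
exists (fun=> 1); first exact: cst_continuous.
by split=> // x; rewrite mul1r addrC subrK.
Qed.

Lemma cder_cst c z : cder (fun=> c) z 0.
Proof.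
exists (fun=> 0); first exact: cst_continuous.
by split=> // x; rewrite mul0r addr0.
Qed.

Lemma hol_cst r c U : hol r (fun=> c) U.
Proof.
elim: r c => //= r IH c; exists (fun=> 0) => // z _; exact: cder_cst.
Qed.

Lemma hol_id r U : hol r id U.
Proof.
case: r => //= r; exists (fun=> 1); last exact: hol_cst.
move=> z _; exact: cder_id.
Qed.

Lemma holD r F G U : hol r F U -> hol r G U -> hol r (fun x => F x + G x) U.
Proof.
elim: r F G => //= r IH F G [F' dF hF] [G' dG hG].
exists (fun x => F' x + G' x); last exact: IH.
by move=> z Uz; apply: cderD; [exact: dF|exact: dG].
Qed.

Lemma holM r F G U : hol r F U -> hol r G U -> hol r (fun x => F x * G x) U.
Proof.
elim: r F G => // r IH F G hF hG.
have [F' dF hF'] := hF; have [G' dG hG'] := hG.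
exists (fun x => F x * G' x + F' x * G x).
  by move=> z Uz; apply: cderM; [exact: dF|exact: dG].
by apply: holD; apply: IH => //; exact: hol_pred.
Qed.

Lemma hol_comp r F G U V : (forall z, U z -> V (F z)) ->
  hol r F U -> hol r G V -> hol r (G \o F) U.
Proof.
move=> FUV; elim: r F G FUV => // r IH F G FUV hF hG.
have [F' dF hF'] := hF; have [G' dG hG'] := hG.
exists (fun x => (G' \o F) x * F' x).
  by move=> z Uz; apply: cder_comp; [exact: dF|apply: dG; exact: FUV].
by apply: holM => //; apply: IH => //; exact: hol_pred.
Qed.

Lemma cderX n z : cder (fun x => x ^+ n) z (n%:R * z ^+ n.-1).
Proof.
elim: n => [|n IH]; first by rewrite mul0r; exact: cder_cst.
have h := cderM (cder_id z) IH.
have {h} : cder (fun x => x ^+ n.+1) z (z * (n%:R * z ^+ n.-1) + 1 * z ^+ n).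
  by apply: cder_near h; near=> x; rewrite exprS.
have -> // : z * (n%:R * z ^+ n.-1) + 1 * z ^+ n = n.+1%:R * z ^+ n.+1.-1.
rewrite mul1r; case: n {IH} => [|n] /=; first by rewrite mul0r mulr0 add0r mul1r.
by rewrite mulrCA -exprS -[X in _ + X]mul1r -mulrDl natr1.
Unshelve. all: by end_near. Qed.

Lemma holX r n U : hol r (fun x => x ^+ n) U.
Proof.
elim: n => [|n IH]; first exact: hol_cst.
rewrite (_ : (fun x : K => x ^+ n.+1) = (fun x => x * x ^+ n)).
  by apply: holM => //; exact: hol_id.
by apply/funext => x; rewrite exprS.
Qed.

Lemma near_neq0 z : z != 0 -> \forall x \near z, x != 0.
Proof.
move=> z0; apply/nbhs_ballP; exists `|z|; rewrite /= ?normr_gt0 // => x.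
rewrite -ball_normE /= => h; apply/eqP => x0; move: h.
by rewrite x0 subr0 ltxx.
Qed.

Lemma cderV z : z != 0 -> cder (fun x => x^-1) z (- (z^-1 * z^-1)).
Proof.
move=> z0; apply: (@cder_slope _ _ (fun x => - (x^-1 * z^-1))).
  by apply: continuousN; apply: continuousM; [exact: continuousV|exact: cst_continuous].
near=> x; have x0 : x != 0 by near: x; exact: near_neq0.
by field; rewrite x0 z0.
Unshelve. all: by end_near. Qed.

Lemma holV r U : ~ U 0 -> hol r (fun x => x^-1) U.
Proof.
move=> U0; have nz z : U z -> z != 0 by move=> Uz; apply/eqP => z0; apply: U0; rewrite -z0.
elim: r => //= r IH; exists (fun x => (- 1) * (x^-1 * x^-1)).
  by move=> z Uz; rewrite mulN1r; exact/cderV/nz.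
apply: holM; [exact: hol_cst|exact: holM].
Qed.

Lemma continuousX (g : K -> K) n z : {for z, continuous g} ->
  {for z, continuous (fun x => g x ^+ n)}.
Proof.
move=> cg; elim: n => [|n IH]; first exact: cst_continuous.
rewrite (_ : (fun x => g x ^+ n.+1) = (fun x => g x * g x ^+ n)).
  exact: continuousM.
by apply/funext => x; rewrite exprS.
Qed.

(** Dividing x - z = g(x)^n - g(z)^n by g(x) - g(z) leaves the cofactor [S x], so the slope of [g]
    is its inverse, continuous at [z] because S(z) = n g(z)^(n-1) is not 0. The derivative is
    written as a multiple of [g z] for the sake of [hol_root]. *)
Lemma cder_root n (g : K -> K) U z : (0 < n)%N -> open U -> U z -> z != 0 ->
  {for z, continuous g} -> (forall x, U x -> g x ^+ n = x) ->
  cder g z ((n%:R * z)^-1 * g z).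
Proof.
move=> n0 oU Uz z0 cg gn.
have gz0 : g z != 0.
  by apply/eqP => gz; move: z0; rewrite -(gn z Uz) gz expr0n eqn0Ngt n0 /= eqxx.
pose S x := \sum_(i < n) g x ^+ (n.-1 - i) * g z ^+ i.
have Sz : S z = n%:R * g z ^+ n.-1.
  rewrite /S (eq_bigr (fun=> g z ^+ n.-1)) ?sumr_const ?card_ord ?mulr_natl //.
  by move=> i _; rewrite -exprD subnK // -ltnS prednK.
have cS : {for z, continuous S}.
  rewrite (_ : S = \sum_(i < n) (fun x => g x ^+ (n.-1 - i) * g z ^+ i)).
    apply: (@big_ind _ (fun f : K -> K => {for z, continuous f})) => [|f1 f2|i _].
    - exact: cst_continuous.
    - exact: continuousD.
    - by apply: continuousM; [exact: continuousX|exact: cst_continuous].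
  by apply/funext => x; rewrite fct_sumE.
have Sz0 : S z != 0 by rewrite Sz mulf_neq0 ?expf_neq0 // pnatr_eq0 -lt0n.
have -> : (n%:R * z)^-1 * g z = (S z)^-1.
  have gzn : z = g z * g z ^+ n.-1 by rewrite -exprS prednK // gn.
  have aux (x y c a : K) : y != 0 -> c != 0 -> a != 0 -> x = y * a ->
      (c * x)^-1 * y = (c * a)^-1.
    by move=> y0 c0 a0 ->; field; rewrite y0 c0 a0.
  by rewrite Sz; apply: aux => //; rewrite ?expf_neq0 // pnatr_eq0 -lt0n.
apply: (@cder_slope _ _ (fun x => (S x)^-1)); first exact: continuousV.
near=> x; have Ux : U x by near: x; exact: open_nbhs_nbhs.
have S0 : S x != 0.
  by near: x; apply: (cS [set y | y != 0]); exact: near_neq0.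
have e : (g x - g z) * S x = x - z by rewrite -[in RHS](gn _ Ux) -[in RHS](gn _ Uz) subrXX.
by rewrite -e mulrC mulfK // addrC subrK.
Unshelve. all: by end_near. Qed.

(** The derivative of [g] is [g] times a rational function without poles in [U], so the induction on
    [r] meets the same [g] again. *)
Lemma hol_root r n (g : K -> K) U : (0 < n)%N -> open U -> ~ U 0 ->
  (forall z, U z -> {for z, continuous g}) -> (forall x, U x -> g x ^+ n = x) ->
  hol r g U.
Proof.
move=> n0 oU U0 cg gn; elim: r => // r IH.
exists (fun x => (n%:R^-1 * x^-1) * g x).
  move=> z Uz; rewrite -invfM; apply: (@cder_root _ _ U) => //; last exact: cg.
  by apply/eqP => z0; apply: U0; rewrite -z0.
by apply: holM => //; apply: holM; [exact: hol_cst|exact: holV].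
Qed.

End Holomorphic.

(** * Real Jacobians of holomorphic functions *)

Section RowVectors.
Variable R : realType.
Local Notation K := (cplx R).
Local Notation Re := (@complex.Re R).
Local Notation Im := (@complex.Im R).

Definition rv (z : K) : 'rV[R]_2 :=
  \row_(l < 2) (if l == 0 then Re z else Im z).
Definition cx (u : 'rV[R]_2) : K := Complex (u 0 0) (u 0 1).

(** Multiplication by [d] as a real matrix acting on row vectors from the right: the rows are the
    images of 1 and of the imaginary unit. *)
Definition cmat (d : K) : 'M[R]_2 := \matrix_(i < 2)
  (if i == 0 then rv d else rv (d * Complex 0 1)).

Lemma cxK : cancel cx rv.
Proof.
move=> u; apply/rowP => i; rewrite mxE /=.
case: i => [[|[|//]] p] /=; congr (u _ _); exact: val_inj.
Qed.

Lemma rvK : cancel rv cx.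
Proof. by move=> z; apply: complex_eqP; rewrite /cx /= mxE. Qed.

Lemma zpowE j z : zpow j z = rv (cx z ^+ j).
Proof. by []. Qed.

Lemma cxB u v : cx (u - v) = cx u - cx v.
Proof. by apply: complex_eqP; rewrite /= ?ReB ?ImB /= !mxE. Qed.

Lemma rvB z w : rv (z - w) = rv z - rv w.
Proof. by apply/rowP => i; rewrite !mxE; case: ifP => _; rewrite ?ReB ?ImB. Qed.

Lemma rvZ (t : R) z : rv (Complex t 0 * z) = t *: rv z.
Proof.
apply/rowP => i; rewrite !mxE; case: ifP => _; rewrite ?ReM ?ImM /=; ring.
Qed.

Lemma mul_cmat u d : u *m cmat d = rv (cx u * d).
Proof.
apply/rowP => i; rewrite mxE !big_ord_recl big_ord0 /= !mxE /= ?mxE /=.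
have -> : lift ord0 ord0 = 1 :> 'I_2 by exact: val_inj.
by case: ifP => _; rewrite ?ReM ?ImM /=; ring.
Qed.

Lemma det_cmat d : \det (cmat d) = Re d ^+ 2 + Im d ^+ 2.
Proof.
rewrite (expand_det_row _ 0) !big_ord_recl big_ord0 /cofactor !det_mx11 !mxE /=.
rewrite ?mxE /= ?mxE /= ?ReM ?ImM /=; ring.
Qed.

(** The determinant is the squared modulus of [d]. The orientation of the surfaces, of the tubes and
    of the covering all rest on this. *)
Lemma det_cmat_gt0 d : d != 0 -> 0 < \det (cmat d).
Proof.
move=> d0; rewrite det_cmat lt0r addr_ge0 ?sqr_ge0 // andbT.
rewrite paddr_eq0 ?sqr_ge0 // !sqrf_eq0; apply/negP => /andP[/eqP h1 /eqP h2].
by move/eqP: d0; apply; apply: complex_eqP.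
Qed.

Lemma nbhs_row2 (u : 'rV[R]_2) (A : set 'rV[R]_2) :
  nbhs u A <-> nbhs (cx u) (rv @^-1` A).
Proof.
split.
  move=> /nbhs_ballP[e /= e0 eA]; apply/nbhs_box; exists e => // z [h0 h1].
  apply: eA; split=> // i j; rewrite ord1 mxE -ball_normE /= distrC.
  case: j => [[|[|//]] p] /=.
    by rewrite (_ : Ordinal p = 0) //; exact: val_inj.
  by rewrite (_ : Ordinal p = 1) //; exact: val_inj.
move=> /nbhs_box[e e0 eA]; apply/nbhs_ballP; exists e => // v [_ uv].
rewrite -(cxK v); apply: eA.
by split; have := uv 0; [move=> /(_ 0)|move=> /(_ 1)]; rewrite -ball_normE /= distrC.
Qed.

Lemma continuous_cx (u : 'rV[R]_2) : {for u, continuous cx}.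
Proof.
move=> A hA; apply/nbhs_row2; rewrite /preimage /= .
by apply: filterS hA => z; rewrite /= rvK.
Qed.

Lemma continuous_rv (z : K) : {for z, continuous rv}.
Proof.
by move=> A; rewrite nbhs_row2 rvK.
Qed.

Lemma normr_row2_le (u : 'rV[R]_2) (e : R) :
  0 <= e -> `|u 0 0| <= e -> `|u 0 1| <= e -> `|u| <= e.
Proof.
move=> e0 h0 h1; rewrite /Num.norm /= mx_normrE; apply/bigmax_leP; split=> //= -[i j] _ /=.
rewrite ord1; case: j => [[|[|//]] p] /=.
  by rewrite (_ : Ordinal p = 0) //; exact: val_inj.
by rewrite (_ : Ordinal p = 1) //; exact: val_inj.
Qed.

Lemma normr_row2_ge (u : 'rV[R]_2) i : `|u 0 i| <= `|u|.
Proof.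
rewrite [X in _ <= X]/Num.norm /= mx_normrE.
exact: (@le_bigmax _ _ _ _ (fun ij => `|u ij.1 ij.2|) (0, i)).
Qed.

Lemma cder_jac (F : K -> K) (A : set 'rV[R]_2) u d : cder F (cx u) d ->
  jac_within (rv \o F \o cx) A u (cmat d).
Proof.
move=> [p cp [pd E]] eps e0; apply: cvg_within.
have cpx : {for u, continuous (p \o cx)}.
  by apply: continuous_comp; [exact: continuous_cx|exact: cp].
(* Each coordinate of a complex product is a sum of two real products, and each of these is granted
   half of [eps]. *)
have nu : \forall v \near u, box d (eps / 2) (p (cx v)).
  apply: cpx; rewrite /= pd; apply/nbhs_box.
  by exists (eps / 2) => //; rewrite divr_gt0.
near=> v; have [/= h0 h1] : box d (eps / 2) (p (cx v)) by near: v.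
rewrite /= mul_cmat cxB E -!rvB.
have -> : F (cx u) + p (cx v) * (cx v - cx u) - F (cx u) - (cx v - cx u) * d =
    (p (cx v) - d) * (cx v - cx u) by ring.
set q := p (cx v) - d in h0 h1 *.
have hq0 : `|Re q| <= eps / 2 by rewrite ReB ltW.
have hq1 : `|Im q| <= eps / 2 by rewrite ImB ltW.
have k0 : `|Re (cx v - cx u)| <= `|v - u|.
  by rewrite -cxB /=; exact: normr_row2_ge.
have k1 : `|Im (cx v - cx u)| <= `|v - u|.
  by rewrite -cxB /=; exact: normr_row2_ge.
have split_eps : eps * `|v - u| = eps / 2 * `|v - u| + eps / 2 * `|v - u|.
  by rewrite -mulrDl -splitr.
apply: normr_row2_le; first by rewrite mulr_ge0 // ltW.
  rewrite mxE /= ReM split_eps (le_trans (ler_normB _ _)) // !normrM.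
  by apply: lerD; apply: ler_pM.
rewrite mxE /= ImM split_eps (le_trans (ler_normD _ _)) // !normrM.
by apply: lerD; apply: ler_pM.
Unshelve. all: by end_near. Qed.

Lemma cder_derivable (F : K -> K) u d (v : 'rV[R]_2) : cder F (cx u) d ->
  is_derive u v (rv \o F \o cx) (rv (d * cx v)).
Proof.
move=> [p cp [pd E]].
have cpx : {for u, continuous (fun w => rv (p (cx w) * cx v))}.
  apply: (continuous_comp (f := fun w => p (cx w) * cx v)); last exact: continuous_rv.
  apply: continuousM; last exact: cst_continuous.
  by apply: continuous_comp; [exact: continuous_cx|exact: cp].
have dlim : (fun h : R => h^-1 *: (((rv \o F \o cx) \o shift u) (h *: v) - (rv \o F \o cx) u)) @ 0^'
    --> rv (d * cx v).
  have cl : {for 0, continuous (fun h : R => rv (p (cx (h *: v + u)) * cx v))}.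
    apply: (continuous_comp (f := fun h : R => h *: v + u)
      (g := fun w => rv (p (cx w) * cx v))).
      apply: continuousD; last exact: cst_continuous.
      by apply: continuousZr_tmp; exact: continuous_at_id.
    by rewrite scale0r add0r.
  have : (fun h : R => rv (p (cx (h *: v + u)) * cx v)) @ 0^' --> rv (d * cx v).
    rewrite -pd -[u in X in _ --> X]add0r -(scale0r v).
    by apply: cvg_trans cl; apply: cvg_app; exact: cvg_within.
  apply: near_eq_cvgto; near=> h => /=.
  have h0 : h != 0 by near: h; exact: nbhs_dnbhs_neq.
  rewrite /= E -rvB addrAC subrr add0r -cxB addrK.
  have -> : cx (h *: v) = Complex h 0 * cx v.
    by apply: (can_inj rvK); rewrite rvZ !cxK.
  by rewrite mulrCA rvZ scalerA mulVf // scale1r.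
split; first by apply/cvg_ex; exists (rv (d * cx v)).
exact: cvg_lim dlim.
Unshelve. all: by end_near. Qed.

Lemma Ck_on_ext n m r (F G : 'rV[R]_n -> 'rV[R]_m) U : open U ->
  (forall u, U u -> F u = G u) -> Ck_on r F U -> Ck_on r G U.
Proof.
move=> oU; elim: r F G => [|r IH] F G FG [cF dF].
  split=> // u Uu; apply: near_eq_continuous (cF u Uu).
  by apply: filterS (open_nbhs_nbhs (conj oU Uu)) => x; exact: FG.
have nFG u : U u -> \forall x \near u, F x = G x.
  by move=> Uu; apply: filterS (open_nbhs_nbhs (conj oU Uu)) => x; exact: FG.
split=> [u Uu|i]; first exact: near_eq_continuous (nFG u Uu) (cF u Uu).
have [dFi CFi] := dF i; split=> [u Uu|].
  exact: near_eq_derivable (nFG u Uu) (dFi u Uu).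
by apply: IH CFi => u Uu; exact: near_eq_derive (nFG u Uu).
Qed.

(** A partial derivative of [F] is [F'] times a constant, so the induction passes to [F']. The extra
    order pays for the continuity of the last derivative, since [hol 0] says nothing. *)
Lemma hol_Ck_on r (F : K -> K) (U : set K) : open U -> hol r.+1 F U ->
  Ck_on r (rv \o F \o cx) (cx @^-1` U).
Proof.
move=> oU; have oU' : open (cx @^-1` U).
  by apply: open_comp => // u _; exact: continuous_cx.
have cF (G G' : K -> K) u : cder G (cx u) (G' (cx u)) ->
    {for u, continuous (rv \o G \o cx)}.
  move=> /cder_continuous cF; apply: continuous_comp; first exact: continuous_cx.
  by apply: continuous_comp; [exact: cF|exact: continuous_rv].
elim: r F => [|r IH] F [F' dF hF'].
  by split=> [u Uu|//]; exact: (cF F F' u (dF _ Uu)).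
split=> [u Uu|i]; first exact: (cF F F' u (dF _ Uu)).
split=> [u Uu|]; first by have [] := cder_derivable (delta_mx 0 i) (dF _ Uu).
apply: (@Ck_on_ext _ _ _ (rv \o (fun z => F' z * cx (delta_mx 0 i)) \o cx)) => //.
  by move=> u Uu; have [_ ->] := cder_derivable (delta_mx 0 i) (dF _ Uu).
by apply: IH; apply: holM => //; exact: hol_cst.
Qed.

Lemma hol_smooth (F : K -> K) (U : set K) : open U ->
  (forall r, hol r F U) -> forall r, Ck_on r (rv \o F \o cx) (cx @^-1` U).
Proof. by move=> oU hF r; exact: hol_Ck_on. Qed.

(** A differential within [A] is tested at points of [A] only, so it is determined in the directions
    in which [A] contains a short segment starting at [u]. This serves both for interior points and
    for the boundary of the disk. *)
Lemma jac_within_dir n m (F : 'rV[R]_n -> 'rV[R]_m) A u J J' (d : 'rV[R]_n) :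
  jac_within F A u J -> jac_within F A u J' ->
  (\forall t \near 0^'+, A (u + t *: d)) -> d *m J = d *m J'.
Proof.
move=> hJ hJ' At; apply/eqP; rewrite -subr_eq0 -normr_eq0.
apply: contraT; rewrite -normr_gt0 normr_id => c0; set c := `|_| in c0.
(* The errors of the two approximations then add up to [c] times the norm of [d] divided by that
   norm plus 1, which is less than [c]; the 1 keeps the denominator positive. *)
pose eps := c / (2 * (`|d| + 1)).
have d1 : 0 < `|d| + 1 by rewrite ltr_wpDl.
have eps0 : 0 < eps by rewrite divr_gt0 // mulr_gt0.
have cvu : (fun t : R => u + t *: d) @ 0^'+ --> u.
  have : {for 0, continuous (fun t : R => u + t *: d)}.
    apply: continuousD; first exact: cst_continuous.
    by apply: continuousZr_tmp; exact: continuous_at_id.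
  rewrite /prop_for /continuous_at scale0r addr0.
  by apply: cvg_trans; apply: cvg_app; exact: cvg_within.
have h1 : \forall t \near 0^'+, A (u + t *: d) ->
    `|F (u + t *: d) - F u - (u + t *: d - u) *m J| <= eps * `|u + t *: d - u|.
  exact: (cvu _ (hJ _ eps0)).
have h2 : \forall t \near 0^'+, A (u + t *: d) ->
    `|F (u + t *: d) - F u - (u + t *: d - u) *m J'| <= eps * `|u + t *: d - u|.
  exact: (cvu _ (hJ' _ eps0)).
have [t [t0 {At h1 h2} [k1 k2]]] : exists t : R, 0 < t /\
    (`|F (u + t *: d) - F u - (u + t *: d - u) *m J| <= eps * `|u + t *: d - u| /\
     `|F (u + t *: d) - F u - (u + t *: d - u) *m J'| <= eps * `|u + t *: d - u|).
  apply: (@filter_ex _ 0^'+); near=> t; split; first by near: t; exact: nbhs_right_gt.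
  have Att : A (u + t *: d) by near: t.
  by split; move: Att; near: t.
move: k1 k2; rewrite (addrC u) addrK; set G := F _ - F u => k1 k2.
have : `|t *: d *m J - t *: d *m J'| <= eps * `|t *: d| + eps * `|t *: d|.
  rewrite (_ : _ - _ = (G - t *: d *m J') - (G - t *: d *m J)); last first.
    by rewrite opprB [RHS]addrC addrA subrK.
  by rewrite (le_trans (ler_normB _ _)) // lerD.
rewrite -!scalemxAl -scalerBr !normrZ gtr0_norm // -/c -mulrDl => h.
exfalso; have : c <= (eps + eps) * `|d|.
  by rewrite -(ler_pM2l t0) (le_trans h) // mulrCA.
have -> : eps + eps = c / (`|d| + 1).
  by rewrite /eps; field; rewrite gt_eqF.
rewrite mulrAC ler_pdivlMr // ler_pM2l // gerDl; lra.
Unshelve. all: by end_near. Qed.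

Lemma jac_within_nbhs n m (F : 'rV[R]_n -> 'rV[R]_m) A u J J' :
  nbhs u A -> jac_within F A u J -> jac_within F A u J' -> J = J'.
Proof.
move=> Au hJ hJ'; apply/row_matrixP => i; rewrite !rowE.
apply: (jac_within_dir hJ hJ').
have : {for 0, continuous (fun t : R => u + t *: (delta_mx 0 i : 'rV[R]_n))}.
  apply: continuousD; first exact: cst_continuous.
  by apply: continuousZr_tmp; exact: continuous_at_id.
rewrite /prop_for /continuous_at scale0r addr0 => h.
by apply: cvg_within; exact: (h _ Au).
Qed.

Lemma jac_within_near n m (F G : 'rV[R]_n -> 'rV[R]_m) A u J :
  A u -> (\forall v \near u, A v -> F v = G v) ->
  jac_within F A u J -> jac_within G A u J.
Proof.
move=> Au FG hJ eps e0; have FGu : F u = G u by exact: (nbhs_singleton FG).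
have h : \forall v \near u, A v ->
    `|F v - F u - (v - u) *m J| <= eps * `|v - u| by exact: hJ e0.
rewrite near_withinE; near=> v => Av; rewrite -FGu.
have <- : F v = G v by move: Av; near: v.
by move: Av; near: v.
Unshelve. all: by end_near. Qed.

End RowVectors.

(** * Surfaces from holomorphic atlases *)

Section Atlas.
Variable R : realType.
Local Notation K := (cplx R).
Local Notation Re := (@complex.Re R).

(* [aoff] is a translation moving all chart images into the open half-plane
   [0 < Re w], so that no chart has boundary points. *)
Record atlas := Atlas {
  apts : choiceType;
  aidx : finType;
  adom : aidx -> set K;
  aphi : aidx -> K -> apts;
  apsi : aidx -> apts -> K;
  aoff : R;
  adom_open : forall a, open (adom a);
  adom_cover : forall p, exists a w, adom a w /\ aphi a w = p;
  aphiK : forall a w, adom a w -> apsi a (aphi a w) = w;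
  acompat : forall a b w w', adom a w -> adom b w' -> aphi a w = aphi b w' ->
    exists (U : set K) (T : K -> K),
      [/\ open U, forall r, hol r T U, U w
        & forall x, U x -> [/\ adom a x, adom b (T x) & aphi b (T x) = aphi a x]];
  aoff_gt0 : forall a w, adom a w -> 0 < Re w + aoff;
  aseparated : forall a b w w', adom a w -> adom b w' -> aphi a w <> aphi b w' ->
    exists U V : set K, [/\ open U, open V, U w, V w'
      & forall x y, U x -> adom a x -> V y -> adom b y -> aphi a x <> aphi b y]
}.

Variable X : atlas.
Definition apoint : Type := apts X.
HB.instance Definition _ := Choice.on apoint.

(** The final topology for the parametrizations: it makes them continuous at once, while their
    openness has to be derived from [acompat]. *)
Definition aopen (W : set apoint) : Prop :=
  forall a, open [set w | @adom X a w /\ W (aphi a w)].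

Lemma aopenT : aopen setT.
Proof.
move=> a; rewrite (_ : mkset _ = @adom X a); first exact: adom_open.
by apply/seteqP; split=> w //= [].
Qed.

Lemma aopenI : setI_closed aopen.
Proof.
move=> A B oA oB a; rewrite (_ : mkset _ =
  [set w | @adom X a w /\ A (aphi a w)] `&` [set w | @adom X a w /\ B (aphi a w)]).
  exact: openI.
by apply/seteqP; split=> [w /= [? [? ?]]|w /= [[? ?] [? ?]]].
Qed.

Lemma aopen_bigU (I : Type) (f : I -> set apoint) :
  (forall i, aopen (f i)) -> aopen (\bigcup_i f i).
Proof.
move=> of_ a; rewrite (_ : mkset _ =
  \bigcup_i [set w | @adom X a w /\ f i (aphi a w)]).
  by apply: bigcup_open => i _; exact: of_.
by apply/seteqP; split=> [w /= [? [i _ ?]]|w /= [i _ [? ?]]]; [exists i|split=> //; exists i].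
Qed.

HB.instance Definition _ :=
  isOpenTopological.Build apoint aopenT aopenI aopen_bigU.

Definition cover_phi a : K -> apoint := @aphi X a.
Local Notation phi := cover_phi.
Local Notation D := (@adom X).
Local Notation psi := (@apsi X : aidx X -> apoint -> K).

Lemma open_atlasP (W : set apoint) : open W <-> aopen W.
Proof. by []. Qed.

(** Read in another chart, the image of [U] is locally the preimage of [U] under the transition map,
    which is continuous. *)
Lemma open_phi a (U : set K) : open U -> U `<=` D a -> open (phi a @` U).
Proof.
move=> oU UD; apply/open_atlasP => b.
rewrite openE => w [Dw [x Ux xw]].
have [V [T [oV hT Vw VT]]] := acompat Dw (UD _ Ux) (esym xw).
have cT : {for w, continuous T}.
  by have [T' dT _] := hT 1%N; exact: cder_continuous (dT _ Vw).
have Tw : T w = x.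
  by have [_ DT e] := VT _ Vw; rewrite -(aphiK DT) e -xw; exact: aphiK (UD _ Ux).
have UT : \forall y \near w, U (T y).
  by apply: (cT U); rewrite Tw; exact: open_nbhs_nbhs.
rewrite /interior; near=> y.
have Vy : V y by near: y; exact: open_nbhs_nbhs.
have [Dy _ e] := VT _ Vy; split=> //; exists (T y); last exact: e.
by near: y.
Unshelve. all: by end_near. Qed.

Lemma continuous_phi a w : D a w -> {for w, continuous (phi a)}.
Proof.
move=> Dw A; rewrite nbhsE => -[W [oW Ww] WA].
have : nbhs w [set w | D a w /\ W (phi a w)].
  by apply: open_nbhs_nbhs; split=> //; exact: (oW a).
by move=> h; apply: filterS h => x [_ /WA].
Qed.

Lemma phiK a w : D a w -> psi a (phi a w) = w.
Proof. exact: aphiK. Qed.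

Lemma continuous_psi a w : D a w -> {for phi a w, continuous (psi a)}.
Proof.
move=> Dw A; rewrite phiK // nbhsE => -[U [oU Uw] UA].
have : nbhs (phi a w) (phi a @` (U `&` D a)).
  apply: open_nbhs_nbhs; split; last by exists w.
  by apply: open_phi; [apply: openI => //; exact: adom_open|move=> x []].
move=> h; apply: filterS h => _ [x [Ux Dx] <-] /=.
by rewrite phiK //; exact: UA.
Qed.

Lemma open_phi_dom a : open (phi a @` D a).
Proof. by apply: open_phi => //; exact: adom_open. Qed.

Lemma atlas_hausdorff : hausdorff_space apoint.
Proof.
rewrite open_hausdorff => p q pq.
have [a [w [Dw ep]]] := adom_cover p; have [b [w' [Dw' eq]]] := adom_cover q.
have ne : aphi a w <> aphi b w' by rewrite ep eq; exact/eqP.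
have [U [V [oU oV Uw Vw h]]] := aseparated Dw Dw' ne.
exists (phi a @` (U `&` D a), phi b @` (V `&` D b)) => /=.
  by split; apply/mem_set; [exists w|exists w'].
split; [by apply: open_phi; [apply: openI => //; exact: adom_open|move=> x []]..|].
apply/eqP; rewrite -subset0 => _ [[x [Ux Dx] <-] [y [Vy Dy] e]].
exact: (h _ _ Ux Dx Vy Dy (esym e)).
Qed.

Definition rat_box (q : rat * rat * rat) : set K :=
  box (Complex (ratr q.1.1) (ratr q.1.2)) (ratr q.2).

Lemma nbhs_rat_box (w : K) (A : set K) : nbhs w A ->
  exists2 q, rat_box q w & rat_box q `<=` A.
Proof.
move=> /nbhs_box[e e0 eA].
have rat_near (x : R) (d : R) : 0 < d -> exists q : rat, `|x - ratr q| < d.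
  move=> d0; have [|q] := @rat_in_itvoo _ (x - d) (x + d); first lra.
  by rewrite in_itv /= => /andP[h1 h2]; exists q; rewrite ltr_norml; lra.
(* The rational centre is within [e / 4] of [w] in both coordinates. A radius above [e / 4] keeps
   [w] in the box, and one below [e / 2] keeps the box within [e] of [w]. *)
have [|d] := @rat_in_itvoo _ (e / 4) (e / 2); first lra.
rewrite in_itv /= => /andP[h1 h2].
have e4 : 0 < e / 4 by lra.
have [q1 k1] := rat_near (Re w) _ e4.
have [q2 k2] := rat_near (complex.Im w) _ e4.
exists (q1, q2, d) => [|z [/= z1 z2]]; first by split=> /=; lra.
by apply: eA; split; move: z1 z2 k1 k2; rewrite !ltr_norml; lra.
Qed.

Lemma atlas_second_countable : @second_countable apoint.
Proof.
pose B := (fun aq : aidx X * (rat * rat * rat) => phi aq.1 @` rat_box aq.2) @`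
  [set aq | rat_box aq.2 `<=` D aq.1].
exists B; first exact: (sub_countable (card_image_le _ _) (countableP _)).
split=> [_ [[a q] /= qD <-]|p W]; first by apply: open_phi => //; exact: open_box.
have [a [w [Dw <-]]] := adom_cover p.
move=> /(continuous_phi Dw) h.
have /nbhs_rat_box[q qw qA] : nbhs w (D a `&` phi a @^-1` W).
  by apply: filterI => //; apply: open_nbhs_nbhs; split=> //; exact: adom_open.
exists (phi a @` rat_box q); last by move=> _ [x /qA[_ ?] <-].
by split; [exists (a, q) => //= x /qA[]|exists w].
Qed.

Definition aB : K := Complex (aoff X) 0.
Definition achart a (p : apoint) : 'rV[R]_2 := rv (psi a p + aB).
Definition aparam a (u : 'rV[R]_2) : apoint := phi a (cx u - aB).

Lemma achartK a p : (phi a @` D a) p -> aparam a (achart a p) = p.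
Proof. by move=> [w Dw <-]; rewrite /aparam /achart rvK addrK phiK. Qed.

Lemma achart_phi a w : D a w -> achart a (phi a w) = rv (w + aB).
Proof. by move=> Dw; rewrite /achart phiK. Qed.

Lemma open_shift (U : set K) (c : K) : open U ->
  open [set u : 'rV[R]_2 | U (cx u + c)].
Proof.
move=> oU; apply: (@open_comp _ _ (fun u => cx u + c) U) => // u _.
apply: continuousD; [exact: continuous_cx|exact: cst_continuous].
Qed.

Lemma achart_image a : exists2 U : set 'rV[R]_2, open U &
  achart a @` (phi a @` D a) = U `&` @halfspace R 2.
Proof.
exists [set u | D a (cx u - aB)]; first by apply: open_shift; exact: adom_open.
apply/seteqP; split=> [_ [_ [w Dw <-] <-]|u [/= Du _]].
  rewrite achart_phi //=; split; first by rewrite /= rvK addrK.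
  move=> [[|[|//]] p] //= _; rewrite mxE /= ReD /=; exact/ltW/aoff_gt0/Dw.
by exists (phi a (cx u - aB)); [exists (cx u - aB)|rewrite achart_phi // subrK cxK].
Qed.

Lemma achart_continuous a : {within phi a @` D a, continuous (achart a)}.
Proof.
apply: continuous_in_subspaceT => p /set_mem[w Dw <-].
apply: (continuous_comp (f := fun p : apoint => psi a p + aB : K) (g := @rv R)).
  by apply: continuousD; [exact: continuous_psi|exact: cst_continuous].
exact: continuous_rv.
Qed.

Lemma aparam_continuous a :
  {within achart a @` (phi a @` D a), continuous (aparam a)}.
Proof.
apply: continuous_in_subspaceT => u /set_mem[_ [w Dw <-] <-].
rewrite achart_phi //.
apply: (continuous_comp (f := fun u : 'rV[R]_2 => cx u - aB) (g := phi a)).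
  by apply: continuousD; [exact: continuous_cx|exact: cst_continuous].
by rewrite rvK addrK; exact: continuous_phi.
Qed.

End Atlas.

Section Manifold.
Variable R : realType.
Local Notation K := (cplx R).
Local Notation phi := cover_phi.

Section Maps.
Variables (X Y : atlas R) (f : apoint X -> apoint Y).

(** [T] expresses [f] in the complex coordinates before the translation by [aB]; that translation
    enters only when passing to real charts, in [hrep_extension]. *)
Definition hrep (a : aidx X) (b : aidx Y) (U : set K) (T : K -> K) : Prop :=
  [/\ open U, forall r, hol r T U
    & forall x, U x -> [/\ adom a x, adom b (T x) & phi b (T x) = f (phi a x)]].

Lemma hrep_psi a b U T x : hrep a b U T -> U x -> apsi b (f (phi a x)) = T x.
Proof. by move=> [_ _ h] /h[_ Db <-]; exact: phiK. Qed.

Lemma hrep_cder a b U T x : hrep a b U T -> U x -> exists d, cder T x d.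
Proof. by move=> [_ hT _] Ux; have [T' dT _] := hT 1%N; exists (T' x); exact: dT. Qed.

Lemma hrep_continuous a b U T x : hrep a b U T -> U x -> {for x, continuous T}.
Proof. by move=> h Ux; have [d] := hrep_cder h Ux; exact: cder_continuous. Qed.

Lemma cder_shift (F : K -> K) z c d : cder F (z + c) d ->
  cder (fun x => F (x + c)) z d.
Proof.
move=> dF; rewrite -[d]mulr1; apply: (cder_comp (F := fun x => x + c)) => //.
by rewrite -[1]addr0; apply: cderD; [exact: cder_id|exact: cder_cst].
Qed.

Lemma hol_shift r (F : K -> K) (U : set K) c : hol r F U ->
  hol r (fun x => F (x + c)) [set x | U (x + c)].
Proof.
move=> hF; apply: (hol_comp (F := fun x => x + c) (V := U)) => //.
by apply: holD; [exact: hol_id|exact: hol_cst].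
Qed.

Lemma open_shiftC (U : set K) (c : K) : open U -> open [set x | U (x + c)].
Proof.
move=> oU; apply: (@open_comp _ _ (fun x : K => x + c) U) => // x _.
by apply: continuousD; [exact: continuous_at_id|exact: cst_continuous].
Qed.

(** The bridge from complex expressions to the real notions of smoothness and differential. The map
    [G] is smooth on an open subset of the plane, so its differential is valid within every set
    [A]. *)
Lemma hrep_extension a b U T w : hrep a b U T -> U w ->
  exists (V : set 'rV[R]_2) (G : 'rV[R]_2 -> 'rV[R]_2),
  [/\ open V, V (rv (w + aB X)), forall r, Ck_on r G V,
      forall v, V v -> U (cx v - aB X) /\ achart b (f (aparam a v)) = G v
    & forall d, cder T w d -> forall A, jac_within G A (rv (w + aB X)) (cmat d)].
Proof.
move=> h Uw; have [oU hT e] := h.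
pose F z := T (z - aB X) + aB Y.
have oU' : open [set x | U (x - aB X)] by exact: open_shiftC.
exists [set v | U (cx v - aB X)], (@rv R \o F \o @cx R); split.
- exact: open_shift.
- by rewrite /= rvK addrK.
- apply: (@hol_smooth _ F [set x | U (x - aB X)]) => // r.
  by apply: holD; [exact: hol_shift (hT r)|exact: hol_cst].
- move=> v /= Uv; split=> //; have [? ? ev] := e _ Uv.
  by rewrite /aparam -ev achart_phi.
- move=> d dT A; apply: cder_jac; rewrite rvK -[d]addr0.
  by apply: cderD; [apply: cder_shift; rewrite addrK|exact: cder_cst].
Qed.

End Maps.

Lemma hrep_comp (X Y Z : atlas R) (f : apoint X -> apoint Y)
    (g : apoint Y -> apoint Z) a b c U V T S :
  hrep f a b U T -> hrep g b c V S ->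
  hrep (g \o f) a c (U `&` T @^-1` V) (S \o T).
Proof.
move=> hf hg; have [oU hT eT] := hf; have [oV hS eS] := hg; split.
- rewrite openE => x [Ux VTx]; rewrite /interior; near=> y; split.
    by near: y; exact: open_nbhs_nbhs.
  near: y; apply: (hrep_continuous hf Ux); exact: open_nbhs_nbhs.
- move=> r; apply: (@hol_comp _ _ _ _ _ V) => //; first by move=> z [].
  by apply: hol_sub (hT r) => z [].
- by move=> x [/eT[? ? e] /eS[? ? e']]; split=> //=; rewrite e' e.
Unshelve. all: by end_near. Qed.

Lemma atlas_trans (X : atlas R) a b w w' : adom a w -> adom b w' ->
  phi a w = phi b w' :> apoint X ->
  exists (U : set K) (T : K -> K), [/\ hrep (@idfun (apoint X)) a b U T, U w & T w = w'].
Proof.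
move=> Da Db e; have [U [T [oU hT Uw UT]]] := acompat Da Db e.
exists U, T; split=> //; have [_ DT eT] := UT _ Uw.
by rewrite -(phiK DT) -(phiK Db) -e /phi eT.
Qed.

(** The transition back is a local left inverse, so by the chain rule the product of the two
    derivatives is 1. *)
Lemma atlas_trans_neq0 (X : atlas R) a b U T w d :
  hrep (@idfun (apoint X)) a b U T -> U w -> cder T w d -> d != 0.
Proof.
move=> h Uw dT; have [oU hT /(_ _ Uw)[Da Db e]] := h.
have [V [S [h' VTw STw]]] := atlas_trans Db Da e.
have [d' dS] := hrep_cder h' VTw.
have : cder (S \o T) w 1.
  apply: (@cder_near _ id); last exact: cder_id.
  have [oUV _ /= eUV] := hrep_comp h h'.
  have : nbhs w (U `&` T @^-1` V) by apply: open_nbhs_nbhs; split.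
  move=> nUV; near=> x.
  have UVx : (U `&` T @^-1` V) x by near: x.
  by have [? ?] := eUV _ UVx; move=> /(congr1 (apsi a)); rewrite !phiK.
move=> /(cder_uniq (cder_comp dT dS)) dd.
by apply/eqP => d0; move/eqP: dd; rewrite d0 mulr0 eq_sym oner_eq0.
Unshelve. all: by end_near. Qed.

Lemma amfd_transition (X : atlas R) (a b : aidx X) :
  smooth_on (achart b \o aparam a)
    (achart a @` (phi a @` adom a `&` phi b @` adom b)).
Proof.
move=> _ [_ [[w Dw <-] [w' Dw' e]] <-]; rewrite achart_phi //.
have [U [T [h Uw _]]] := atlas_trans Dw Dw' (esym e).
have [V [G [oV Vw hG eG _]]] := hrep_extension h Uw.
by exists V, G; split=> // v _ /eG[].
Qed.

Definition amfd0 (X : atlas R) : manifold R 2 :=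
  @Manifold R 2 (apoint X) (aidx X) (fun a => phi a @` adom a)
    (@achart R X) (@aparam R X) (@atlas_hausdorff R X)
    (@atlas_second_countable R X) (@open_phi_dom R X)
    (fun p => let: ex_intro a (ex_intro w (conj Dw e)) := adom_cover p in
       ex_intro _ a (ex_intro2 _ _ w Dw e))
    (@achartK R X) (@achart_image R X) (@achart_continuous R X)
    (@aparam_continuous R X) (@amfd_transition X).

Lemma amfd_boundary (X : atlas R) : boundary (amfd0 X) = set0.
Proof.
rewrite -subset0 => p [a [/= [w Dw <-] [i i0]]].
rewrite achart_phi // mxE -val_eqE /= i0 /= ReD /= => /eqP.
by rewrite gt_eqF // (aoff_gt0 Dw).
Qed.

Lemma amfd_compact (X : atlas R) (C : aidx X -> set K) :
  (forall a, compact (C a)) -> (forall a, C a `<=` adom a) ->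
  (forall p : apoint X, exists a w, C a w /\ phi a w = p) ->
  compact [set: amfd0 X].
Proof.
move=> cC CD cover.
have -> : [set: amfd0 X] = \big[setU/set0]_(a : aidx X) (phi a @` C a).
  apply/seteqP; split=> // p _; have [a [w [Cw <-]]] := cover p.
  rewrite -(bigcup_seq (index_enum (aidx X)) (fun a => phi a @` C a)).
  by exists a; [exact: mem_index_enum|exists w].
apply: bigsetU_compact => a _; apply: continuous_compact => //.
apply: continuous_in_subspaceT => w /set_mem/CD; exact: continuous_phi.
Qed.

End Manifold.

(** * Holomorphic maps between surfaces *)

Section HolomorphicMaps.
Variable R : realType.
Local Notation K := (cplx R).
Local Notation phi := cover_phi.

Section OneMap.
Variables (X Y : atlas R) (f : apoint X -> apoint Y).

Lemma hrep_dom a b U T w : hrep f a b U T -> U w ->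
  [/\ adom a w, dom (a : cidx (amfd0 X)) (phi a w)
    & dom (b : cidx (amfd0 Y)) (f (phi a w))].
Proof. by move=> [_ _ h] /h[Da Db <-]; split => //; [exists w|exists (T w)]. Qed.

Lemma hrep_jac a b U T w : hrep f a b U T -> U w ->
  exists G, [/\
    nbhs (achart a (phi a w)) (coords (a : cidx (amfd0 X))
      (f @^-1` dom (b : cidx (amfd0 Y)))),
    \forall v \near achart a (phi a w), achart b (f (aparam a v)) = G v
  & forall d, cder T w d ->
      forall A, jac_within G A (achart a (phi a w)) (cmat d)].
Proof.
move=> h Uw; have [V [G [oV Vw _ eG dG]]] := hrep_extension h Uw.
have [Dw _ _] := hrep_dom h Uw.
have nV : nbhs (rv (w + aB X)) V by apply: open_nbhs_nbhs.
rewrite achart_phi //; exists G; split=> //; near=> v.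
  have /eG[Uv _] : V v by near: v.
  have [Dv d1 d2] := hrep_dom h Uv.
  exists (phi a (cx v - aB X)); first by split.
  by rewrite /= achart_phi // subrK cxK.
have Vv : V v by near: v.
by have [] := eG _ Vv.
Unshelve. all: by end_near. Qed.

Lemma hrep_diff a b U T w d : hrep f a b U T -> U w -> cder T w d ->
  diff_at (N := amfd0 X) (M := amfd0 Y) f (phi a w) a b (cmat d).
Proof.
move=> h Uw dT; have [Dw d1 d2] := hrep_dom h Uw.
have [G [nG eG dG]] := hrep_jac h Uw; split=> //.
apply: jac_within_near (dG _ dT _); first exact: nbhs_singleton nG.
near=> v => _; rewrite /local_rep /=; apply/esym; near: v; exact: eG.
Unshelve. all: by end_near. Qed.

Lemma hrep_diff_uniq a b U T w d J : hrep f a b U T -> U w -> cder T w d ->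
  diff_at (N := amfd0 X) (M := amfd0 Y) f (phi a w) a b J -> J = cmat d.
Proof.
move=> h Uw dT [_ _ hJ]; have [G [nG eG dG]] := hrep_jac h Uw.
apply: (jac_within_nbhs nG hJ).
by have [_ _] := hrep_diff h Uw dT.
Qed.

Definition holo_at (p : apoint X) : Prop :=
  exists a b U T w, [/\ hrep f a b U T, U w & phi a w = p].

(** Changing the charts on both sides multiplies the derivative by nonzero factors, so its vanishing
    does not depend on the charts. *)
Lemma hrep_change a b U T w a' w' b' v' : hrep f a b U T -> U w ->
  adom a' w' -> phi a' w' = phi a w -> adom b' v' -> phi b' v' = f (phi a w) ->
  exists U' T', [/\ hrep f a' b' U' T', U' w' & forall d, cder T w d ->
    exists e1 e2, [/\ e1 != 0, e2 != 0 & cder T' w' (e2 * d * e1)]].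
Proof.
move=> h Uw Da' ew' Db' ev'.
have [_ _ /(_ _ Uw)[Da Db eb]] := h.
have [U1 [T1 [h1 U1w T1w]]] := atlas_trans Da' Da ew'.
have eTw : phi b (T w) = phi b' v' by rewrite ev'.
have [U2 [T2 [h2 U2w T2w]]] := atlas_trans Db Db' eTw.
exists (U1 `&` T1 @^-1` (U `&` T @^-1` U2)), ((T2 \o T) \o T1); split.
- exact: (hrep_comp h1 (hrep_comp h h2)).
- by split=> //; rewrite /= /preimage /= T1w.
move=> d dT; have [e1 dT1] := hrep_cder h1 U1w; have [e2 dT2] := hrep_cder h2 U2w.
exists e1, e2; split.
- exact: atlas_trans_neq0 h1 U1w dT1.
- exact: atlas_trans_neq0 h2 U2w dT2.
- by apply: cder_comp => //; rewrite T1w; apply: cder_comp.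
Qed.

Lemma holo_at_chart a b w v : holo_at (phi a w) -> adom a w -> adom b v ->
  phi b v = f (phi a w) -> exists U T, hrep f a b U T /\ U w.
Proof.
move=> [a' [b' [U [T [w' [h Uw' e]]]]]] Da Db ev; rewrite -e in ev.
by have [U' [T' [h' Uw _]]] := hrep_change h Uw' Da (esym e) Db ev; exists U', T'.
Qed.

Lemma holo_at_continuous p : holo_at p -> {for p, continuous f}.
Proof.
move=> [a [b [U [T [w [h Uw <-]]]]]]; have [oU _ e] := h.
have [Dw _ _] := hrep_dom h Uw; have [_ DTw ew] := e _ Uw.
apply: (near_eq_continuous (f := fun q : apoint X => phi b (T (apsi a q)))).
  have : open_nbhs (phi a w) (phi a @` U).
    by split; [apply: open_phi => // x /e[]|exists w].
  move=> /open_nbhs_nbhs nU; near=> q.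
  have [x Ux <-] : (phi a @` U) q by near: q.
  by have [Dx _ ex] := e _ Ux; rewrite /= phiK.
apply: (continuous_comp (f := (apsi a : apoint X -> K)) (g := fun x => phi b (T x))).
  exact: continuous_psi.
rewrite phiK //; apply: (continuous_comp (f := T) (g := phi b)).
  exact: hrep_continuous h Uw.
exact: continuous_phi.
Unshelve. all: by end_near. Qed.

Lemma holo_smooth_on (S : set (apoint X)) : (forall p, S p -> holo_at p) ->
  smooth_map_on (N := amfd0 X) (M := amfd0 Y) f S.
Proof.
move=> hS; split.
  by apply: continuous_in_subspaceT => p /set_mem/hS/holo_at_continuous.
move=> a b _ [_ [[w Dw <-] [Sp [v Dv ev]]] <-].
have [U [T [h Uw]]] := holo_at_chart (hS _ Sp) Dw Dv ev.
have [V [G [oV Vw hG eG _]]] := hrep_extension h Uw.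
exists V, G; split=> //; first by rewrite /= achart_phi.
by move=> u _ /eG[].
Qed.

End OneMap.

Lemma holo_id (X : atlas R) p : holo_at (@idfun (apoint X)) p.
Proof.
have [a [w [Dw e]]] := adom_cover p.
have [U [T [h Uw _]]] := @atlas_trans R X a a w w Dw Dw erefl.
by exists a, a, U, T, w.
Qed.

Lemma amfd_orientation (X : atlas R) :
  is_orientation ((fun _ _ => false) : orientation_data (amfd0 X)).
Proof.
split=> [a p _|a b p J hJ]; first by near=> q.
have [[w Dw ew] [v Dv ev] _] := hJ; rewrite -ew in hJ ev.
have [U [T [h Uw]]] := holo_at_chart (holo_id _) Dw Dv ev.
have [d dT] := hrep_cder h Uw; rewrite (hrep_diff_uniq h Uw dT hJ) !mul1r.
exact: det_cmat_gt0 (atlas_trans_neq0 h Uw dT).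
Unshelve. all: by end_near. Qed.

Definition amfd (X : atlas R) : omanifold R 2 :=
  GManifold (fun _ => @amfd_orientation X).

Section RegularPoints.
Variables (X Y : atlas R) (f : amfd X -> amfd Y).

Lemma hrep_regular a b U T w d : hrep f a b U T -> U w -> cder T w d ->
  d != 0 -> regular_at f (phi a w) /\ preserves_at f (phi a w).
Proof.
move=> h Uw dT d0; have hd := hrep_diff h Uw dT; have g0 := det_cmat_gt0 d0.
split; exists a, b, (cmat d); split=> //.
  by rewrite unitmxE unitfE gt_eqF.
by rewrite /osign /= !expr0 !mul1r.
Qed.

Lemma diff_at_hrep p a b J : holo_at f p -> diff_at f p a b J ->
  exists U T w, [/\ hrep f a b U T, U w, phi a w = p
    & forall d, cder T w d -> J = cmat d].
Proof.
move=> hp hJ; have [[w Dw ew] [v Dv ev] _] := hJ.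
rewrite -ew in hp hJ ev *.
have [U [T [h Uw]]] := holo_at_chart hp Dw Dv ev.
exists U, T, w; split=> // d dT; exact: hrep_diff_uniq h Uw dT hJ.
Qed.

Lemma holo_preserves p : holo_at f p -> regular_at f p -> preserves_at f p.
Proof.
move=> hp [a [b [J [hJ uJ]]]].
have [U [T [w [h Uw <- JE]]]] := diff_at_hrep hp hJ.
have [d dT] := hrep_cder h Uw; move: uJ; rewrite (JE d dT) => uJ.
have [//|_ //] := hrep_regular h Uw dT.
apply/eqP => d0; move: uJ; rewrite unitmxE unitfE det_cmat d0 /=.
by rewrite !expr0n addr0 eqxx.
Qed.

(** Regularity is witnessed by some pair of charts, so all pairs have to be refuted; [hrep_change]
    carries the zero derivative to each of them. *)
Lemma hrep_critical a b U T w : hrep f a b U T -> U w -> cder T w 0 ->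
  ~ regular_at f (phi a w).
Proof.
move=> h Uw dT [a' [b' [J [hJ]]]].
have [[w' Dw' ew'] [v' Dv' ev'] _] := hJ.
have [U' [T' [h' Uw' dT']]] := hrep_change h Uw Dw' ew' Dv' ev'.
have [e1 [e2 [_ _]]] := dT' _ dT; rewrite mulr0 mul0r => dT0.
rewrite -ew' in hJ; rewrite (hrep_diff_uniq h' Uw' dT0 hJ).
by rewrite unitmxE unitfE det_cmat /= !expr0n addr0 eqxx.
Qed.

(** The local inverse is supplied explicitly as [S], which is only related to [T] where the two
    domains match; [U1] and [V1] are the parts of [U] and [V] that [T] and [S] exchange. *)
Lemma hrep_local_diffeo a b U T w V S : hrep f a b U T -> U w ->
  open V -> (forall r, hol r S V) -> V (T w) ->
  (forall x, U x -> V (T x) -> S (T x) = x) -> (forall y, V y -> T (S y) = y) ->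
  S (T w) = w -> local_diffeo f (phi a w).
Proof.
move=> h Uw oV hS VTw ST TS STw; have [oU hT e] := h.
have cT x : U x -> {for x, continuous T} := hrep_continuous h.
have cS y : V y -> {for y, continuous S}.
  by move=> Vy; have [S' dS _] := hS 1%N; exact: cder_continuous (dS _ Vy).
pose U1 := U `&` T @^-1` V; pose V1 := V `&` S @^-1` U.
have oU1 : open U1.
  rewrite openE => x [Ux VTx]; rewrite /interior; near=> y; split.
    by near: y; exact: open_nbhs_nbhs.
  by near: y; apply: (cT x Ux); exact: open_nbhs_nbhs.
have oV1 : open V1.
  rewrite openE => x [Vx USx]; rewrite /interior; near=> y; split.
    by near: y; exact: open_nbhs_nbhs.
  by near: y; apply: (cS x Vx); exact: open_nbhs_nbhs.
have U1D : U1 `<=` adom a by move=> x [/e[]].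
have V1D : V1 `<=` adom b by move=> y [Vy /e[_]]; rewrite TS.
pose g : amfd Y -> amfd X := fun q => phi a (S (apsi b q)).
have gf x : U1 x -> g (f (phi a x)) = phi a x.
  by move=> [Ux Vx]; rewrite /g (hrep_psi h Ux) ST.
have fU1 : f @` (phi a @` U1) = phi b @` V1.
  apply/seteqP; split=> [_ [_ [x [Ux VTx] <-] <-]|_ [y [Vy USy] <-]].
    have [_ DT <-] := e _ Ux; exists (T x) => //; split=> //.
    by rewrite /preimage /= ST.
  exists (phi a (S y)); first by exists (S y) => //; split=> //; rewrite /preimage /= TS.
  by have [_ _ <-] := e _ USy; rewrite TS.
have hg : hrep (g : apoint Y -> apoint X) b a V1 S.
  split=> // [r|y [Vy USy]]; first by apply: hol_sub (hS r) => y [].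
  have [D1 D2] := e _ USy; rewrite TS // in D2 * => ey; split=> //.
  by rewrite /g phiK.
exists (phi a @` U1), g; split.
- split; first exact: open_phi.
  by exists w.
- by rewrite fU1; exact: open_phi.
- by move=> _ [x U1x <-]; exact: gf.
- apply: holo_smooth_on => _ [x [Ux VTx] <-].
  by exists a, b, U, T, x.
- rewrite fU1; apply: holo_smooth_on => _ [y V1y <-].
  by exists b, a, V1, S, y.
Unshelve. all: by end_near. Qed.

End RegularPoints.

End HolomorphicMaps.

(** * Complex roots *)

Section Roots.
Variable R : realType.
Local Notation K := (cplx R).
Local Notation Re := (@complex.Re R).
Local Notation Im := (@complex.Im R).

(** The test [b] may be arbitrary, since both branches are continuous at [t] and agree there. This
    glues branches of roots along a half-line. *)
Lemma continuous_if (T U : topologicalType) (b : pred T) (f g : T -> U) (t : T) :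
  {for t, continuous f} -> {for t, continuous g} -> f t = g t ->
  {for t, continuous (fun x => if b x then f x else g x)}.
Proof.
move=> cf cg fg A; have -> : (if b t then f t else g t) = f t by case: ifP.
move=> nA; have nf : \forall x \near t, A (f x) by exact: cf.
have ng : \forall x \near t, A (g x) by apply: cg; rewrite /= -fg.
suff : \forall x \near t, A (if b x then f x else g x) by [].
near=> x; have Af : A (f x) by near: x.
have Ag : A (g x) by near: x.
by rewrite /=; case: ifP.
Unshelve. all: by end_near. Qed.

Lemma cvg_dist_lt (T : Type) (F : set_system T) (FF : Filter F) (f : T -> R)
    (l : R) :
  (forall e, 0 < e -> \forall x \near F, `|l - f x| < e) -> f @ F --> l.
Proof. by move=> h; apply/cvgrPdist_lt. Qed.

Lemma near_continuous (T U : topologicalType) (f : T -> U) (t : T) (A : set U) :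
  {for t, continuous f} -> (\forall y \near f t, A y) ->
  \forall x \near t, A (f x).
Proof. by move=> cf h; apply: (cf A). Qed.

Lemma near_continuous_lt (T : topologicalType) (f : T -> R) (t : T) (c : R) :
  {for t, continuous f} -> f t < c -> \forall x \near t, f x < c.
Proof. by move=> cf h; apply: (cf [set y | y < c]); exact: lt_nbhsl. Qed.

Lemma near_continuous_gt (T : topologicalType) (f : T -> R) (t : T) (c : R) :
  {for t, continuous f} -> c < f t -> \forall x \near t, c < f x.
Proof. by move=> cf h; apply: (cf [set y | c < y]); exact: lt_nbhsr. Qed.

Definition cis (t : R) : K := Complex (cos t) (sin t).

Lemma cisD s t : cis (s + t) = cis s * cis t.
Proof.
by apply: complex_eqP; rewrite ?ReM ?ImM /= ?cosD ?sinD //; ring.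
Qed.

Lemma cis0 : cis 0 = 1.
Proof. by rewrite /cis cos0 sin0. Qed.

Lemma cisX n t : cis t ^+ n = cis (n%:R * t).
Proof.
elim: n => [|n IH]; first by rewrite mul0r cis0.
by rewrite exprS IH -cisD -natr1 mulrDl mul1r addrC.
Qed.

Lemma cis_neq0 t : cis t != 0.
Proof.
apply/eqP => /(congr1 (fun z => z * cis (- t))); rewrite -cisD subrr cis0 mul0r.
by move/eqP; rewrite oner_eq0.
Qed.

Lemma cis2pi : cis (pi *+ 2) = 1.
Proof. by rewrite /cis cos2pi sin2pi. Qed.

Lemma cis_eq1 t : 0 < t < pi *+ 2 -> cis t <> 1.
Proof.
move=> /andP[t0 t2] /(congr1 Re) /= c1.
have aux (s : R) : 0 < s <= pi -> cos s < 1.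
  move=> /andP[s0 sp]; rewrite -cos0 ltr_cos // in_itv /= ?lexx ?pi_ge0 //.
  by rewrite ltW.
have [tp|tp] := leP t pi; first by have := aux t; rewrite t0 tp c1 ltxx => /(_ isT).
have := aux (pi *+ 2 - t); rewrite cosB cos2pi sin2pi mul1r mul0r addr0 c1 ltxx.
by rewrite subr_gt0 t2 /= lerBlDr mulr2n lerD2l (ltW tp) => /(_ isT).
Qed.

Lemma continuous_cis (t : R) : {for t, continuous cis}.
Proof.
by apply: cvg_complex; [exact: continuous_cos|exact: continuous_sin].
Qed.

Definition modulus (z : K) : R := Num.sqrt (Re z ^+ 2 + Im z ^+ 2).

Lemma modulus_sqr z : modulus z ^+ 2 = Re z ^+ 2 + Im z ^+ 2.
Proof. by rewrite sqr_sqrtr // addr_ge0 ?sqr_ge0. Qed.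

Lemma modulus_gt0 z : z != 0 -> 0 < modulus z.
Proof.
move=> z0; rewrite sqrtr_gt0 lt0r addr_ge0 ?sqr_ge0 // andbT.
rewrite paddr_eq0 ?sqr_ge0 // !sqrf_eq0; apply/negP => /andP[/eqP h1 /eqP h2].
by move/eqP: z0; apply; apply: complex_eqP.
Qed.

Lemma modulusN z : modulus (- z) = modulus z.
Proof. by case: z => a b; rewrite /modulus /= !sqrrN. Qed.

Lemma continuous_modulus z : {for z, continuous modulus}.
Proof.
have cX (f : K -> R) : {for z, continuous f} -> {for z, continuous (fun x => f x ^+ 2)}.
  move=> cf; rewrite (_ : (fun _ => _) = (fun x => f x * f x)).
    exact: continuousM.
  by apply/funext => x; rewrite expr2.
apply: (continuous_comp (f := fun z : K => Re z ^+ 2 + Im z ^+ 2) (g := Num.sqrt)).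
  by apply: continuousD; apply: cX; [exact: continuous_Re|exact: continuous_Im].
exact: sqrt_continuous.
Qed.

Definition ucos (z : K) : R := Re z / modulus z.

Lemma ucos_bound z : z != 0 -> -1 <= ucos z <= 1.
Proof.
move=> z0; have m0 := modulus_gt0 z0; rewrite -ler_norml normrM normfV.
rewrite (gtr0_norm m0) ler_pdivrMr // mul1r -(@ler_pXn2r _ 2) ?nnegrE ?(ltW m0) //.
by rewrite modulus_sqr real_normK ?num_real // lerDl sqr_ge0.
Qed.

Lemma continuous_ucos z : z != 0 -> {for z, continuous ucos}.
Proof.
move=> z0; apply: continuousM; first exact: continuous_Re.
apply: continuousV; first by rewrite gt_eqF // modulus_gt0.
exact: continuous_modulus.
Qed.

Lemma ucosN z : ucos (- z) = - ucos z.
Proof. by rewrite /ucos modulusN; case: z => a b /=; rewrite mulNr. Qed.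

(** The value 1 is an end point of the domain of [acos], so the proof uses monotonicity instead:
    cosine decreases on [0, pi], hence [cos d < ucos x] forces the angle below [d]. *)
Lemma continuous_acos_ucos1 z : z != 0 -> ucos z = 1 ->
  {for z, continuous (fun x => acos (ucos x))}.
Proof.
move=> z0 u1; rewrite /prop_for /continuous_at u1 acos1.
apply: (@cvg_dist_lt _ (nbhs z)) => e e0; pose d := Num.min e pi.
have d0 : 0 < d by rewrite lt_min e0 pi_gt0.
have dpi : d <= pi by rewrite ge_min lexx orbT.
have cd : cos d < 1.
  by rewrite -cos0 ltr_cos // in_itv /= ?lexx ?pi_ge0 // ltW.
have nu : \forall x \near z, cos d < ucos x.
  by apply: near_continuous_gt; [exact: continuous_ucos|rewrite u1].
near=> x; have x0 : x != 0 by near: x; exact: near_neq0.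
have xb := ucos_bound x0; have ux : cos d < ucos x by near: x.
rewrite sub0r normrN ger0_norm ?acos_ge0 //.
have : acos (ucos x) < d.
  rewrite ltNge; apply/negP => dle; move: ux.
  rewrite -{1}(acosK (x := ucos x)) ?in_itv //= ltr_cos ?in_itv /= ?acos_ge0 ?acos_lepi //=.
    by rewrite ltNge dle.
  by rewrite ltW.
by move=> h; apply: lt_le_trans h _; rewrite ge_min lexx.
Unshelve. all: by end_near. Qed.

Lemma continuous_acos_ucos z : z != 0 ->
  {for z, continuous (fun x => acos (ucos x))}.
Proof.
move=> z0; have /andP[h1 h2] := ucos_bound z0.
have [u1|u1] := eqVneq (ucos z) 1; first exact: continuous_acos_ucos1.
(* At the other end point, acos(-t) = pi - acos(t) reduces to the previous case at [- z]. *)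
have [uN|uN] := eqVneq (ucos z) (-1).
  have zN0 : - z != 0 by rewrite oppr_eq0.
  apply: (near_eq_continuous (f := fun x => pi - acos (ucos (- x)))).
    near=> x; have x0 : x != 0 by near: x; exact: near_neq0.
    by rewrite ucosN acosN ?ucos_bound // opprB addrC subrK.
  apply: continuousB; first exact: cst_continuous.
  apply: (continuous_comp (f := fun x : K => - x) (g := fun x => acos (ucos x))).
    apply: continuousN; exact: continuous_at_id.
  by apply: continuous_acos_ucos1 => //; rewrite ucosN uN opprK.
apply: (continuous_comp (f := ucos) (g := acos)); first exact: continuous_ucos.
by apply: continuous_acos; rewrite !lt_neqAle h1 h2 u1 eq_sym uN.
Unshelve. all: by end_near. Qed.

(** The argument in [0, 2 pi[, which jumps across the positive reals. *)
Definition ang (z : K) : R :=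
  if 0 <= Im z then acos (ucos z) else pi *+ 2 - acos (ucos z).

Lemma polar z : z != 0 -> z = Complex (modulus z) 0 * cis (ang z).
Proof.
move=> z0; have m0 := modulus_gt0 z0; have ub := ucos_bound z0.
have cE : cos (acos (ucos z)) = ucos z by rewrite acosK // in_itv.
have sE : sin (acos (ucos z)) = `|Im z| / modulus z.
  rewrite sin_acos // -[RHS]ger0_norm; last by rewrite divr_ge0 // ltW.
  rewrite -sqrtr_sqr; congr Num.sqrt.
  rewrite /ucos !exprMn !exprVn modulus_sqr real_normK ?num_real //.
  by field; rewrite -modulus_sqr gt_eqF // exprn_gt0.
have cA : cos (ang z) = ucos z.
  by rewrite /ang; case: ifP => // _; rewrite cosB cos2pi sin2pi mul1r mul0r addr0.
have sA : sin (ang z) = Im z / modulus z.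
  rewrite /ang; case: ifP => h; first by rewrite sE ger0_norm.
  rewrite sinB cos2pi sin2pi mul1r mul0r add0r sE ltr0_norm ?mulNr ?opprK //.
  by rewrite ltNge h.
apply: complex_eqP; rewrite ?ReM ?ImM /= cA sA /ucos; field; exact: lt0r_neq0.
Qed.

Section Root.
Variable n : nat.
Hypothesis n_gt0 : (0 < n)%N.

Let nR0 : n%:R != 0 :> R.
Proof. by rewrite pnatr_eq0 -lt0n. Qed.

Definition zeta : K := cis (pi *+ 2 / n%:R).

Lemma zeta_prim : n.-primitive_root zeta.
Proof.
rewrite /primitive_root_of_unity n_gt0; apply/forallP => i.
rewrite unity_rootE cisX mulrCA.
have [->|ne] := eqVneq i.+1 n; first by rewrite mulfV // mulr1 cis2pi eqxx.
rewrite eqbF_neg; apply/eqP/cis_eq1.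
have p2 : 0 < pi *+ 2 :> R by rewrite mulrn_wgt0 // pi_gt0.
have n0 : 0 < n%:R :> R by rewrite ltr0n.
rewrite mulr_gt0 ?divr_gt0 ?ltr0n //= -[X in _ < X]mulr1 ltr_pM2l //.
by rewrite ltr_pdivrMr // mul1r ltr_nat ltn_neqAle ne ltn_ord.
Qed.

Definition rmod (z : K) : K := Complex (expR (ln (modulus z) / n%:R)) 0.
(** [rt_up] and [rt_dn] are both continuous away from 0, but they are n-th roots only on the closed
    upper and lower half-plane respectively. They agree on the positive reals, where [rt_cut] glues
    them, and differ by the factor [zeta] on the negative reals, where [rt] glues them. *)
Definition rt_up (z : K) : K := rmod z * cis (acos (ucos z) / n%:R).
Definition rt_dn (z : K) : K := rmod z * cis (- acos (ucos z) / n%:R).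

(* The n-th root with argument in [0, 2 pi / n[. *)
Definition rt (z : K) : K := if 0 <= Im z then rt_up z else zeta * rt_dn z.

Lemma rtE z : rt z = rmod z * cis (ang z / n%:R).
Proof.
rewrite /rt /ang; case: ifP => // _.
by rewrite /rt_dn mulrCA -cisD -mulrDl.
Qed.

Lemma rtX z : z != 0 -> rt z ^+ n = z.
Proof.
move=> z0; rewrite rtE exprMn cisX mulrCA divff // mulr1.
rewrite [RHS]polar //; congr (_ * _).
have aux (t : R) : (Complex t 0 : K) ^+ n = Complex (t ^+ n) 0.
  elim: (n) => // m IH; rewrite !exprS IH.
  by apply: complex_eqP; rewrite ?ReM ?ImM /=; ring.
by rewrite aux -expRM_natl mulrCA divff // mulr1 lnK // posrE modulus_gt0.
Qed.

Lemma rt_neq0 z : z != 0 -> rt z != 0.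
Proof.
move=> z0; apply: contra_neq z0 => r0.
have [//|z0] := eqVneq z 0; have := rtX z0.
by rewrite r0 expr0n eqn0Ngt n_gt0.
Qed.

Lemma continuous_rmod z : z != 0 -> {for z, continuous rmod}.
Proof.
move=> z0; apply: continuousC_ext; last exact: cst_continuous.
apply: (continuous_comp (f := fun z => ln (modulus z) / n%:R) (g := expR)).
  apply: (@continuousM _ _ (fun z => ln (modulus z))); last exact: cst_continuous.
  apply: (continuous_comp (f := modulus) (g := (@ln R : R -> R))); first exact: continuous_modulus.
  by apply: continuous_ln; exact: modulus_gt0.
exact: continuous_expR.
Qed.

Lemma continuous_rt_up z : z != 0 -> {for z, continuous rt_up}.
Proof.
move=> z0; apply: continuousM; first exact: continuous_rmod.
apply: (continuous_comp (f := fun z => acos (ucos z) / n%:R) (g := cis)).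
  by apply: continuousM; [exact: continuous_acos_ucos|exact: cst_continuous].
exact: continuous_cis.
Qed.

Lemma continuous_rt_dn z : z != 0 -> {for z, continuous rt_dn}.
Proof.
move=> z0; apply: continuousM; first exact: continuous_rmod.
apply: (continuous_comp (f := fun z => - acos (ucos z) / n%:R) (g := cis)).
  apply: continuousM; last exact: cst_continuous.
  by apply: continuousN; exact: continuous_acos_ucos.
exact: continuous_cis.
Qed.

Definition on_cut (z : K) : bool := (Im z == 0) && (0 < Re z).

Lemma continuous_rt z : z != 0 -> ~~ on_cut z -> {for z, continuous rt}.
Proof.
move=> z0 ncut.
have cu := continuous_rt_up z0.
have cd : {for z, continuous (fun x => zeta * rt_dn x)}.
  by apply: continuousM; [exact: cst_continuous|exact: continuous_rt_dn].
have [i0|i0|i0] := ltgtP (Im z) 0.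
- apply: near_eq_continuous cd; near=> x.
  have : Im x < 0 by near: x; exact: (near_continuous_lt (@continuous_Im R z)).
  by rewrite /rt ltNge => /negbTE ->.
- apply: near_eq_continuous cu; near=> x.
  have : 0 < Im x by near: x; exact: (near_continuous_gt (@continuous_Im R z)).
  by rewrite /rt => /ltW ->.
- have : rt_up z = zeta * rt_dn z -> {for z, continuous rt}.
    exact: (@continuous_if _ _ (fun x : K => 0 <= Im x) _ _ _ cu cd).
  apply.
  have Rz : Re z < 0.
    rewrite lt_neqAle; move: ncut; rewrite /on_cut i0 eqxx /= -leNgt => ->.
    by rewrite andbT; apply: contra_neq z0 => r0; apply: complex_eqP.
  have uz : ucos z = -1.
    rewrite /ucos /modulus i0 expr0n addr0 sqrtr_sqr ltr0_norm // invrN mulrN divff //.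
    by rewrite lt_eqF.
  rewrite /rt_up /rt_dn uz acosN1 mulrCA -cisD; congr (_ * cis _); field.
Unshelve. all: by end_near. Qed.

(* Continuing the root across the cut from above. *)
Definition rt_cut (z : K) : K := if 0 <= Im z then rt_up z else rt_dn z.

Lemma continuous_rt_cut z : on_cut z -> {for z, continuous rt_cut}.
Proof.
move=> /andP[/eqP i0 Rz].
have z0 : z != 0 by apply: contraTneq Rz => ->; rewrite ltxx.
have : rt_up z = rt_dn z -> {for z, continuous rt_cut}.
  exact: (@continuous_if _ _ (fun x : K => 0 <= Im x) _ _ _
    (continuous_rt_up z0) (continuous_rt_dn z0)).
apply.
have uz : ucos z = 1.
  by rewrite /ucos /modulus i0 expr0n addr0 sqrtr_sqr gtr0_norm // divff // gt_eqF.
by rewrite /rt_up /rt_dn uz acos1 oppr0.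
Qed.

Lemma rt_rt_cut z : rt z = (if 0 <= Im z then 1 else zeta) * rt_cut z.
Proof. by rewrite /rt /rt_cut; case: ifP; rewrite ?mul1r. Qed.

(** The number of the sector of angle 2 pi / n that contains [w], that is, the number of full turns
    made by [w ^+ n]. The test [w != 0] gives the centre the value 0. *)
Definition turn (w : K) : nat :=
  odflt 0%N (omap (@nat_of_ord n)
    [pick m : 'I_n | (w != 0) && (w == zeta ^+ m * rt (w ^+ n))]).

Lemma turn0 : turn 0 = 0%N.
Proof. by rewrite /turn; case: pickP => //= m; rewrite eqxx. Qed.

Lemma turnP (w : K) : w != 0 -> (turn w < n)%N /\ w = zeta ^+ turn w * rt (w ^+ n).
Proof.
move=> w0; rewrite /turn; case: pickP => [m /= /andP[_ /eqP e]|no].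
  by split; [exact: ltn_ord|].
have wn0 := expf_neq0 n w0; have g0 := rt_neq0 wn0.
have [|i e] := prim_rootP zeta_prim (x := w / rt (w ^+ n)).
  by rewrite expr_div_n rtX // divff.
by have := no i; rewrite w0 -e mulfVK // eqxx.
Qed.

Lemma turn_lt w : (turn w < n)%N.
Proof. by have [->|/turnP[]//] := eqVneq w 0; rewrite turn0. Qed.

Lemma zetaX_inj i j : (i < n)%N -> (j < n)%N -> zeta ^+ i = zeta ^+ j -> i = j.
Proof.
move=> hi hj /eqP; rewrite (eq_prim_root_expr zeta_prim) !modn_small //.
by move/eqP.
Qed.

Lemma zetaX_neq0 i : zeta ^+ i != 0.
Proof. by rewrite expf_neq0 // cis_neq0. Qed.

Lemma turn_inj w w' : w ^+ n = w' ^+ n -> turn w = turn w' -> w = w'.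
Proof.
move=> e t; have [w0|w0] := eqVneq w 0.
  move: e; rewrite w0 expr0n eqn0Ngt n_gt0 /= => /esym/eqP.
  by rewrite expf_eq0 n_gt0 /= => /eqP ->.
have w0' : w' != 0.
  apply: contra_neq w0 => w0'; move: e; rewrite w0' expr0n eqn0Ngt n_gt0 /= => /eqP.
  by rewrite expf_eq0 n_gt0 /= => /eqP ->.
have [_ ->] := turnP w0; have [_ ->] := turnP w0'.
by rewrite t e.
Qed.

Lemma turn_surj z m : z != 0 -> (m < n)%N ->
  exists w, [/\ w ^+ n = z, turn w = m & w != 0].
Proof.
move=> z0 mn; pose w := zeta ^+ m * rt z.
have wn : w ^+ n = z.
  by rewrite exprMn rtX // exprAC (prim_expr_order zeta_prim) expr1n mul1r.
have w0 : w != 0 by rewrite mulf_neq0 ?zetaX_neq0 ?rt_neq0.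
exists w; split=> //; have [tn e] := turnP w0.
apply: zetaX_inj => //; apply: (mulIf (rt_neq0 z0)).
by rewrite -[LHS]/(zeta ^+ turn w * rt z) -[in LHS]wn -e.
Qed.

(** The powers of [zeta] are finitely many, hence isolated from each other: a continuous function
    with values among them is locally constant. *)
Lemma near_zetaX i : \forall y \near zeta ^+ i,
  forall m, y = zeta ^+ m -> y = zeta ^+ i.
Proof.
have : \forall y \near zeta ^+ i, forall m : 'I_n, y = zeta ^+ m -> y = zeta ^+ i.
  apply: (@filter_forall _ _ (fun (m : 'I_n) y => y = zeta ^+ m -> y = zeta ^+ i)
    (nbhs (zeta ^+ i))) => m.
  have [e|ne] := eqVneq (zeta ^+ m) (zeta ^+ i).
    by near=> y; rewrite e.
  have nd : \forall y \near zeta ^+ i, y - zeta ^+ m != 0.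
    have : {for zeta ^+ i, continuous (fun y => y - zeta ^+ m)}.
      by apply: continuousB; [exact: continuous_at_id|exact: cst_continuous].
    move=> c; apply: (near_continuous (A := fun y => y != 0) c).
    by apply: near_neq0; rewrite subr_eq0 eq_sym.
  near=> y => ym; have : y - zeta ^+ m != 0 by near: y.
  by rewrite ym subrr eqxx.
move=> nh; near=> y => m ym.
have h : forall m : 'I_n, y = zeta ^+ m -> y = zeta ^+ i by near: y.
apply: (h (Ordinal (ltn_pmod m n_gt0))) => /=.
by rewrite (prim_expr_mod zeta_prim).
Unshelve. all: by end_near. Qed.

(** The quotient of [x] by [rt (x ^+ n)] is continuous here and equals [zeta ^+ turn x], so it is
    locally constant. *)
Lemma turn_near (w : K) : w != 0 -> ~~ on_cut (w ^+ n) ->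
  \forall x \near w, turn x = turn w.
Proof.
move=> w0 nc; have wn0 := expf_neq0 n w0.
have cX : {for w, continuous (fun x : K => x ^+ n)}.
  by apply: continuousX; exact: continuous_at_id.
have c : {for w, continuous (fun x : K => x / rt (x ^+ n))}.
  apply: continuousM; first exact: continuous_at_id.
  apply: continuousV; first exact: rt_neq0.
  apply: (continuous_comp (f := fun x : K => x ^+ n) (g := rt) cX).
  exact: continuous_rt.
have qE x : x != 0 -> x / rt (x ^+ n) = zeta ^+ turn x.
  move=> x0; have [_ e] := turnP x0.
  by rewrite {1}e mulfK // rt_neq0 // expf_neq0.
have nq : \forall x \near w,
    forall m, x / rt (x ^+ n) = zeta ^+ m -> x / rt (x ^+ n) = zeta ^+ turn w.
  apply: (near_continuous (A := fun y => forall m, y = zeta ^+ m -> y = _) c).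
  by rewrite qE //; exact: near_zetaX.
near=> x; have x0 : x != 0 by near: x; exact: near_neq0.
have h : forall m, x / rt (x ^+ n) = zeta ^+ m ->
  x / rt (x ^+ n) = zeta ^+ turn w by near: x.
have e : zeta ^+ turn x = zeta ^+ turn w by exact: etrans (esym (qE x x0)) (h _ (qE x x0)).
exact: zetaX_inj (turn_lt x) (turn_lt w) e.
Unshelve. all: by end_near. Qed.

(** When [w ^+ n] crosses the positive reals downwards, the sector number falls by one modulo n.
    Dividing by [rt_cut], which is continuous across the cut, replaces [turn] by the corrected
    number [s], which is locally constant modulo n. *)
Lemma turn_near_cut (w : K) : w != 0 -> on_cut (w ^+ n) ->
  \forall x \near w, if 0 <= Im (x ^+ n) then turn x = turn w
                     else (turn x).+1 = turn w %[mod n].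
Proof.
move=> w0 cut; have wn0 := expf_neq0 n w0.
have cX : {for w, continuous (fun x : K => x ^+ n)}.
  by apply: continuousX; exact: continuous_at_id.
have rc0 x : x != 0 -> rt_cut x != 0.
  by move=> x0; have := rt_neq0 x0; rewrite rt_rt_cut mulf_eq0 negb_or => /andP[].
have c : {for w, continuous (fun x : K => x / rt_cut (x ^+ n))}.
  apply: continuousM; first exact: continuous_at_id.
  apply: continuousV; first exact: rc0.
  apply: (continuous_comp (f := fun x : K => x ^+ n) (g := rt_cut) cX).
  exact: continuous_rt_cut.
pose s x := if 0 <= Im (x ^+ n) then turn x else (turn x).+1.
have qE x : x != 0 -> x / rt_cut (x ^+ n) = zeta ^+ s x.
  move=> x0; have [_ e] := turnP x0; have r0 := rc0 _ (expf_neq0 n x0).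
  rewrite {1}e rt_rt_cut /s; case: ifP => _; first by rewrite mul1r mulfK.
  by rewrite mulrA mulfK // exprSr.
have sw : s w = turn w by rewrite /s; have /andP[/eqP -> _] := cut; rewrite lexx.
have nq : \forall x \near w, forall m, x / rt_cut (x ^+ n) = zeta ^+ m ->
    x / rt_cut (x ^+ n) = zeta ^+ turn w.
  apply: (near_continuous (A := fun y => forall m, y = zeta ^+ m -> y = _) c).
  by rewrite qE // sw; exact: near_zetaX.
near=> x; have x0 : x != 0 by near: x; exact: near_neq0.
have h : forall m, x / rt_cut (x ^+ n) = zeta ^+ m ->
  x / rt_cut (x ^+ n) = zeta ^+ turn w by near: x.
have : zeta ^+ s x = zeta ^+ turn w by exact: etrans (esym (qE x x0)) (h _ (qE x x0)).
rewrite /s; case: ifP => _ e; first exact: zetaX_inj (turn_lt x) (turn_lt w) e.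
by apply/eqP; rewrite -(eq_prim_root_expr zeta_prim) e.
Unshelve. all: by end_near. Qed.

(** Away from the cut a constant multiple of [rt] works. For [z0] on the cut, [rt (- z)] is used on
    the right half-plane, its own cut lying on the negative reals; the n-th power -1 of the constant
    factor cancels the sign of [- z]. *)
Lemma local_root z0 w : z0 != 0 -> w ^+ n = z0 ->
  exists (V : set K) (r : K -> K), [/\ open V, V z0, ~ V 0, r z0 = w &
    (forall z, V z -> r z ^+ n = z) /\ (forall z, V z -> {for z, continuous r})].
Proof.
move=> z00 wn; have [cut|ncut] := boolP (on_cut z0).
  have zN : - z0 != 0 by rewrite oppr_eq0.
  have V0 z : 0 < Re z -> z != 0 by move=> h; apply: contraTneq h => ->; rewrite ltxx.
  exists [set z | 0 < Re z], (fun z => w / rt (- z0) * rt (- z)); split.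
  - apply: (@open_comp _ _ (Re : K -> R) [set x | 0 < x]); last exact: open_gt.
    by move=> x _; exact: continuous_Re.
  - by have /andP[] := cut.
  - by rewrite /= ltxx.
  - by rewrite mulfVK // rt_neq0.
  split=> z Vz; have z0' : - z != 0 by rewrite oppr_eq0; exact: V0.
    by rewrite exprMn expr_div_n wn !rtX // invrN !mulrN mulNr opprK mulfV // mul1r.
  apply: continuousM; first exact: cst_continuous.
  apply: (continuous_comp (f := fun z : K => - z) (g := rt)).
    by apply: continuousN; exact: continuous_at_id.
  apply: continuous_rt => //; rewrite /on_cut negb_and -leNgt.
  by apply/orP; right; case: (z) Vz => a b /=; rewrite oppr_le0 => /ltW.
(* The plane without the nonnegative reals, as a union of three open half-planes. *)
pose V := [set z : K | 0 < Im z] `|` [set z : K | Im z < 0] `|` [set z : K | Re z < 0].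
have V0 z : V z -> z != 0.
  by move=> h; apply/eqP => z0E; move: h; rewrite z0E /V /= ltxx => -[[]|].
exists V, (fun z => w / rt z0 * rt z); split.
- apply: openU; first apply: openU.
  + apply: (@open_comp _ _ (Im : K -> R) [set x | 0 < x]); last exact: open_gt.
    by move=> x _; exact: continuous_Im.
  + apply: (@open_comp _ _ (Im : K -> R) [set x | x < 0]); last exact: open_lt.
    by move=> x _; exact: continuous_Im.
  + apply: (@open_comp _ _ (Re : K -> R) [set x | x < 0]); last exact: open_lt.
    by move=> x _; exact: continuous_Re.
- rewrite /V /=; have [i0|i0|i0] := ltgtP (Im z0) 0; [by left; right|by left; left|right].
  rewrite lt_neqAle; move: ncut; rewrite /on_cut i0 eqxx /= -leNgt => ->.
  by rewrite andbT; apply: contra_neq z00 => r0; apply: complex_eqP.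
- by move/V0; rewrite eqxx.
- by rewrite mulfVK // rt_neq0.
split=> z Vz; have z0' := V0 z Vz.
  by rewrite exprMn expr_div_n wn !rtX // divff // mul1r.
apply: continuousM; first exact: cst_continuous.
apply: continuous_rt => //; rewrite /on_cut negb_and -leNgt.
case: Vz => [[|]|] /= h; apply/orP; [left|left|right]; last exact: ltW.
  by rewrite gt_eqF.
by rewrite lt_eqF.
Qed.

End Root.
End Roots.

(** * Square-tiled surfaces *)

Section Tiling.
Variable R : realType.
Local Notation K := (cplx R).
Local Notation Re := (@complex.Re R).
Local Notation Im := (@complex.Im R).
Local Notation L := (4 : R).

(* The circle R/2L is cut into two arcs [La, L(a+1)[; [circ a t] is the point
   at signed distance t from the vertex La. *)
Definition circ (a : bool) (t : R) : bool * R :=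
  if 0 <= t then (a, t) else (~~ a, L + t).

Lemma circ_inj a t t' : `|t| < L -> `|t'| < L -> circ a t = circ a t' -> t = t'.
Proof.
rewrite !ltr_norml /circ; case: (leP 0 t) => ?; case: (leP 0 t') => ?;
  by case: a => /andP[? ?] /andP[? ?] [] // ?; lra.
Qed.

Lemma circ_eq0 a t : `|t| < L -> (circ a t).2 = 0 -> t = 0.
Proof. by rewrite ltr_norml /circ; case: (leP 0 t) => ? /andP[? ?] /=; lra. Qed.

Lemma circ_bound a t : `|t| < L -> 0 <= (circ a t).2 < L.
Proof. by rewrite ltr_norml /circ; case: (leP 0 t) => ? /andP[? ?] /=; lra. Qed.

Lemma circ_surj a (x : R) : 0 <= x < L ->
  exists a' t, `|t| <= L / 2 /\ circ a' t = (a, x).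
Proof.
move=> /andP[x0 xL]; have [h|h] := leP x (L / 2).
  by exists a, x; rewrite /circ x0 ger0_norm.
exists (~~ a), (x - L); rewrite /circ negbK; split; first by rewrite ler_norml; lra.
by case: leP => ?; [exfalso; lra|congr pair; lra].
Qed.

(* Both heights are continuous on the circle, and together they separate its
   points; this makes the tiled surface Hausdorff. *)
Definition uheight (p : bool * R) : R := if p.1 then L - p.2 else p.2.
Definition vheight (p : bool * R) : R :=
  if p.1 then - (p.2 * (L - p.2)) else p.2 * (L - p.2).

Lemma heights_inj p q : 0 <= p.2 < L -> 0 <= q.2 < L ->
  uheight p = uheight q -> vheight p = vheight q -> p = q.
Proof.
case: p q => [a x] [b y] /= /andP[x0 xL] /andP[y0 yL]; rewrite /uheight /vheight /=.
by case: a; case: b => h k; congr pair; nra.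
Qed.

Lemma uheight_circ a t : `|t| < L ->
  uheight (circ a t) = if a then L - `|t| else `|t|.
Proof.
rewrite /circ /uheight; case: (leP 0 t) => h _ /=.
  by rewrite ger0_norm.
by rewrite ltr0_norm //; case: a => /=; lra.
Qed.

Lemma vheight_circ a t : `|t| < L ->
  vheight (circ a t) = if a then - (t * (L - `|t|)) else t * (L - `|t|).
Proof.
rewrite /circ /vheight; case: (leP 0 t) => h _ /=.
  by rewrite ger0_norm.
by rewrite ltr0_norm //; case: a => /=; ring.
Qed.

Variable S : finType.
(* [V c] is the permutation of the sheets met when crossing rightwards the
   vertical edge going up from the vertex c, and [H c] when crossing upwards the
   horizontal edge going right from c. *)
Variables H V : bool * bool -> {perm S}.

Definition left_of (c : bool * bool) := (~~ c.1, c.2).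
Definition below (c : bool * bool) := (c.1, ~~ c.2).

(** Labels of the sheet met when turning counterclockwise around the vertex [c], starting in the
    first quadrant. The edges above and to the left are crossed against their direction, hence the
    inverses; the edges below and to the right are crossed along it. The edge to the left of [c]
    starts at [left_of c], the edge below it at [below c]. *)
Definition upleft c (s : S) : S := ((V c)^-1)%g s.
Definition downleft c s := ((H (left_of c))^-1)%g (upleft c s).
Definition downright c s := V (below c) (downleft c s).
Definition monodromy c s := H c (downright c s).

Lemma upleft_inj c : injective (upleft c).
Proof. exact: perm_inj. Qed.
Lemma downleft_inj c : injective (downleft c).
Proof. by move=> s t /perm_inj/upleft_inj. Qed.
Lemma downright_inj c : injective (downright c).
Proof. by move=> s t /perm_inj/downleft_inj. Qed.
Lemma monodromy_inj c : injective (monodromy c).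
Proof. by move=> s t /perm_inj/downright_inj. Qed.

Definition sheet c (z : K) : S -> S :=
  if 0 <= Im z then (if 0 <= Re z then id else upleft c)
  else (if 0 <= Re z then downright c else downleft c).

Lemma sheet_inj c z : injective (sheet c z).
Proof.
rewrite /sheet; case: ifP => _; case: ifP => _ //;
  [exact: upleft_inj|exact: downright_inj|exact: downleft_inj].
Qed.

Definition tpt := (bool * R * (bool * R) * S)%type.

(* The point at position z from the vertex c, on the sheet labelled by l in the
   first quadrant. *)
Definition star c (z : K) (l : S) : tpt :=
  (circ c.1 (Re z), circ c.2 (Im z), sheet c z l).

Definition in_star (z : K) : Prop := `|Re z| < L /\ `|Im z| < L.

Lemma star_inj c z z' l l' : in_star z -> in_star z' ->
  star c z l = star c z' l' -> z = z' /\ l = l'.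
Proof.
move=> [h1 h2] [h1' h2'] [/(circ_inj h1 h1') e1 /(circ_inj h2 h2') e2].
have zz : z = z' by exact: complex_eqP.
by rewrite zz => /sheet_inj.
Qed.

(* The continuation of a point that is not a vertex by a small displacement. *)
Definition step (p : tpt) (d : K) : tpt :=
  let: (a, x, (b, y), s) := p in
  if (x == 0) && (Re d < 0) then
    (~~ a, L + Re d, (b, y + Im d), ((V (a, b))^-1)%g s)
  else if (y == 0) && (Im d < 0) then
    (a, x + Re d, (~~ b, L + Im d), ((H (a, b))^-1)%g s)
  else (a, x + Re d, (b, y + Im d), s).

(** Crossing the vertical edge, crossing the horizontal edge and crossing none lead to three
    different squares. Equal results therefore come from the same case, where the label undergoes
    one and the same permutation. *)
Lemma step_label_inj q s s' d d' : step (q, s) d = step (q, s') d' -> s = s'.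
Proof.
case: q => [[a x] [b y]] e.
have := congr1 (fun p : tpt => p.1.1.1) e; have := congr1 (fun p : tpt => p.1.2.1) e.
have := congr1 (fun p : tpt => p.2) e; rewrite /step /= {e}.
move: (_ && (Re d < 0)) (_ && (Re d' < 0)) (_ && (Im d < 0)) (_ && (Im d' < 0)).
by do 4 case; move=> /= el eb ea; (try exact: el); (try exact: perm_inj el);
   case: a b ea eb {el} => -[].
Qed.

Lemma step_sheet_inj p p' d d' :
  p.1 = p'.1 -> step p d = step p' d' -> p.2 = p'.2.
Proof. by case: p p' => [q s] [q' s'] /= ->; exact: step_label_inj. Qed.

(** Signs that are nonzero at [z] persist at [z'], so from a quadrant one only translates and from a
    half-axis one crosses at most its edge. The quadrant labels are consistent except between the
    fourth and the first, where a full turn shows up as the monodromy; this is the last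
    hypothesis. *)
Lemma star_step c (z z' : K) l l' : in_star z -> z != 0 ->
  (0 < Re z -> 0 < Re z') -> (Re z < 0 -> Re z' < 0) ->
  (0 < Im z -> 0 < Im z') -> (Im z < 0 -> Im z' < 0) ->
  (if on_cut z && (Im z' < 0) then monodromy c l' = l else l' = l) ->
  star c z' l' = step (star c z l) (z' - z).
Proof.
case: z z' => [x y] [x' y'] [/= hx hy] z0 xp xn yp yn.
rewrite /star /sheet /circ /on_cut /= => hl.
move: hx hy; rewrite !ltr_norml => /andP[hx1 hx2] /andP[hy1 hy2].
rewrite /left_of /below /downleft /downright /monodromy /upleft /= in hl *.
have xF : x < 0 -> (0 <= x = false) * (0 <= x' = false) * (L + x == 0 = false).
  by move=> xs; rewrite (lt_geF xs) (lt_geF (xn xs)) gt_eqF //; lra.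
have xT : 0 < x -> (0 <= x) * (0 <= x') * (x == 0 = false).
  by move=> xs; rewrite (ltW xs) (ltW (xp xs)) (gt_eqF xs).
have yF : y < 0 -> (0 <= y = false) * (0 <= y' = false) * (L + y == 0 = false).
  by move=> ys; rewrite (lt_geF ys) (lt_geF (yn ys)) gt_eqF //; lra.
have yT : 0 < y -> (0 <= y) * (0 <= y') * (y == 0 = false).
  by move=> ys; rewrite (ltW ys) (ltW (yp ys)) (gt_eqF ys).
have [xs|xs|xs] := ltgtP x 0; [rewrite !(xF xs) /=|rewrite !(xT xs) /=|];
  (have [ys|ys|ys] := ltgtP y 0; [rewrite !(yF ys) /=|rewrite !(yT ys) /=|]);
  rewrite ?(lt_eqF xs) ?(gt_eqF xs) ?(lt_eqF ys) ?(gt_eqF ys) /= in hl *.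
- by rewrite hl; congr (_, _, (_, _), _); lra.
- by rewrite hl; congr (_, _, (_, _), _); lra.
- rewrite ?ys ?eqxx (lt_gtF xs) ?andbF /= in hl; rewrite ys eqxx subr0 hl.
  by case: (leP 0 y') => _ /=; congr (_, _, (_, _), _); lra.
- by rewrite hl; congr (_, _, (_, _), _); lra.
- by rewrite hl; congr (_, _, (_, _), _); lra.
(* The positive real axis, the only place where the labelling jumps. *)
- rewrite ?ys ?eqxx xs /= in hl; rewrite ys eqxx subr0.
  case: (leP 0 y') hl => _ /= hl; last rewrite -hl -surjective_pairing permK.
    by rewrite hl; congr (_, _, (_, _), _); lra.
  by congr (_, _, (_, _), _); lra.
- rewrite ?xs ?ltxx ?andbF /= in hl; rewrite xs eqxx subr0 hl.
  by case: (leP 0 x') => _ /=; rewrite ?permK; congr (_, _, (_, _), _); lra.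
- rewrite ?xs ?ltxx ?andbF /= in hl; rewrite xs eqxx subr0 hl -surjective_pairing.
  by case: (leP 0 x') => _ /=; congr (_, _, (_, _), _); lra.
- by move: z0; rewrite xs ys eqxx.
Qed.

Variable s0 : S.

Definition sheet_order c s := fingraph.order (monodromy c) s.
Definition sheet_rep c s := froot (monodromy c) s.

Lemma monodromy_sym c : connect_sym (frel (monodromy c)).
Proof. exact: fconnect_sym (@monodromy_inj c). Qed.

Lemma sheet_repK c s : sheet_rep c (sheet_rep c s) = sheet_rep c s.
Proof. exact: root_root (monodromy_sym c) s. Qed.

Lemma sheet_order_gt0 c s : (0 < sheet_order c s)%N.
Proof. exact: fingraph.order_gt0. Qed.

Lemma sheet_rep_iter c s m : sheet_rep c (iter m (monodromy c) s) = sheet_rep c s.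
Proof.
apply/eqP; rewrite root_connect; last exact: monodromy_sym.
by rewrite monodromy_sym fconnect_iter.
Qed.

(** Normal forms in place of a quotient: the half-open coordinates make the square unique, and at a
    vertex the sheets of one monodromy cycle become one point, named by the representative of the
    cycle. *)
Definition tpt_ok (p : tpt) : bool :=
  let: (a, x, (b, y), s) := p in
  [&& 0 <= x < L, 0 <= y < L &
      ((x == 0) && (y == 0)) ==> (sheet_rep (a, b) s == s)].

Definition tiling_point := {p : tpt | tpt_ok p}.

Definition origin : tpt := (false, 0, (false, 0), sheet_rep (false, false) s0).

Lemma origin_ok : tpt_ok origin.
Proof. by rewrite /tpt_ok /= !lexx !ltr0n /= sheet_repK eqxx !eqxx. Qed.

(** The chart at a vertex and a cycle of length n. Each of the n sectors of the w-plane covers the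
    star once, and the sector number counts how many times the monodromy is applied to the starting
    sheet. *)
Definition raw (a : bool * bool * S) (w : K) : tpt :=
  let n := sheet_order a.1 a.2 in
  star a.1 (w ^+ n) (iter (turn n w) (monodromy a.1) a.2).

(** The first condition leaves one nonempty chart for each cycle, although the charts are indexed by
    all sheets. *)
Definition tdom (a : bool * bool * S) : set K :=
  [set w | sheet_rep a.1 a.2 = a.2 /\ in_star (w ^+ sheet_order a.1 a.2)].

Lemma star_eq0 c z l : in_star z -> (star c z l).1.1.2 = 0 ->
  (star c z l).1.2.2 = 0 -> z = 0.
Proof.
by move=> [h1 h2] /(circ_eq0 h1) e1 /(circ_eq0 h2) e2; apply: complex_eqP.
Qed.

Lemma star0 c l : star c 0 l = (c.1, 0, (c.2, 0), l).
Proof. by rewrite /star /circ /sheet /= lexx. Qed.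

Lemma raw0 a : raw a 0 = (a.1.1, 0, (a.1.2, 0), a.2).
Proof. by rewrite /raw turn0 expr0n gtn_eqF ?sheet_order_gt0 //= star0. Qed.

Lemma raw_ok a w : tdom a w -> tpt_ok (raw a w).
Proof.
move=> [ra h]; have [h1 h2] := h; have [w0|w0] := eqVneq w 0.
  by rewrite w0 raw0 /tpt_ok /= !lexx !ltr0n !eqxx /= -surjective_pairing ra.
rewrite /tpt_ok; case E : (raw a w) => [[[a1 x] [b1 y]] s].
have hx : x = (circ a.1.1 (Re (w ^+ sheet_order a.1 a.2))).2.
  by have := congr1 (fun p : tpt => p.1.1.2) E.
have hy : y = (circ a.1.2 (Im (w ^+ sheet_order a.1 a.2))).2.
  by have := congr1 (fun p : tpt => p.1.2.2) E.
have -> : 0 <= x < L by rewrite hx; exact: circ_bound.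
have -> : 0 <= y < L by rewrite hy; exact: circ_bound.
rewrite /=; apply/implyP => /andP[/eqP x0 /eqP y0].
have := @star_eq0 a.1 _ (iter (turn (sheet_order a.1 a.2) w) (monodromy a.1) a.2) h.
rewrite -[star _ _ _]/(raw a w) E /= => /(_ x0 y0)/eqP.
by rewrite expf_eq0 (negbTE w0) andbF.
Qed.

Definition tphi a (w : K) : tiling_point := insubd (exist _ origin origin_ok) (raw a w).

Lemma val_tphi a w : tdom a w -> val (tphi a w) = raw a w.
Proof. by move=> /raw_ok h; rewrite val_insubd h. Qed.

Lemma iter_monodromy_inj c s i j : (i < sheet_order c s)%N ->
  (j < sheet_order c s)%N ->
  iter i (monodromy c) s = iter j (monodromy c) s -> i = j.
Proof. by move=> hi hj e; rewrite -(findex_iter hi) e findex_iter. Qed.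

Lemma raw_inj a w w' : tdom a w -> tdom a w' -> raw a w = raw a w' -> w = w'.
Proof.
move=> [_ h] [_ h'] /(star_inj h h')[e1 e2].
apply: (turn_inj (sheet_order_gt0 a.1 a.2) e1).
by apply: iter_monodromy_inj e2; apply: turn_lt; exact: sheet_order_gt0.
Qed.

Definition tpsi a (p : tiling_point) : K := xget 0 [set w | tdom a w /\ tphi a w = p].

Lemma tphiK a w : tdom a w -> tpsi a (tphi a w) = w.
Proof.
move=> Dw; rewrite /tpsi; case: xgetP => [w' _ [Dw' e]|/(_ w)]; last by case.
by apply: (raw_inj Dw' Dw); rewrite -(val_tphi Dw') -(val_tphi Dw) e.
Qed.

(** The jump of [turn] across the cut compensates the jump of the labelling in [star_step]. Hence,
    near a point that is not a vertex, the chart depends only on that point and on the displacement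
    of the power of [w]; this makes charts comparable. *)
Lemma near_step a w : tdom a w -> w != 0 -> \forall x \near w,
  raw a x = step (raw a w) (x ^+ sheet_order a.1 a.2 - w ^+ sheet_order a.1 a.2).
Proof.
move=> [ra h] w0; set n := sheet_order _ _ in h *.
have n0 : (0 < n)%N := sheet_order_gt0 _ _.
have cX : {for w, continuous (fun x : K => x ^+ n)}.
  by apply: continuousX; exact: continuous_at_id.
have cR : {for w, continuous (fun x : K => Re (x ^+ n))}.
  by apply: (continuous_comp (f := fun x : K => x ^+ n) (g := Re)) => //; exact: continuous_Re.
have cI : {for w, continuous (fun x : K => Im (x ^+ n))}.
  by apply: (continuous_comp (f := fun x : K => x ^+ n) (g := Im)) => //; exact: continuous_Im.
have sgn (g : K -> R) : {for w, continuous g} -> \forall x \near w,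
    (0 < g w -> 0 < g x) /\ (g w < 0 -> g x < 0).
  move=> cg; have [gw|gw|gw] := ltgtP (g w) 0.
  - have nx := near_continuous_lt cg gw; near=> x; split=> //; move=> _; near: x; exact: nx.
  - have nx := near_continuous_gt cg gw; near=> x; split=> //; move=> _; near: x; exact: nx.
  - by near=> x.
have nl : \forall x \near w,
    if on_cut (w ^+ n) && (Im (x ^+ n) < 0)
    then monodromy a.1 (iter (turn n x) (monodromy a.1) a.2) = iter (turn n w) (monodromy a.1) a.2
    else iter (turn n x) (monodromy a.1) a.2 = iter (turn n w) (monodromy a.1) a.2.
  have [cut|cut] := boolP (on_cut (w ^+ n)); last first.
    have nt := turn_near n0 w0 cut; near=> x => /=.
    have -> // : turn n x = turn n w by near: x.
  have nt := turn_near_cut n0 w0 cut; near=> x.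
  have : if 0 <= Im (x ^+ n) then turn n x = turn n w
         else (turn n x).+1 = turn n w %[mod n] by near: x.
  have tx := turn_lt n0 x.
  case: (leP 0 (Im (x ^+ n))) => _ /=; first by move=> ->.
  rewrite -iterS (modn_small (turn_lt n0 w)) => <-.
  (* In the last sector the count wraps around to 0, which is harmless because n is the length of
     the cycle. *)
  have [e|ne] := eqVneq (turn n x).+1 n; last first.
    by rewrite modn_small // ltn_neqAle ne.
  by rewrite e modnn /= iter_order //; exact: monodromy_inj.
have nR := sgn _ cR; have nI := sgn _ cI.
near=> x.
have [R1 R2] : (0 < Re (w ^+ n) -> 0 < Re (x ^+ n)) /\ (Re (w ^+ n) < 0 -> Re (x ^+ n) < 0).
  by near: x.
have [I1 I2] : (0 < Im (w ^+ n) -> 0 < Im (x ^+ n)) /\ (Im (w ^+ n) < 0 -> Im (x ^+ n) < 0).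
  by near: x.
apply: star_step => //; first by rewrite expf_neq0.
by near: x.
Unshelve. all: by end_near. Qed.

End Tiling.

Lemma near_open (T : topologicalType) (t : T) (A : set T) :
  nbhs t A -> exists U : set T, [/\ open U, U t & U `<=` A].
Proof. by rewrite nbhsE => -[U [oU Ut] UA]; exists U. Qed.

Section ModulusBounds.
Variable R : realType.
Local Notation K := (cplx R).
Local Notation Re := (@complex.Re R).
Local Notation Im := (@complex.Im R).

Lemma modulus_ge0 (z : K) : 0 <= modulus z.
Proof. exact: sqrtr_ge0. Qed.

Lemma modulusM (z w : K) : modulus (z * w) = modulus z * modulus w.
Proof.
apply/eqP; rewrite -(@eqrXn2 _ 2) ?mulr_ge0 ?modulus_ge0 // exprMn !modulus_sqr.
by rewrite ReM ImM; apply/eqP; ring.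
Qed.

Lemma modulusX (z : K) n : modulus (z ^+ n) = modulus z ^+ n.
Proof.
elim: n => [|n IH]; last by rewrite !exprS modulusM IH.
by rewrite !expr0 /modulus /= expr1n expr0n addr0 sqrtr1.
Qed.

Lemma modulus_root_lt (w : K) n (B : R) : (0 < n)%N -> 1 <= B ->
  Re (w ^+ n) ^+ 2 + Im (w ^+ n) ^+ 2 < B ^+ 2 -> modulus w < B.
Proof.
move=> n0 B1; rewrite -modulus_sqr ltr_pXn2r ?nnegrE ?modulus_ge0 //; last lra.
rewrite modulusX => h; rewrite ltNge; apply/negP => Bw.
have w1 : 1 <= modulus w by lra.
by have := ler_eXnr n0 w1; lra.
Qed.

Lemma Re_modulus (w : K) : `|Re w| <= modulus w.
Proof.
rewrite -(@ler_pXn2r _ 2) ?nnegrE ?modulus_ge0 // modulus_sqr.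
by rewrite real_normK ?num_real // lerDl sqr_ge0.
Qed.

Lemma Im_modulus (w : K) : `|Im w| <= modulus w.
Proof.
rewrite -(@ler_pXn2r _ 2) ?nnegrE ?modulus_ge0 // modulus_sqr.
by rewrite real_normK ?num_real // lerDr sqr_ge0.
Qed.

End ModulusBounds.

(** * The square-tiled surface as a holomorphic atlas *)

Section TilingAtlas.
Variable R : realType.
Local Notation K := (cplx R).
Local Notation Re := (@complex.Re R).
Local Notation Im := (@complex.Im R).
Local Notation L := (4 : R).
Variables (S : finType) (H V : bool * bool -> {perm S}) (s0 : S).
Local Notation raw := (@raw R S H V).
Local Notation tdom := (@tdom R S H V).
Local Notation tphi := (@tphi R S H V s0).
Local Notation tpsi := (@tpsi R S H V s0).
Local Notation point := (@tiling_point R S H V).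
Local Notation ord a := (sheet_order H V a.1 a.2).

Lemma near_tdom a w : tdom a w -> \forall x \near w, tdom a x.
Proof.
move=> [ra []]; rewrite !ltr_norml => /andP[h1 h2] /andP[h3 h4].
have cX : {for w, continuous (fun x : K => x ^+ ord a)}.
  by apply: continuousX; exact: continuous_at_id.
have cR : {for w, continuous (fun x : K => Re (x ^+ ord a))}.
  by apply: (continuous_comp (f := fun x : K => x ^+ ord a) (g := Re) cX); exact: continuous_Re.
have cI : {for w, continuous (fun x : K => Im (x ^+ ord a))}.
  by apply: (continuous_comp (f := fun x : K => x ^+ ord a) (g := Im) cX); exact: continuous_Im.
have n1 := near_continuous_gt cR h1; have n2 := near_continuous_lt cR h2.
have n3 := near_continuous_gt cI h3; have n4 := near_continuous_lt cI h4.
near=> x; split; first exact: ra.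
by split; rewrite ltr_norml; apply/andP; split; near: x.
Unshelve. all: by end_near. Qed.

Lemma tdom_open a : open (tdom a).
Proof. by rewrite openE => w; exact: near_tdom. Qed.

Lemma tdom_bounded a w : tdom a w -> modulus w < 8.
Proof.
move=> [_ []]; rewrite !ltr_norml => /andP[h1 h2] /andP[h3 h4].
(* The power of [w] has squared modulus below 4^2 + 4^2 = 32, hence below 8^2. This is the origin of
   the translation by 8. *)
by apply: (modulus_root_lt (sheet_order_gt0 H V a.1 a.2)); [lra|nra].
Qed.

Lemma tdom_offset a w : tdom a w -> 0 < Re w + 8.
Proof.
move=> /tdom_bounded h; have := Re_modulus w; have := ler_norm (- Re w).
rewrite normrN; lra.
Qed.

Lemma raw_eq0 a w : tdom a w -> (raw a w).1.1.2 = 0 -> (raw a w).1.2.2 = 0 -> w = 0.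
Proof.
move=> [_ h] e1 e2; have /eqP := star_eq0 h e1 e2.
by rewrite expf_eq0 => /andP[_ /eqP].
Qed.

Lemma raw_vertex a b w w' : tdom b w' -> raw a w = raw b w' -> w = 0 -> w' = 0.
Proof.
by move=> Db e w0; apply: (raw_eq0 Db); rewrite -e w0 raw0.
Qed.

(** At a vertex the two charts coincide. Elsewhere [near_step] writes both as [step] from the common
    point, so they agree when the displacements x^n - w^n and T(x)^m - w'^m are equal. This is
    solved by an m-th root with value [w'] at the base point. *)
Lemma tcompat a b w w' : tdom a w -> tdom b w' -> tphi a w = tphi b w' ->
  exists (U : set K) (T : K -> K),
    [/\ open U, forall r, hol r T U, U w
      & forall x, U x -> [/\ tdom a x, tdom b (T x) & tphi b (T x) = tphi a x]].
Proof.
move=> Da Db /(congr1 val); rewrite !val_tphi // => e.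
have [w0|w0] := eqVneq w 0.
  have w0' := raw_vertex Db e w0.
  exists (tdom a), id; split; [exact: tdom_open|by move=> r; exact: hol_id|exact: Da|].
  move: e; rewrite w0 w0' !raw0 => -[e1 e2 e3].
  have <- : a = b by case: (a) (b) e1 e2 e3 => [[? ?] ?] [[? ?] ?] /= -> -> ->.
  by [].
have w0' : w' != 0 by apply: contra_neq w0; exact: raw_vertex Da (esym e).
set n := ord a; set m := ord b.
have m0 : (0 < m)%N := sheet_order_gt0 H V b.1 b.2.
have [W [r [oW Ww W0 rw [rX cr]]]] := @local_root R m m0 (w' ^+ m) w' (expf_neq0 _ w0') erefl.
pose c := w' ^+ m - w ^+ n.
have cw : w ^+ n + c = w' ^+ m by rewrite /c addrC subrK.
have cX : {for w, continuous (fun x : K => x ^+ n + c)}.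
  apply: continuousD; last exact: cst_continuous.
  by apply: continuousX; exact: continuous_at_id.
pose T x := r (x ^+ n + c).
have Tw : T w = w' by rewrite /T cw.
have cT : {for w, continuous T}.
  apply: (continuous_comp (f := fun x : K => x ^+ n + c) (g := r) cX).
  by rewrite cw; exact: cr.
have nW : \forall x \near w, W (x ^+ n + c).
  by apply: (near_continuous cX); rewrite cw; exact: open_nbhs_nbhs.
have nDa := near_tdom Da; have nsa := near_step Da w0.
have nDb : \forall x \near w, tdom b (T x).
  by apply: (near_continuous cT); rewrite Tw; exact: near_tdom.
have nsb : \forall x \near w, raw b (T x) = step H V (raw b w') (T x ^+ m - w' ^+ m).
  apply: (near_continuous (A := fun y => raw b y = step H V (raw b w') (y ^+ m - w' ^+ m)) cT).
  by rewrite Tw; exact: near_step.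
pose P x := [/\ W (x ^+ n + c), tdom a x, tdom b (T x) & raw b (T x) = raw a x].
have nP : \forall x \near w, P x.
  near=> x; have Wx : W (x ^+ n + c) by near: x; exact: nW.
  have Dax : tdom a x by near: x; exact: nDa.
  have Dbx : tdom b (T x) by near: x; exact: nDb.
  split; [exact: Wx|exact: Dax|exact: Dbx|].
  have -> : raw b (T x) = step H V (raw b w') (T x ^+ m - w' ^+ m) by near: x; exact: nsb.
  have -> : raw a x = step H V (raw a w) (x ^+ n - w ^+ n) by near: x; exact: nsa.
  by rewrite e /T (rX _ Wx) /c addrA addrAC addrK.
have [U [oU Uw UP]] := near_open nP; exists U, T.
split; [exact: oU| |exact: Uw|].
- move=> k; apply: (@hol_comp _ _ (fun x => x ^+ n + c) r U W).
  + by move=> x /UP[].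
  + by apply: holD; [exact: holX|exact: hol_cst].
  + exact: hol_root m0 oW W0 cr rX.
- move=> x /UP[_ Dax Dbx ex]; split; [exact: Dax|exact: Dbx|].
  by apply: val_inj; rewrite (val_tphi _ Dax) (val_tphi _ Dbx).
Unshelve. all: by end_near. Qed.

(** A function on points whose expression in star coordinates is continuous and independent of the
    sheet separates the points at which it takes different values, by thresholds at the midpoint
    [m]. *)
Lemma separated_cont (h : bool * R * (bool * R) * S -> R) (g : bool * bool -> K -> R) a b w w' :
  (forall c z, {for z, continuous (g c)}) ->
  (forall c z l, in_star z -> h (star H V c z l) = g c z) ->
  tdom a w -> tdom b w' -> h (raw a w) <> h (raw b w') ->
  exists U W : set K, [/\ open U, open W, U w, W w'
    & forall x y, U x -> tdom a x -> W y -> tdom b y -> tphi a x <> tphi b y].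
Proof.
move=> cg hg.
have gE a' x : tdom a' x -> h (raw a' x) = g a'.1 (x ^+ ord a').
  by move=> [_ hz]; exact: hg.
have cX a' x : {for x, continuous (fun x : K => g a'.1 (x ^+ ord a'))}.
  apply: (continuous_comp (f := fun x : K => x ^+ ord a') (g := g a'.1)); last exact: cg.
  by apply: continuousX; exact: continuous_at_id.
wlog : a b w w' / h (raw a w) < h (raw b w') => [wl Da Db ne|lt Da Db _].
  have [l|l|//] := ltgtP (h (raw a w)) (h (raw b w')); first exact: wl.
  have [U [W [oU oW Ub Wa UW]]] := wl _ _ _ _ l Db Da (nesym ne).
  by exists W, U; split=> // x y Wx Dx Uy Dy; exact: nesym (UW _ _ Uy Dy Wx Dx).
pose m := (h (raw a w) + h (raw b w')) / 2.
exists [set x | g a.1 (x ^+ ord a) < m], [set y | m < g b.1 (y ^+ ord b)]; split.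
- apply: (@open_comp _ _ (fun x : K => g a.1 (x ^+ ord a)) [set x | x < m]); last exact: open_lt.
  by move=> x _; exact: cX.
- apply: (@open_comp _ _ (fun x : K => g b.1 (x ^+ ord b)) [set x | m < x]); last exact: open_gt.
  by move=> x _; exact: cX.
- by rewrite /= -gE // /m; lra.
- by rewrite /= -gE // /m; lra.
move=> x y /= xm Dx ym Dy /(congr1 val); rewrite !val_tphi // => e.
have e' : g a.1 (x ^+ ord a) = g b.1 (y ^+ ord b).
  exact: etrans (esym (gE _ _ Dx)) (etrans (congr1 h e) (gE _ _ Dy)).
by have /lt_eqF := lt_trans xm ym; rewrite e' eqxx.
Qed.

Lemma continuous_normr (T : topologicalType) (f : T -> R) t :
  {for t, continuous f} -> {for t, continuous (fun x => `|f x|)}.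
Proof. by move=> cf; apply: continuous_comp cf _; exact: norm_continuous. Qed.

(** Different positions on the torus are separated by one of the four heights. For equal positions
    the sheets have to be told apart, differently at a vertex and elsewhere. *)
Lemma tseparated a b w w' : tdom a w -> tdom b w' -> tphi a w <> tphi b w' ->
  exists U W : set K, [/\ open U, open W, U w, W w'
    & forall x y, U x -> tdom a x -> W y -> tdom b y -> tphi a x <> tphi b y].
Proof.
move=> Da Db ne.
have ne' : raw a w <> raw b w'.
  by move=> e; apply: ne; apply: val_inj; rewrite (val_tphi _ Da) (val_tphi _ Db).
have cu (f : K -> R) c z : {for z, continuous f} ->
    {for z, continuous (fun z => if c : bool then L - `|f z| else `|f z|)}.
  move=> cf; case: c; last exact: continuous_normr.
  by apply: continuousB; [exact: cst_continuous|exact: continuous_normr].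
have cv (f : K -> R) c z : {for z, continuous f} ->
    {for z, continuous (fun z => if c : bool then - (f z * (L - `|f z|)) else f z * (L - `|f z|))}.
  move=> cf; have c' : {for z, continuous (fun z => f z * (L - `|f z|))}.
    apply: continuousM; first exact: cf.
    by apply: continuousB; [exact: cst_continuous|exact: continuous_normr].
  by case: c; [exact: continuousN|exact: c'].
have [e1|e1] := eqVneq (uheight (raw a w).1.1) (uheight (raw b w').1.1); last first.
  apply: (@separated_cont (fun p => uheight p.1.1) (fun c z => if c.1 then L - `|Re z| else `|Re z|) _ _ _ _ _ _ Da Db (elimN eqP e1)).
    by move=> c z; apply: cu; exact: continuous_Re.
  by move=> c z l [? ?]; rewrite /= uheight_circ.
have [e2|e2] := eqVneq (vheight (raw a w).1.1) (vheight (raw b w').1.1); last first.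
  apply: (@separated_cont (fun p => vheight p.1.1)
    (fun c z => if c.1 then - (Re z * (L - `|Re z|)) else Re z * (L - `|Re z|)) _ _ _ _ _ _ Da Db (elimN eqP e2)).
    by move=> c z; apply: cv; exact: continuous_Re.
  by move=> c z l [? ?]; rewrite /= vheight_circ.
have [e3|e3] := eqVneq (uheight (raw a w).1.2) (uheight (raw b w').1.2); last first.
  apply: (@separated_cont (fun p => uheight p.1.2) (fun c z => if c.2 then L - `|Im z| else `|Im z|) _ _ _ _ _ _ Da Db (elimN eqP e3)).
    by move=> c z; apply: cu; exact: continuous_Im.
  by move=> c z l [? ?]; rewrite /= uheight_circ.
have [e4|e4] := eqVneq (vheight (raw a w).1.2) (vheight (raw b w').1.2); last first.
  apply: (@separated_cont (fun p => vheight p.1.2)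
    (fun c z => if c.2 then - (Im z * (L - `|Im z|)) else Im z * (L - `|Im z|)) _ _ _ _ _ _ Da Db (elimN eqP e4)).
    by move=> c z; apply: cv; exact: continuous_Im.
  by move=> c z l [? ?]; rewrite /= vheight_circ.
have [_ [i1 i2]] := Da; have [_ [j1 j2]] := Db.
have q1 : (raw a w).1.1 = (raw b w').1.1.
  exact: heights_inj (circ_bound _ i1) (circ_bound _ j1) e1 e2.
have q2 : (raw a w).1.2 = (raw b w').1.2.
  exact: heights_inj (circ_bound _ i2) (circ_bound _ j2) e3 e4.
have q : (raw a w).1 = (raw b w').1.
  exact: etrans (surjective_pairing _) (etrans (congr2 pair q1 q2) (esym (surjective_pairing _))).
have [w0|w0] := eqVneq w 0.
  have w0' : w' = 0 by apply: (raw_eq0 Db); rewrite -q w0 raw0.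
  (* At one vertex, the charts of two different cycles have disjoint images altogether. *)
  exists setT, setT; split; [exact: openT|exact: openT|by []|by []|].
  move=> x y _ Dx _ Dy /(congr1 val); rewrite (val_tphi _ Dx) (val_tphi _ Dy) => exy.
  move: q; rewrite w0 w0' !raw0 /= => -[c1 c2].
  have cc : a.1 = b.1 by rewrite [LHS]surjective_pairing [RHS]surjective_pairing c1 c2.
  have [ra hx] := Dx; have [rb hy] := Dy.
  rewrite -cc in rb hy; move: exy; rewrite /raw -cc => exy.
  have [_ ei] := star_inj hx hy exy.
  have := congr1 (sheet_rep H V a.1) ei; rewrite !sheet_rep_iter ra rb => ll.
  by apply: ne'; rewrite w0 w0' !raw0 cc ll.
have w0' : w' != 0.
  apply: contra_neq w0 => w0'; apply: (raw_eq0 Da); by rewrite q w0' raw0.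
(* Away from the vertices, nearby points arise by [step] from the two given ones, and [step] never
   merges different sheets. *)
have na := near_step Da w0; have nb := near_step Db w0'.
have ll : (raw a w).2 <> (raw b w').2.
  by move=> l; apply: ne'; rewrite [LHS]surjective_pairing [RHS]surjective_pairing q l.
have [U [oU Uw UP]] := near_open na; have [W [oW Ww WP]] := near_open nb.
exists U, W; split; [exact: oU|exact: oW|exact: Uw|exact: Ww|].
move=> x y /UP ex Dx /WP ey Dy /(congr1 val); rewrite (val_tphi _ Dx) (val_tphi _ Dy).
rewrite /= in ex ey; rewrite ex ey => e; apply: ll.
exact: step_sheet_inj q e.
Qed.

(** Closed stars of half the size: they still cover, since every point of an arc is within [L / 2]
    of one of its ends, and they are compact. *)
Definition tcore (a : bool * bool * S) : set K :=
  [set w | sheet_rep H V a.1 a.2 = a.2 /\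
     (`|Re (w ^+ ord a)| <= L / 2 /\ `|Im (w ^+ ord a)| <= L / 2)].

Lemma tcore_dom a : tcore a `<=` tdom a.
Proof. by move=> w [ra [h1 h2]]; split=> //; split; lra. Qed.

Lemma tcover (p : point) : exists a w, tcore a w /\ tphi a w = p.
Proof.
case: p => -[[[a x] [b y]] s] pok; have := pok; rewrite /tpt_ok => /and3P[hx hy hv].
have [a' [tx [h1 e1]]] := circ_surj a hx; have [b' [ty [h2 e2]]] := circ_surj b hy.
pose c := (a', b'); pose z : K := Complex tx ty.
have zs : in_star z by split=> /=; lra.
pose l := invF (@sheet_inj R S H V c z) s.
have sl : sheet H V c z l = s by rewrite /l f_invF.
pose s' := sheet_rep H V c l.
have ss' : sheet_rep H V c s' = s' by exact: sheet_repK.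
have con : fconnect (monodromy H V c) s' l.
  by rewrite (monodromy_sym H V c); exact: connect_root.
pose n := sheet_order H V c s'.
have n0 : (0 < n)%N by exact: sheet_order_gt0.
have star_p : star H V c z l = ((a, x), (b, y), s) by rewrite /star /= e1 e2 sl.
have [z0|z0] := eqVneq z 0.
  exists (c, s'), 0; have D0 : tcore (c, s') 0.
    split=> //=; rewrite expr0n gtn_eqF //= normr0; lra.
  split=> //; apply: val_inj; rewrite val_tphi; last exact: tcore_dom.
  move: star_p; rewrite z0 star0 raw0 /= => -[ea ex eb ey es].
  (* At a vertex the normal form already carries the representative of its cycle. *)
  rewrite -ea -ex -eb -ey; congr pair.
  move: hv; rewrite -ea -ex -eb -ey eqxx /= -es => /eqP ll.
  by rewrite /s' ll.
(* Among the n roots of [z], the one in the sector numbered by the place of [l] in its cycle lies on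
   the required sheet. *)
have [w [wn tw w0]] := turn_surj n0 z0 (findex_max con).
have Cw : tcore (c, s') w by split=> //=; rewrite wn.
exists (c, s'), w; split=> //; apply: val_inj; rewrite val_tphi; last exact: tcore_dom.
by rewrite /raw /= wn tw iter_findex.
Qed.

Lemma tcore_compact a : compact (tcore a).
Proof.
apply: (@subclosed_compact _ _ [set z : K | `|Re z| <= 8 /\ `|Im z| <= 8]).
- have cX x : {for x, continuous (fun x : K => x ^+ ord a)}.
    by apply: continuousX; exact: continuous_at_id.
  have closed_le (f : K -> R) (d : R) : (forall z, {for z, continuous f}) ->
      closed [set z | f z <= d].
    move=> cf; apply: (@closed_comp _ _ f [set y | y <= d]); last exact: closed_le.
    by move=> z _; exact: cf.
  have [ra|nra] := pselect (sheet_rep H V a.1 a.2 = a.2); last first.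
    by rewrite (_ : tcore a = set0); [exact: closed0|rewrite -subset0 => w []].
  rewrite (_ : tcore a = [set w | `|Re (w ^+ ord a)| <= L / 2] `&` [set w | `|Im (w ^+ ord a)| <= L / 2]).
    apply: closedI; apply: closed_le => z; apply: continuous_normr.
      by apply: (continuous_comp (f := fun x : K => x ^+ ord a) (g := Re) (cX z)); exact: continuous_Re.
    by apply: (continuous_comp (f := fun x : K => x ^+ ord a) (g := Im) (cX z)); exact: continuous_Im.
  by apply/seteqP; split=> w /= [].
- by apply: compact_box_closed.
- move=> w /tcore_dom/tdom_bounded h /=.
  by split; apply: le_trans (ltW h); [exact: Re_modulus|exact: Im_modulus].
Qed.

Lemma tcover_dom (p : point) : exists a w, tdom a w /\ tphi a w = p.
Proof. by have [a [w [/tcore_dom Dw e]]] := tcover p; exists a, w. Qed.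

Definition tiling_atlas : atlas R :=
  @Atlas R point (bool * bool * S)%type tdom tphi tpsi 8 tdom_open tcover_dom
    (@tphiK R S H V s0) tcompat tdom_offset tseparated.

End TilingAtlas.

(** * Tubes around the vertices *)

Section FinitePoints.
Variable R : realType.

Lemma smooth_on_dim0 m (F : 'rV[R]_0 -> 'rV[R]_m) A : smooth_on F A.
Proof.
move=> u Au; exists setT, F; split=> //; first exact: openT.
have cF (G : 'rV[R]_0 -> 'rV[R]_m) v : {for v, continuous G}.
  rewrite (_ : G = fun=> G 0); first exact: cst_continuous.
  by apply/funext => x; rewrite [x]thinmx0.
case=> [|r]; first by split.
by split=> // -[].
Qed.

Variable T : finType.
Local Notation pt := (discrete_topology T).

Definition fp_dom (a : T) : set pt := [set a].
Definition fp_chart (a : T) (p : pt) : 'rV[R]_0 := 0.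
Definition fp_param (a : T) (u : 'rV[R]_0) : pt := a.

Lemma fp_second_countable : @second_countable pt.
Proof.
exists ((fun x : pt => [set x]) @` setT).
  exact: (sub_countable (card_image_le _ _) (countableP [set: T])).
split=> [_ [x _ <-]|x A]; first exact: discrete_open.
by move=> /nbhs_singleton Ax; exists [set x] => [|_ -> //]; split=> //; exists x.
Qed.

Lemma fp_dom_cover (p : pt) : exists a, fp_dom a p.
Proof. by exists p. Qed.

Lemma fp_chartK a p : fp_dom a p -> fp_param a (fp_chart a p) = p.
Proof. by move=> ->. Qed.

Lemma fp_chart_image a : exists2 U : set 'rV[R]_0, open U &
  fp_chart a @` fp_dom a = U `&` @halfspace R 0.
Proof.
exists setT; first exact: openT.
apply/seteqP; split=> [u _|u _]; first by split=> // -[].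
by exists a => //; rewrite [u]thinmx0.
Qed.

Lemma fp_chart_continuous a : {within fp_dom a, continuous (fp_chart a)}.
Proof. by apply: continuous_in_subspaceT => p _; exact: cst_continuous. Qed.

Lemma fp_param_continuous a :
  {within fp_chart a @` fp_dom a, continuous (fp_param a)}.
Proof. by apply: continuous_in_subspaceT => p _; exact: cst_continuous. Qed.

Definition fp_mfd : manifold R 0 :=
  @Manifold R 0 pt T fp_dom fp_chart fp_param discrete_hausdorff
    fp_second_countable (fun a => discrete_open _) fp_dom_cover fp_chartK
    fp_chart_image fp_chart_continuous fp_param_continuous
    (fun a b => @smooth_on_dim0 0 _ _).

Lemma fp_orientation : is_orientation ((fun _ _ => false) : orientation_data fp_mfd).
Proof.
split=> [a p _|a b p J _]; first by near=> q.
by rewrite !mul1r det_mx00 ltr01.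
Unshelve. all: by end_near. Qed.

Definition fp (G : str_group) : gmanifold R G 0 :=
  GManifold (fun _ : G = SO2 => fp_orientation).

Lemma fp_compact : compact [set: fp_mfd].
Proof. by apply: finite_compact; exact: finite_finset. Qed.

Lemma fp_diffeo : diffeo (idfun : fp_mfd -> fp_mfd).
Proof.
have s : smooth_map (idfun : fp_mfd -> fp_mfd).
  split; first by apply: continuous_in_subspaceT => p _; exact: continuous_at_id.
  by move=> a b; exact: smooth_on_dim0.
by split=> //; exists idfun.
Qed.

Lemma trivial_in_group (G : str_group) : Defs.in_group G (1%:M : 'M[R]_2).
Proof. by split=> [|_]; rewrite ?trmx1 ?mulmx1 ?det1. Qed.

Definition trivial_bundle (G : str_group) : disk_bundle G fp_mfd.
Proof.
refine (@DiskBundle R G 0 fp_mfd unit (fun _ => setT) (fun _ _ _ => 1%:M)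
  (fun _ => openT) (fun x => ex_intro _ tt I) (fun _ _ _ _ _ => trivial_in_group G)
  _ (fun _ _ _ => @smooth_on_dim0 _ _ _)).
by move=> *; rewrite mulmx1.
Defined.

Lemma act1 (z : 'rV[R]_2) : act 1%:M z = z.
Proof. by rewrite /act trmx1 mulmx1. Qed.

Lemma mu1 j : mu j (1%:M : 'M[R]_2) = 1%:M.
Proof. by rewrite /mu det1 eqxx; exact: expr1n. Qed.

Lemma trivial_iso (G : str_group) j :
  bundle_iso (xit := trivial_bundle G) (xi := trivial_bundle G) j
    (idfun : fp_mfd -> fp_mfd) (fun _ _ _ => 1%:M).
Proof.
split.
- exact: fp_diffeo.
- by move=> *; exact: trivial_in_group.
- by move=> * /=; rewrite mu1 mulmx1.
- by move=> *; exact: smooth_on_dim0.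
Qed.

End FinitePoints.

Section DiskJacobian.
Variable R : realType.
Local Notation K := (cplx R).

Lemma disk_convex (z y : 'rV[R]_2) (t : R) : disk z -> disk y -> 0 <= t <= 1 ->
  disk (z + t *: (y - z)).
Proof.
rewrite /disk /= !mxE => hz hy /andP[t0 t1].
set a := z 0 0 in hz *; set b := z 0 1 in hz *.
set c := y 0 0 in hy *; set d := y 0 1 in hy *.
have h : 0 <= t * (1 - t) by rewrite mulr_ge0 ?subr_ge0.
have := sqr_ge0 (a - c); have := sqr_ge0 (b - d).
(* The squared norm of a convex combination is the combination of the squared norms minus t (1 - t)
   times the squared distance. *)
have -> : (a + t * (c - a)) ^+ 2 + (b + t * (d - b)) ^+ 2 =
   (1 - t) * (a ^+ 2 + b ^+ 2) + t * (c ^+ 2 + d ^+ 2) -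
   t * (1 - t) * ((a - c) ^+ 2 + (b - d) ^+ 2) by ring.
move=> s1 s2.
have h1 : (1 - t) * (a ^+ 2 + b ^+ 2) <= 1 - t.
  by rewrite ler_piMr // subr_ge0.
have h2 : t * (c ^+ 2 + d ^+ 2) <= t by rewrite ler_piMr.
have h3 : 0 <= t * (1 - t) * ((a - c) ^+ 2 + (b - d) ^+ 2).
  by rewrite mulr_ge0 // addr_ge0.
lra.
Qed.

(* The disk spans the plane as seen from each of its points, including those of
   its boundary, so that differentials within the disk are unique. *)
Lemma jac_within_disk m (F : 'rV[R]_2 -> 'rV[R]_m) A u J J' :
  disk u -> (\forall v \near u, disk v -> A v) ->
  jac_within F A u J -> jac_within F A u J' -> J = J'.
Proof.
move=> du nA hJ hJ'.
have dirE y : disk y -> (y - u) *m J = (y - u) *m J'.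
  move=> dy; apply: (jac_within_dir hJ hJ').
  have cu : {for 0, continuous (fun t : R => u + t *: (y - u))}.
    apply: continuousD; first exact: cst_continuous.
    by apply: continuousZr_tmp; exact: continuous_at_id.
  have nt : \forall t \near (0 : R), disk (u + t *: (y - u)) -> A (u + t *: (y - u)).
    apply: (near_continuous (A := fun v => disk v -> A v) cu).
    by rewrite scale0r addr0.
  have nt' : \forall t \near (0:R)^'+, disk (u + t *: (y - u)) -> A (u + t *: (y - u)).
    by apply: cvg_within; exact: nt.
  near=> t; have h : disk (u + t *: (y - u)) -> A (u + t *: (y - u)) by near: t; exact: nt'.
  apply: h; apply: disk_convex => //; apply/andP; split; first exact: ltW.
  by near: t; exact: nbhs_right_le.
(* The direction from [u] to the centre removes [u] itself; the directions to the basis vectors,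
   which lie on the unit circle, then yield the rows. *)
have uE : u *m J = u *m J'.
  have d0 : disk (0 : 'rV[R]_2) by rewrite /disk /= !mxE expr0n addr0 ler01.
  by apply: oppr_inj; rewrite -!mulNmx -(add0r (- u)); exact: dirE.
apply/row_matrixP => i; rewrite !rowE.
have de : disk (delta_mx 0 i : 'rV[R]_2).
  rewrite /disk /= !mxE /=; case: i => [[|[|//]] p] /=.
    by rewrite expr1n expr0n addr0.
  by rewrite expr1n expr0n add0r.
by have := dirE _ de; rewrite !mulmxBl uE => /addIr.
Unshelve. all: by end_near. Qed.

Lemma disk_modulus (z : 'rV[R]_2) : disk z -> modulus (cx z) <= 1.
Proof.
by rewrite /disk /= => h; rewrite /modulus -sqrtr1 ler_sqrt.
Qed.

(** Over a base of dimension 0, the coordinates on the total space are those of the fibre. *)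
Lemma lsubmx_dim0 (u : 'rV[R]_2) : @lsubmx R 1 2 0 u = u.
Proof. by apply/rowP => i; rewrite mxE; congr (u _ _); exact: val_inj. Qed.

Lemma row_mx_dim0 (z : 'rV[R]_2) (v : 'rV[R]_0) : row_mx z v = z :> 'rV[R]_2.
Proof.
rewrite -[RHS](row_mxKl z v); apply/esym; exact: lsubmx_dim0.
Qed.

End DiskJacobian.

Section Tubes.
Variable R : realType.
Local Notation K := (cplx R).
Local Notation Re := (@complex.Re R).
Local Notation Im := (@complex.Im R).
Local Notation L := (4 : R).
Variables (S : finType) (H V : bool * bool -> {perm S}) (s0 : S).
Local Notation X := (tiling_atlas R H V s0).
Local Notation phi := (@cover_phi R X).
Local Notation tdom := (@tdom R S H V).
Local Notation raw := (@raw R S H V).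
Local Notation ord a := (sheet_order H V a.1 a.2).

(** One cycle is selected at each vertex to carry the tube. The covering is later assumed to be
    unramified at all the other cycles, so that a vertex carries at most one singular point. *)
Variable base : bool * bool -> S.
Hypothesis baseP : forall c, sheet_rep H V c (base c) = base c.

Definition vbase c : bool * bool * S := (c, base c).

Lemma modulus_star (z : K) n : modulus z <= 1 ->
  `|Re (z ^+ n)| <= 1 /\ `|Im (z ^+ n)| <= 1.
Proof.
move=> h; have hn : modulus (z ^+ n) <= 1.
  by rewrite modulusX exprn_ile1 // modulus_ge0.
by split; apply: le_trans hn; [exact: Re_modulus|exact: Im_modulus].
Qed.

Lemma modulus_tdom c (z : K) : modulus z <= 1 -> tdom (vbase c) z.
Proof.
move=> /modulus_star h; split; first exact: baseP.
by have [h1 h2] := h (ord (vbase c)); split; apply: le_lt_trans; [exact: h1| |exact: h2|]; lra.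
Qed.

(** On an arc of length 4, a position at most 1 lies just after a vertex and one at least 3 just
    before the next, so the nearby vertex is determined. Hence tubes around different vertices are
    disjoint. *)
Lemma circ_near_inj a a' (t t' : R) : `|t| <= 1 -> `|t'| <= 1 ->
  circ a t = circ a' t' -> a = a'.
Proof.
rewrite !ler_norml /circ => /andP[? ?] /andP[? ?].
by case: (leP 0 t) => ?; case: (leP 0 t') => ? [e1 e2];
   [exact: e1|exfalso; lra|exfalso; lra|exact: negb_inj].
Qed.

Lemma tube_phi_inj c c' (z z' : K) : modulus z <= 1 -> modulus z' <= 1 ->
  phi (vbase c) z = phi (vbase c') z' -> c = c' /\ z = z'.
Proof.
move=> hz hz' e; have Dz := modulus_tdom c hz; have Dz' := modulus_tdom c' hz'.
have := congr1 val e; rewrite (val_tphi s0 Dz) (val_tphi s0 Dz') => er.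
have [h1 h2] := modulus_star (ord (vbase c)) hz.
have [h1' h2'] := modulus_star (ord (vbase c')) hz'.
have cc : c = c'.
  rewrite [LHS]surjective_pairing [RHS]surjective_pairing; congr pair.
    exact: circ_near_inj h1 h1' (congr1 (fun p : bool * R * (bool * R) * S => p.1.1) er).
  exact: circ_near_inj h2 h2' (congr1 (fun p : bool * R * (bool * R) * S => p.1.2) er).
split; first exact: cc.
by rewrite -cc in Dz' er; exact: raw_inj Dz Dz' er.
Qed.

Variables (T : finType) (iota : T -> bool * bool).
Hypothesis iota_inj : injective iota.
Variable G : str_group.

(** The closed unit disk of the chart itself, so that the covering is exactly z^j in these
    coordinates, without any isotopy or rescaling. *)
Definition tube_map (a : unit) (c : fp_mfd R T) (z : 'rV[R]_2) : amfd X :=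
  phi (vbase (iota c)) (cx z).

Lemma tube_map_continuous (p : discrete_topology T * 'rV[R]_2) : disk p.2 ->
  {for p, continuous (fun p : fp_mfd R T * 'rV[R]_2 => tube_map tt p.1 p.2)}.
Proof.
case: p => c z /= dz.
have cz : {for (c, z) : fp_mfd R T * 'rV[R]_2,
    continuous (fun p : fp_mfd R T * 'rV[R]_2 => tube_map tt c p.2)}.
  apply: (continuous_comp (f := fun p : fp_mfd R T * 'rV[R]_2 => p.2)
                          (g := fun z => tube_map tt c z)); first exact: cvg_snd.
  apply: (continuous_comp (f := @cx R) (g := phi (vbase (iota c)))).
    exact: continuous_cx.
  by apply: continuous_phi; apply: modulus_tdom; exact: disk_modulus.
apply: near_eq_continuous cz.
have cf : {for (c, z) : fp_mfd R T * 'rV[R]_2,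
    continuous (fun p : fp_mfd R T * 'rV[R]_2 => p.1)} by exact: cvg_fst.
have nc : \forall p \near ((c, z) : fp_mfd R T * 'rV[R]_2), p.1 = c.
  by apply: (near_continuous (A := fun x => x = c) cf); exact: discrete_set1.
by near=> p; have -> : p.1 = c by near: p; exact: nc.
Unshelve. all: by end_near. Qed.

Lemma tube_extension (c : T) (b : aidx X) (z : 'rV[R]_2) :
  disk z -> dom (b : cidx (amfd X)) (tube_map tt c z) ->
  exists (W : set 'rV[R]_2) (F : 'rV[R]_2 -> 'rV[R]_2),
  [/\ open W, W z, forall r, Ck_on r F W,
      forall v, W v -> dom (b : cidx (amfd X)) (tube_map tt c v) /\
        achart b (tube_map tt c v) = F v
    & exists2 d, d != 0 & forall A, jac_within F A z (cmat d)].
Proof.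
move=> dz [w Dw e]; have Dz := modulus_tdom (iota c) (disk_modulus dz).
have [U [F [h Uz Fz]]] := @atlas_trans R X (vbase (iota c)) b (cx z) w Dz Dw (esym e).
have [oU hF eU] := h; have [d dF] := hrep_cder h Uz.
pose F' x := F x + aB X.
exists (@cx R @^-1` U), (@rv R \o F' \o @cx R); split.
- by apply: open_comp => // u _; exact: continuous_cx.
- exact: Uz.
- apply: (@hol_smooth R F' U oU) => r; apply: holD; [exact: hF|exact: hol_cst].
- move=> v Uv; have [_ DFv ev] := eU _ Uv; split; first by exists (F (cx v)).
  by rewrite /tube_map -[phi _ _]/(idfun (phi _ _)) -ev achart_phi.
- exists d; first exact: atlas_trans_neq0 h Uz dF.
  move=> A; apply: cder_jac; rewrite -[d]addr0.
  by apply: cderD; [exact: dF|exact: cder_cst].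
Qed.

Let e : bidx (trivial_bundle R T G) -> fp R T G -> 'rV[R]_2 -> amfd X := tube_map.

Lemma tube_coordsP (a : unit) (c : T) (b : aidx X) u :
  tube_coords (xi := trivial_bundle R T G) (V := fp R T G) (M := amfd X) e a c b u ->
  disk (u : 'rV[R]_2) /\ dom (b : cidx (amfd X)) (tube_map tt c u).
Proof.
move=> [x [z [-> /= xc _ dz bz]]]; rewrite row_mx_dim0; split; first exact: dz.
by move: bz; rewrite /e /tube_map xc.
Qed.

Lemma tube_coordsI (a : unit) (c : T) (b : aidx X) (u : 'rV[R]_2) :
  disk u -> dom (b : cidx (amfd X)) (tube_map tt c u) ->
  tube_coords (xi := trivial_bundle R T G) (V := fp R T G) (M := amfd X) e a c b u.
Proof.
move=> du bu; exists c, u; split=> //; by rewrite row_mx_dim0.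
Qed.

Lemma tube_repE (a : unit) (c : T) (b : aidx X) (u : 'rV[R]_2) :
  tube_rep (xi := trivial_bundle R T G) (V := fp R T G) (M := amfd X) e a c b u =
  achart b (tube_map tt c u).
Proof. by rewrite /tube_rep lsubmx_dim0. Qed.

(** Being complex multiplication by a nonzero number, the differential gives the immersion and the
    orientation conditions together. Uniqueness within the disk brings an arbitrary [J] to this
    form. *)
Lemma tube_jac (a : unit) (c : T) (b : aidx X) u (J : 'M[R]_2) :
  tube_coords (xi := trivial_bundle R T G) (V := fp R T G) (M := amfd X) e a c b u ->
  jac_within (tube_rep (xi := trivial_bundle R T G) (V := fp R T G) (M := amfd X) e a c b)
    (tube_coords (xi := trivial_bundle R T G) (V := fp R T G) (M := amfd X) e a c b) u J ->
  exists2 d, d != 0 & J = cmat d.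
Proof.
move=> Au hJ; have [du bu] := tube_coordsP Au.
have [W [F [oW Wu _ eW [d d0 dF]]]] := tube_extension du bu.
exists d; first exact: d0.
have nW : \forall v \near (u : 'rV[R]_2), W v by exact: open_nbhs_nbhs.
apply: (jac_within_disk du _ hJ).
  near=> v => dv; have Wv : W v by near: v; exact: nW.
  by have [bv _] := eW _ Wv; exact: tube_coordsI dv bv.
apply: (jac_within_near (F := F)) (dF _); first exact: Au.
near=> v => _; rewrite tube_repE.
have Wv : W v by near: v; exact: nW.
by have [_ ->] := eW _ Wv.
Unshelve. all: by end_near. Qed.

Lemma tube_map_embedding :
  tube_embedding (xi := trivial_bundle R T G) (V := fp R T G) (M := amfd X) e.
Proof.
split.
- move=> a b x y z w _ dz _ dw; rewrite /= act1; split=> [exy|[-> ->] //].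
  have [xy zw] := tube_phi_inj (disk_modulus dz) (disk_modulus dw) exy.
  split; first exact: iota_inj.
  exact: (can_inj (@cxK R)).
- move=> a; apply: continuous_in_subspaceT => p /set_mem[_ dp].
  exact: tube_map_continuous.
- move=> a c b u Au; have [du bu] := tube_coordsP Au.
  have [W [F [oW Wu hF eW _]]] := tube_extension du bu.
  exists W, F; split=> // v _ Wv; rewrite tube_repE.
  by have [] := eW _ Wv.
- move=> a c b u J Au /(tube_jac Au)[d d0 ->].
  by rewrite unitmxE unitfE gt_eqF // det_cmat_gt0.
- move=> _ a c b x z J Au _ /(tube_jac Au)[d d0 ->].
  by rewrite /osign !expr0 !mul1r det_cmat_gt0.
Qed.

Lemma tube_map_zero : zero_section (xi := trivial_bundle R T G) (V := fp R T G) (M := amfd X) e =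
  [set p | exists c : T, p = phi (vbase (iota c)) 0].
Proof.
have cx0 : cx (0 : 'rV[R]_2) = 0 by apply: complex_eqP; rewrite /= mxE.
by apply/seteqP; split=> [_ [a [c [_ ->]]]|_ [c ->]];
  [exists c|exists tt, c]; rewrite /e /tube_map cx0.
Qed.

End Tubes.

(** * The covering of the torus *)

Section LocalInverse.
Variable K : numFieldType.

(** Both [x] and [r (x ^+ n)] have the same n-th power, so the product of their difference with
    [Q x] vanishes; and [Q] is not 0 near [w], its value there being n w^(n-1). *)
Lemma power_locally_injective n (r : K -> K) (w : K) : (0 < n)%N -> w != 0 ->
  {for w ^+ n, continuous r} -> r (w ^+ n) = w ->
  (\forall z \near w ^+ n, r z ^+ n = z) ->
  \forall x \near w, r (x ^+ n) = x.
Proof.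
move=> n0 w0 cr rw rn.
have cX : {for w, continuous (fun x : K => x ^+ n)}.
  by apply: continuousX; exact: continuous_at_id.
have cy : {for w, continuous (fun x : K => r (x ^+ n))}.
  exact: (continuous_comp (f := fun x : K => x ^+ n) (g := r) cX).
pose Q (x : K) := \sum_(i < n) x ^+ (n.-1 - i) * r (x ^+ n) ^+ i.
have Qw : Q w = n%:R * w ^+ n.-1.
  rewrite /Q rw (eq_bigr (fun=> w ^+ n.-1)) ?sumr_const ?card_ord ?mulr_natl //.
  by move=> i _; rewrite -exprD subnK // -ltnS prednK.
have cQ : {for w, continuous Q}.
  rewrite (_ : Q = \sum_(i < n) (fun x => x ^+ (n.-1 - i) * r (x ^+ n) ^+ i)).
    apply: (@big_ind _ (fun f : K -> K => {for w, continuous f})) => [|f1 f2|i _].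
    - exact: cst_continuous.
    - exact: continuousD.
    - apply: continuousM; last exact: continuousX.
      by apply: continuousX; exact: continuous_at_id.
  by apply/funext => x; rewrite fct_sumE.
have nQ : \forall x \near w, Q x != 0.
  apply: (near_continuous (A := fun y => y != 0) cQ).
  by apply: near_neq0; rewrite Qw mulf_neq0 ?expf_neq0 // pnatr_eq0 -lt0n.
have nr : \forall x \near w, r (x ^+ n) ^+ n = x ^+ n.
  exact: (near_continuous (A := fun z => r z ^+ n = z) cX).
near=> x; have Qx : Q x != 0 by near: x; exact: nQ.
have rx : r (x ^+ n) ^+ n = x ^+ n by near: x; exact: nr.
have := subrXX x (r (x ^+ n)) n; rewrite rx subrr => /esym/eqP.
by rewrite mulf_eq0 -[X in _ || (X == 0)]/(Q x) (negbTE Qx) orbF subr_eq0 => /eqP.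
Unshelve. all: by end_near. Qed.

End LocalInverse.

Section Covering.
Variable R : realType.
Local Notation K := (cplx R).
Local Notation Re := (@complex.Re R).
Local Notation Im := (@complex.Im R).
Variables (S : finType) (H V : bool * bool -> {perm S}) (s0 : S).
Local Notation X := (tiling_atlas R H V s0).
Local Notation ord a := (sheet_order H V a.1 a.2).
Local Notation tdom := (@tdom R S H V).

(** The torus is itself such a tiling, with a single sheet, so that one construction yields both
    surfaces. *)
Definition trivial_perm (c : bool * bool) : {perm unit} := 1%g.
Local Notation Y := (tiling_atlas R trivial_perm trivial_perm tt).
Local Notation phiX := (@cover_phi R X).
Local Notation phiY := (@cover_phi R Y).

Lemma trivial_order c s : sheet_order trivial_perm trivial_perm c s = 1%N.
Proof.
apply/eqP; rewrite eqn_leq sheet_order_gt0 andbT.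
by apply: leq_trans (max_card _) _; rewrite card_unit.
Qed.

Lemma tiling_proj_ok (p : bool * R * (bool * R) * S) :
  tpt_ok H V p -> tpt_ok trivial_perm trivial_perm (p.1, tt).
Proof.
case: p => [[[a x] [b y]] s] /and3P[h1 h2 _]; rewrite /tpt_ok /= h1 h2 /=.
by apply/implyP => _; case: (sheet_rep _ _ _ _).
Qed.

Definition tiling_proj (p : amfd X) : amfd Y :=
  exist _ ((val p).1, tt) (tiling_proj_ok (valP p)).

Lemma tdom_proj a w : tdom a w ->
  @adom R Y (a.1, tt) (w ^+ ord a).
Proof.
by move=> [_ h]; split; [case: (sheet_rep _ _ _ _)|rewrite /= trivial_order expr1].
Qed.

Lemma tiling_proj_phi a w : tdom a w ->
  tiling_proj (phiX a w) = phiY (a.1, tt) (w ^+ ord a).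
Proof.
move=> Dw; apply: val_inj; rewrite /= [RHS](val_tphi _ (tdom_proj Dw)).
rewrite [val (phiX a w)](val_tphi _ Dw) /raw /= trivial_order expr1 /star /=.
by congr pair; case: (sheet _ _ _ _ _).
Qed.

Lemma tiling_proj_hrep a : hrep tiling_proj (a : aidx X) ((a.1, tt) : aidx Y)
  (tdom a) (fun w => w ^+ ord a).
Proof.
split; [exact: tdom_open|by move=> r; exact: holX|].
move=> w Dw; split; [exact: Dw|exact: tdom_proj|].
by rewrite -tiling_proj_phi.
Qed.

Lemma tiling_proj_holo p : holo_at tiling_proj p.
Proof.
have [a [w [Dw e]]] := tcover_dom s0 p.
exists a, (a.1, tt), (tdom a), (fun w => w ^+ ord a), w.
by split; [exact: tiling_proj_hrep|exact: Dw|exact: e].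
Qed.

Lemma tiling_proj_critical a w : tdom a w -> (1 < ord a)%N -> w = 0 ->
  ~ regular_at tiling_proj (phiX a w).
Proof.
move=> Dw n1 w0; apply: (hrep_critical (tiling_proj_hrep a) Dw).
have := cderX (ord a) w; rewrite w0 expr0n.
by case: (ord a) n1 => [|[|n]] // _; rewrite mulr0.
Qed.

(** In charts the projection is a power map. Its inverse is a local root away from the centre, and
    the identity if the order is 1. *)
Lemma tiling_proj_local_diffeo a w : tdom a w -> (w != 0) || (ord a == 1%N) ->
  local_diffeo tiling_proj (phiX a w).
Proof.
move=> Dw; have n0 : (0 < ord a)%N := sheet_order_gt0 H V a.1 a.2.
have [w0 _|w0 /= /eqP n1] := boolP (w != 0); last first.
  apply: (hrep_local_diffeo (V := setT) (S := id) (tiling_proj_hrep a) Dw).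
  - exact: openT.
  - by move=> r; exact: hol_id.
  - by [].
  - by move=> x _ _; rewrite n1 expr1.
  - by move=> y _; rewrite n1 expr1.
  - by rewrite n1 expr1.
have [W [r [oW Ww W0 rw [rX cr]]]] := local_root n0 (expf_neq0 (ord a) w0) erefl.
have nr : \forall x \near w, r (x ^+ ord a) = x.
  apply: power_locally_injective => //; first exact: cr.
  have : \forall z \near w ^+ ord a, W z by exact: open_nbhs_nbhs.
  move=> nW; near=> z; apply: rX; near: z; exact: nW.
have nU : nbhs w (fun x => tdom a x /\ r (x ^+ ord a) = x).
  by apply: filterI; [exact: near_tdom|exact: nr].
have [U [oU Uw UP]] := near_open nU.
have hU : hrep tiling_proj (a : aidx X) ((a.1, tt) : aidx Y) U (fun w => w ^+ ord a).
  split; [exact: oU|by move=> k; exact: holX|].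
  by move=> x /UP[Dx _]; have [_ _] := tiling_proj_hrep a; apply.
apply: (hrep_local_diffeo (V := W) (S := r) hU Uw oW).
- by move=> k; exact: hol_root n0 oW W0 cr rX.
- exact: Ww.
- by move=> x /UP[_ ex] _.
- exact: rX.
- exact: rw.
Unshelve. all: by end_near. Qed.

(** A nontrivial cycle over a vertex would give a critical point. Over a regular value all cycles
    are therefore single sheets, and each sheet is its own representative. *)
Lemma regular_fiber (y : amfd Y) :
  (forall p, tiling_proj p = y -> regular_at tiling_proj p) ->
  forall s, tpt_ok H V ((val y).1, s).
Proof.
case: y => [[[[a x] [b z]] u] yok] hreg s /=.
have /and3P[h1 h2 _] := yok.
rewrite h1 h2 /=; apply/implyP => /andP[/eqP x0 /eqP z0].
pose s' := sheet_rep H V (a, b) s.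
have ok' : tpt_ok H V ((a, x), (b, z), s').
  by rewrite /tpt_ok h1 h2 /= /s' sheet_repK eqxx implybT.
pose p : amfd X := exist (fun p => is_true (tpt_ok H V p)) _ ok'.
have Dp : tdom (a, b, s') 0.
  split; first exact: sheet_repK.
  by rewrite expr0n gtn_eqF ?sheet_order_gt0 //; split; rewrite /= normr0.
have ep : phiX (a, b, s') 0 = p.
  by apply: val_inj; rewrite [LHS](val_tphi _ Dp) raw0 /= x0 z0.
have reg : regular_at tiling_proj p.
  by apply: hreg; apply: val_inj; rewrite /=; case: (u).
rewrite -ep in reg; have [n1|n1] := ltnP 1 (sheet_order H V (a, b) s').
  by have := tiling_proj_critical Dp n1 erefl reg.
have : fconnect (monodromy H V (a, b)) s' s.
  by rewrite (monodromy_sym H V (a, b)); exact: connect_root.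
move=> con; have /esym := iter_findex con.
have : (findex (monodromy H V (a, b)) s' s < 1)%N.
  exact: leq_trans (findex_max con) n1.
by rewrite ltnS leqn0 => /eqP -> /= e; apply/eqP; exact: esym e.
Qed.

Definition lift_sheet (q : bool * R * (bool * R)) (s : S) : amfd X :=
  insubd (exist _ (origin R H V s0) (origin_ok R H V s0)) (q, s).

(** The sheets are in bijection with the fibre over a regular value, and every regular point of a
    holomorphic map counts +1. *)
Lemma tiling_proj_degree (y : amfd Y) :
  (forall p, tiling_proj p = y -> regular_at tiling_proj p) ->
  \sum_(p \in tiling_proj @^-1` [set y]) local_degree tiling_proj p = #|S|%:Z.
Proof.
move=> hreg; have ok := regular_fiber hreg.
have vl s : val (lift_sheet (val y).1 s) = ((val y).1, s).
  by rewrite val_insubd ok.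
have fibE : tiling_proj @^-1` [set y] = lift_sheet (val y).1 @` [set: S].
  apply/seteqP; split=> [p /= e|_ [s _ <-]].
    exists (val p).2 => //; apply: val_inj; rewrite vl -e /=.
    by case: (val p).
  by apply: val_inj; rewrite /= vl /=; case: (val y) => q [].
rewrite fibE fsbig_image; last first.
  by move=> s t _ _ /(congr1 val); rewrite !vl => -[].
rewrite (eq_fsbigr (fun=> 1)); last first.
  move=> s _; rewrite /local_degree ifT //; apply/asboolP.
  apply: holo_preserves; first exact: tiling_proj_holo.
  by apply: hreg; apply: val_inj; rewrite /= vl /=; case: (val y) => q [].
have -> : [set: S] = [set` enum S].
  by apply/seteqP; split=> s //= _; rewrite mem_enum.
rewrite -fsbig_seq ?enum_uniq // big_const_seq count_predT -cardE iter_addr_0.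
by rewrite natz.
Qed.

End Covering.

Section CoveringOfSurfaces.
Variable R : realType.
Local Notation K := (cplx R).
Variables (S : finType) (H V : bool * bool -> {perm S}) (s0 : S).
Variable base : bool * bool -> S.
Hypothesis baseP : forall c, sheet_rep H V c (base c) = base c.
Hypothesis base_other : forall c s, sheet_rep H V c s = s -> s != base c ->
  sheet_order H V c s = 1%N.
Variables (G : str_group) (k : nat).
Hypothesis cardS : #|S| = k.
Local Notation X := (tiling_atlas R H V s0).
Local Notation Y := (tiling_atlas R trivial_perm trivial_perm tt).
Local Notation phiX := (@cover_phi R X).
Local Notation phiY := (@cover_phi R Y).
Local Notation border c := (sheet_order H V c (base c)).
Local Notation proj := (@tiling_proj R S H V s0).

Definition vertex_of j := {c : bool * bool | border c == j}.

Lemma ubaseP (c : bool * bool) : sheet_rep trivial_perm trivial_perm c tt = tt.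
Proof. by case: (sheet_rep _ _ _ _). Qed.

Lemma tube_normal_form j (c : vertex_of j) (z : 'rV[R]_2) : disk z ->
  proj (tube_map H V s0 base val tt c z) =
  tube_map trivial_perm trivial_perm tt (fun _ => tt) val tt c (act 1%:M (zpow j z)).
Proof.
move=> dz; rewrite /tube_map tiling_proj_phi; last first.
  by apply: modulus_tdom => //; exact: disk_modulus.
by rewrite act1 zpowE rvK /= (eqP (valP c)).
Qed.

Definition tiling_branch j : branch G (proj : amfd X -> amfd Y) j :=
  @Branch R G 0 (amfd X) (amfd Y) proj j (fp R (vertex_of j) G) (fp R (vertex_of j) G)
    (@fp_compact R (vertex_of j)) (@fp_compact R (vertex_of j))
    (trivial_bundle R (vertex_of j) G) (trivial_bundle R (vertex_of j) G)
    (tube_map H V s0 base val) (tube_map trivial_perm trivial_perm tt (fun _ => tt) val)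
    (@tube_map_embedding R S H V s0 base baseP (vertex_of j) val val_inj G)
    (@tube_map_embedding R unit trivial_perm trivial_perm tt (fun _ => tt) ubaseP (vertex_of j) val val_inj G)
    idfun (fun _ _ _ => 1%:M) (@trivial_iso R (vertex_of j) G j)
    (fun _ _ c z _ _ dz => tube_normal_form c dz).
Lemma zero_sectionE j :
  zero_section (bret (tiling_branch j)) =
  [set p | exists c : vertex_of j, p = phiX (vbase base (val c)) 0].
Proof. exact: tube_map_zero. Qed.

Lemma zero_sections_disjoint i j : i != j ->
  zero_section (bret (tiling_branch i)) `&` zero_section (bret (tiling_branch j)) = set0.
Proof.
move=> ij; rewrite !zero_sectionE -subset0 => p [[c ->] [d e]].
have m0 : modulus (0 : K) <= 1 by rewrite /modulus /= expr0n addr0 sqrtr0 ler01.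
have [cd _] := tube_phi_inj baseP m0 m0 e.
by move/eqP: ij; apply; rewrite -(eqP (valP c)) -(eqP (valP d)) cd.
Qed.

Lemma tubes_disjoint i j : i != j ->
  tube (bre (tiling_branch i)) `&` tube (bre (tiling_branch j)) = set0.
Proof.
move=> ij; rewrite -subset0 => p [[a [c [z [_ dz ->]]]] [b [d [w [_ dw e]]]]].
have [cd _] := tube_phi_inj ubaseP (disk_modulus dz) (disk_modulus dw) e.
by move/eqP: ij; apply; rewrite -(eqP (valP c)) -(eqP (valP d)) cd.
Qed.

Lemma border_le c : (border c <= k)%N.
Proof. by rewrite -cardS; exact: max_card. Qed.

Lemma proj_smooth : smooth_map (proj : amfd X -> amfd Y).
Proof. by apply: holo_smooth_on => p _; exact: tiling_proj_holo. Qed.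

Lemma proj_local_diffeo (p : amfd X) :
  (forall j : 'I_k.-1, ~ zero_section (bret (tiling_branch j.+2)) p) ->
  local_diffeo (proj : amfd X -> amfd Y) p.
Proof.
move=> np; have [[c s] [w [Dw e]]] := tcover_dom s0 p.
have D : (w != 0) || (sheet_order H V c s == 1%N).
  have [w0|//] := eqVneq w 0; rewrite /=.
  have [rs _] := Dw; have [sb|sb] := eqVneq s (base c); last by rewrite base_other.
  have [b1|b1] := eqVneq (border c) 1%N; first by rewrite sb b1.
  have b2 : (1 < border c)%N by rewrite ltn_neqAle eq_sym b1 sheet_order_gt0.
  (* The index [j] stands for the exponent [j + 2], and a cycle is no longer than the number k of
     sheets. *)
  have jlt : ((border c).-2 < k.-1)%N.
    by have := border_le c; case: (border c) b2 => [|[|n]] // _; case: (k).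
  case: (np (Ordinal jlt)); rewrite zero_sectionE /=.
  have cj : border c == (border c).-2.+2 by case: (border c) b2 => [|[|n]].
  by exists (exist _ c cj); rewrite -e w0 sb.
by rewrite -e; exact: (tiling_proj_local_diffeo s0 Dw D).
Qed.

Lemma proj_degree (x : amfd Y) :
  has_degree_over (proj : amfd X -> amfd Y) (connected_component [set: amfd Y] x) k%:Z.
Proof. by move=> y _ hreg; rewrite -cardS; exact: tiling_proj_degree. Qed.

Definition tiling_covering : branched_covering G k (amfd X) (amfd Y) :=
  @BranchedCovering R G k 0 (amfd X) (amfd Y) proj proj_smooth
    (fun j => tiling_branch j.+2) proj_degree proj_local_diffeo
    (fun p => holo_preserves (tiling_proj_holo p))
    (fun i j ij => tubes_disjoint (i := i.+2) (j := j.+2) ij)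
    (fun i j ij => zero_sections_disjoint (i := i.+2) (j := j.+2) ij).

Lemma tiling_closed (S' : finType) (H' V' : bool * bool -> {perm S'}) (s' : S') :
  closed_mfd (amfd (tiling_atlas R H' V' s')).
Proof.
split; last exact: amfd_boundary.
exact: (@amfd_compact R (tiling_atlas R H' V' s') (@tcore R S' H' V')
  (@tcore_compact R S' H' V') (@tcore_dom R S' H' V') (@tcover R S' H' V' s')).
Qed.

Definition tiling_surface_covering : surface_covering R G k :=
  @SurfaceCovering R G k (amfd X) (amfd Y) (tiling_closed H V s0)
    (tiling_closed trivial_perm trivial_perm tt) tiling_covering.

Lemma tiling_singular_points : singular_points tiling_surface_covering =
  (fun c => phiX (vbase base c) 0) @` [set c | (1 < border c)%N].
Proof.
apply/seteqP; split=> [p [j _]|_ [c /= c1 <-]].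
  rewrite /sbranch [bret _]/= -[zero_section _]/(zero_section (bret (tiling_branch j.+2))).
  rewrite zero_sectionE => -[c ->].
  by exists (val c) => //=; rewrite (eqP (valP c)).
have jlt : ((border c).-2 < k.-1)%N.
  by have := border_le c; case: (border c) c1 => [|[|n]] // _; case: (k).
exists (Ordinal jlt) => //.
rewrite -[zero_section _]/(zero_section (bret (tiling_branch (border c).-2.+2))).
rewrite zero_sectionE.
have cj : border c == (border c).-2.+2 by case: (border c) c1 => [|[|n]].
by exists (exist _ c cj).
Qed.

Lemma card_tiling_singular_points n : #|[pred c | 1 < border c]%N| = n ->
  (singular_points tiling_surface_covering #= `I_n)%card.
Proof.
move=> cn; rewrite tiling_singular_points.
have m0 : modulus (0 : K) <= 1 by rewrite /modulus /= expr0n addr0 sqrtr0 ler01.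
apply: card_eq_trans.
  by apply: inj_card_eq => c d _ _ e; have [] := tube_phi_inj baseP m0 m0 e.
have -> : [set c | (1 < border c)%N] =
    (@enum_val _ [pred c | 1 < border c]%N) @` [set: 'I_#|[pred c | 1 < border c]%N|].
  apply/seteqP; split=> [c /= c1|_ [i _ <-] /=]; last by have := enum_valP i.
  by exists (enum_rank_in (A := [pred c | 1 < border c]%N) c1 c); rewrite ?enum_rankK_in.
apply: (card_eq_trans (B := [set: 'I_n])); last by rewrite card_eq_sym card_II.
by rewrite -cn; apply: inj_card_eq => i j _ _; exact: enum_val_inj.
Qed.

Lemma card_singt (A : nzRingType) (j : 'I_k.-1) :
  \sum_(p \in [set: singt tiling_surface_covering j]) (1 : A) =
  #|[pred c | border c == j.+2]|%:R.
Proof.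
have -> : [set: singt tiling_surface_covering j] = [set` enum {: vertex_of j.+2}].
  by apply/seteqP; split=> s //= _; rewrite mem_enum.
rewrite -fsbig_seq ?enum_uniq // big_const_seq count_predT -cardE iter_addr_0.
by rewrite card_sig.
Qed.

End CoveringOfSurfaces.

(** * The permutations of the sheets *)

(** Computes the ramification of the selected cycle and shows that the other cycles are trivial,
    from an explicit cycle outside of which the permutation is the identity. *)
Lemma single_orbit (S : finType) (f : S -> S) (p : seq S) (x : S) :
  injective f -> fcycle f p -> uniq p -> x \in p ->
  (forall s, s \notin p -> f s = s) ->
  fingraph.order f (froot f x) = size p /\
  (forall s, froot f s = s -> s != froot f x -> fingraph.order f s = 1%N).
Proof.
move=> finj cp up xp fixp; have fsym := fconnect_sym finj.
have conp y : y \in p -> fconnect f x y by move=> yp; rewrite (fconnect_cycle cp xp).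
have rp : froot f x \in p.
  by rewrite -(fconnect_cycle cp xp) connect_root.
split; first by rewrite (order_cycle cp up rp).
move=> s rs sx; have [sp|sp] := boolP (s \in p).
  by move: sx; rewrite -rs (eqP (_ : froot f x == froot f s)) ?eqxx // root_connect // conp.
have cs : fcycle f [:: s] by rewrite /= fixp // eqxx.
by rewrite (order_cycle cs) ?mem_seq1.
Qed.

(* The reflection x |-> h - x of Z/N, extended by the identity. *)
Definition mirror (N h x : nat) : nat :=
  if (x < N)%N then if (x <= h)%N then (h - x)%N else (h + N - x)%N else x.

Lemma mirrorK N h : (h < N)%N -> involutive (mirror N h).
Proof. by move=> hN x; rewrite /mirror; do !case: ifP; lia. Qed.

Lemma mirror_lt N h n x : (h < N <= n)%N -> (x < n)%N -> (mirror N h x < n)%N.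
Proof. by rewrite /mirror; do !case: ifP; lia. Qed.

Lemma mirror_predE h x :
  mirror h.*2.+1 h.*2 x = if (x < h.*2.+1)%N then (h.*2 - x)%N else x.
Proof. by rewrite /mirror; do !case: ifP; lia. Qed.

(** The rotation by h + 1 of Z/(2h + 1), a square root of the rotation by 1. *)
Lemma mirror_mirror h x : mirror h.*2.+1 h (mirror h.*2.+1 h.*2 x) =
  if (x < h)%N then (x + h).+1 else if (x < h.*2.+1)%N then (x - h)%N else x.
Proof. by rewrite mirror_predE /mirror; do !case: ifP; lia. Qed.

Section Permutations.
Variables (n i : nat).
Hypothesis (i2 : (2 <= i <= n.+1)%N).
Local Notation S := 'I_n.+1.
Local Notation N := (if odd i then i else i.-1).

Lemma odd_size_bounds : (0 < N <= n.+1)%N.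
Proof. by case: ifP => _; lia. Qed.

Definition mirror_ord h (x : S) : S := inord (mirror N h x).

Lemma val_mirror_ord h x : (h < N)%N -> mirror_ord h x = mirror N h x :> nat.
Proof. by move=> hN; rewrite inordK // mirror_lt // hN; case/andP: odd_size_bounds. Qed.

Lemma mirror_ordK h : (h < N)%N -> involutive (mirror_ord h).
Proof. by move=> hN x; apply: val_inj; rewrite /= !val_mirror_ord // mirrorK. Qed.

Lemma half_lt : (N./2 < N)%N. Proof. by have := odd_size_bounds; lia. Qed.
Lemma pred_lt : (N.-1 < N)%N. Proof. by have := odd_size_bounds; lia. Qed.

Definition mirror_half : {perm S} := perm (can_inj (mirror_ordK half_lt)).
Definition mirror_pred : {perm S} := perm (can_inj (mirror_ordK pred_lt)).
(** For even i, [i.-1] is N, the first sheet fixed by both mirrors. A transposition involving it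
    lengthens the N-cycle to an i-cycle. *)
Definition swap : {perm S} := if odd i then 1%g else tperm ord0 (inord i.-1).

(* The monodromy at (true, false) is [swap], and at (false, false) it is an
   i-cycle: the rotation x |-> x + 1 of Z/N, which is the commutator of the two
   mirrors, composed with a conjugate of [swap].  At the two other vertices it is
   trivial. *)
Definition horizontal (c : bool * bool) : {perm S} :=
  if c.2 then 1%g else if c.1 then (mirror_half * swap)%g else mirror_half.
Definition vertical (c : bool * bool) : {perm S} := if c.1 then 1%g else mirror_pred.

Local Notation mono := (monodromy horizontal vertical).

Lemma mirror_halfV x : (mirror_half^-1)%g x = mirror_half x.
Proof. by apply: (@perm_inj _ mirror_half); rewrite permKV !permE mirror_ordK ?half_lt. Qed.
Lemma mirror_predV x : (mirror_pred^-1)%g x = mirror_pred x.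
Proof. by apply: (@perm_inj _ mirror_pred); rewrite permKV !permE mirror_ordK ?pred_lt. Qed.

Lemma swapK : involutive swap.
Proof. by rewrite /swap; case: odd => x; rewrite ?perm1 // tpermK. Qed.
Lemma swapV x : (swap^-1)%g x = swap x.
Proof. by apply: (@perm_inj _ swap); rewrite permKV swapK. Qed.

Lemma val_swap x : swap x = (if odd i then val x else if val x == 0 then N
  else if val x == N then 0 else val x)%N :> nat.
Proof.
rewrite /swap; case: ifPn => oi; first by rewrite perm1.
have NE : (inord i.-1 : S) = i.-1 :> nat by rewrite inordK //; lia.
case: tpermP => [->|->|/eqP x0 /eqP xN] /=; rewrite ?NE ?eqxx //.

  by rewrite (_ : (i.-1 == 0)%N = false) //; lia.
by move: x0 xN; rewrite -!(inj_eq val_inj) /= NE => /negPf -> /negPf ->.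
Qed.

(** With p and q the reflections [mirror_half] and [mirror_pred] and s the swap, the monodromy is p
    q p s q, that is, (p q)^2 after q s q. The square is x + 1 on Z/N, and q s q exchanges N - 1 and
    N if i is even, inserting N between N - 1 and 0. *)
Lemma mono00 x : mono (false, false) x =
  (if (x.+1 < i)%N then x.+1 else if x.+1 == i then 0%N else x) :> nat.
Proof.
rewrite /monodromy /downright /downleft /upleft /horizontal /vertical /=.
rewrite invMg permM swapV mirror_halfV mirror_predV !permE.
rewrite !val_mirror_ord ?half_lt ?pred_lt //.
rewrite val_swap /= !val_mirror_ord ?half_lt ?pred_lt //.
have [h [Nh ih]] : exists h, N = h.*2.+1 /\ i = (h.*2.+1 + ~~ odd i)%N.
  by exists N./2; case: ifPn => oi; lia.
case: ifPn ih Nh => oi ih Nh; rewrite Nh /= uphalf_double.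
  by rewrite mirror_mirror mirror_predE /mirror; clear; do !case: ifP; lia.
have -> : i = h.*2.+2 by lia.
move: (nat_of_ord x) => {}x; rewrite (mirror_predE h x).
(* Only N - 1 = 2h, which the reflection sends to 0, and N = 2h + 1 feel the swap. *)
set y := (X in mirror _ _ (mirror _ _ (mirror _ _ X))).
have -> : y = if x == h.*2 then h.*2.+1 else if x == h.*2.+1 then 0%N
              else mirror h.*2.+1 h.*2 x.
  by rewrite {}/y mirror_predE; do !case: ifP; lia.
rewrite {y} mirror_mirror; have [->|x0] := eqVneq x h.*2.
  by rewrite (_ : mirror _ _ _ = h.*2.+1); [do !case: ifP; lia|rewrite /mirror ltnn].
have [->|x1] := eqVneq x h.*2.+1.
  by rewrite (_ : mirror _ _ _ = h); [do !case: ifP; lia|rewrite /mirror leq0n subn0].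
by rewrite mirror_mirror; do !case: ifP; lia.
Qed.

Lemma mono10 x : mono (true, false) x = swap x.
Proof.
by rewrite /monodromy /downright /downleft /upleft /horizontal /vertical /= invg1
  !perm1 permM permKV.
Qed.

Lemma mono1 a x : mono (a, true) x = x.
Proof.
rewrite /monodromy /downright /downleft /upleft /horizontal /vertical /= invg1 !perm1.
by case: a => /=; rewrite ?invg1 ?perm1 // permKV.
Qed.

(** Sheet 0 lies on the nontrivial cycle of each monodromy that has one, so its representative
    selects that cycle. *)
Definition base_sheet c : S := sheet_rep horizontal vertical c ord0.

Lemma base_sheetP c : sheet_rep horizontal vertical c (base_sheet c) = base_sheet c.
Proof. exact: sheet_repK. Qed.

Definition ramification (c : bool * bool) : nat :=
  if c.2 then 1%N else if c.1 then (if odd i then 1%N else 2%N) else i.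

Lemma iter_mono00 m : (m < i)%N -> iter m (mono (false, false)) ord0 = m :> nat.
Proof. by elim: m => //= m IH mi; rewrite mono00 IH ?mi //; exact: ltnW. Qed.

Lemma mono_cycle c : exists p : seq S,
  [/\ fcycle (mono c) p, uniq p, ord0 \in p, size p = ramification c
    & forall s, s \notin p -> mono c s = s].
Proof.
have fix_cycle : (forall s, mono c s = s) -> ramification c = 1%N -> exists p : seq S,
    [/\ fcycle (mono c) p, uniq p, ord0 \in p, size p = ramification c
    & forall s, s \notin p -> mono c s = s].
  by move=> fs ->; exists [:: ord0]; split=> //=; rewrite ?fs ?eqxx ?mem_seq1.
case: c fix_cycle => [[] []] fix_cycle.
- by apply: fix_cycle => // s; exact: mono1.
- rewrite /ramification /=; case: ifPn fix_cycle => oi; rewrite /ramification /= ?oi.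
    by apply => // s; rewrite mono10 /swap oi perm1.
  move=> _; exists [:: ord0; inord i.-1]; split=> //=.
  + by rewrite !mono10 /swap (negPf oi) tpermL tpermR !eqxx.
  + by rewrite inE -(inj_eq val_inj) /= inordK; lia.
  move=> s; rewrite !inE negb_or => /andP[s0 si].
  by rewrite mono10 /swap (negPf oi) tpermD // eq_sym.
- by apply: fix_cycle => // s; exact: mono1.
pose f := mono (false, false).
have vt : map val (traject f ord0 i) = iota 0 i.
  apply: (@eq_from_nth _ 0%N) => [|m]; rewrite size_map size_traject ?size_iota // => mi.
  rewrite (nth_map ord0) ?size_traject // nth_traject // nth_iota // add0n.
  exact: iter_mono00.
exists (traject f ord0 i); split.
- have i1 : i = i.-1.+1 by lia.
  (* The last step leads from i - 1 back to 0 and closes the trajectory into a cycle. *)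
  rewrite i1 /=; have <- : rcons (traject f (f ord0) i.-1) (iter i.-1 f (f ord0)) =
    rcons (traject f (f ord0) i.-1) ord0.
    congr rcons; apply: val_inj; rewrite -iterSr iterS /= mono00 iter_mono00; last by lia.
    by rewrite -i1 ltnn eqxx.
  by rewrite -trajectSr fpath_traject.
- by rewrite -(map_inj_uniq val_inj) vt iota_uniq.
- by rewrite -(mem_map val_inj) vt mem_iota /=; lia.
- by rewrite size_traject.
move=> s; rewrite -(mem_map val_inj) vt mem_iota /= add0n => si.
by apply: val_inj; rewrite /= mono00; do !case: ifP; lia.
Qed.

Lemma ramificationE c : sheet_order horizontal vertical c (base_sheet c) = ramification c.
Proof.
have [p [cp up p0 <- fp]] := mono_cycle c.
by have [] := single_orbit (@monodromy_inj _ _ _ c) cp up p0 fp.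
Qed.

Lemma other_sheets c s : sheet_rep horizontal vertical c s = s -> s != base_sheet c ->
  sheet_order horizontal vertical c s = 1%N.
Proof.
have [p [cp up p0 _ fp]] := mono_cycle c.
by have [_] := single_orbit (@monodromy_inj _ _ _ c) cp up p0 fp; apply.
Qed.

Lemma card_ramified : #|[pred c | 1 < ramification c]%N| = if odd i then 1%N else 2%N.
Proof.
rewrite (eq_card (B := if odd i then pred1 (false, false) else pred2 (false, false) (true, false))).
  by case: odd; rewrite ?card1 ?card2.
move=> -[a b]; rewrite inE /ramification /=; case/andP: i2 => i1 _.
by case: (odd i); rewrite !inE; case: b; case: a; rewrite ?i1.
Qed.

(** For i = 2 both ramified vertices have the same type and the two terms add up to 2, the value
    prescribed by g_2. *)
Lemma card_ramification m : (1 < m)%N ->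
  #|[pred c | ramification c == m]| = ((m == i) + (~~ odd i && (m == 2)))%N.
Proof.
move=> m1; rewrite -sum1_card (eq_bigl (fun c => ramification c == m)) //.
rewrite big_mkcond /= (eq_bigr (fun c : bool * bool =>
  (fun a b => if ramification (a, b) == m then 1 else 0)%N c.1 c.2)); last by case.
rewrite -(pair_bigA _ (fun a b => if ramification (a, b) == m then 1 else 0)%N) /=.
rewrite !big_bool /ramification /=.
by case: (odd i); rewrite /= ?[(m == _)]eq_sym; do !case: ifP; lia.
Qed.

End Permutations.

(** * Minimality *)

Lemma two_le_card T (A : set T) (p q : T) : A p -> A q -> p <> q ->
  (`I_2 #<= A)%card.
Proof.
move=> Ap Aq pq; pose f m := if m == 0%N then p else q.
have finj : {in `I_2 &, injective f}.
  move=> [|[|m]] [|[|m']] /set_mem //= _ /set_mem //= _; rewrite /f /= => e //.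
  by case: pq.
rewrite -(card_le_eql (inj_card_eq finj)); apply: subset_card_le => _ [m _ <-].
by rewrite /f; case: ifP.
Qed.

Section LowerBounds.
Variables (R : realType) (G : str_group) (k : nat) (f : surface_covering R G k).

Lemma singular_zero (j : 'I_k.-1) (x : singt f j) :
  exists p, zero_section (bret (sbranch f j)) p.
Proof. by have [a ax] := bdom_cover (brxit (sbranch f j)) x; exists (bret _ a x 0), a, x. Qed.

Lemma one_singular_point (j : 'I_k.-1) (x : singt f j) :
  (`I_1 #<= singular_points f)%card.
Proof.
have [p zp] := singular_zero x.
rewrite -(card_le_eql (card_set1 (x := p))); apply: subset_card_le => _ ->.
by exists j.
Qed.

Lemma two_singular_types (i j : 'I_k.-1) (x : singt f i) (y : singt f j) : i != j ->
  (`I_2 #<= singular_points f)%card.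
Proof.
move=> ij; have [p zp] := singular_zero x; have [q zq] := singular_zero y.
apply: (two_le_card (p := p) (q := q)); [by exists i|by exists j|move=> e].
have : (zero_section (bret (sbranch f i)) `&` zero_section (bret (sbranch f j))) p.
  by split=> //; rewrite e.
by rewrite (cov_sing_disjoint (scov f) ij).
Qed.

Lemma two_singular_points (j : 'I_k.-1) (x y : singt f j) : x <> y ->
  (`I_2 #<= singular_points f)%card.
Proof.
move=> xy; have [a ax] := bdom_cover (brxit (sbranch f j)) x.
have [b yb] := bdom_cover (brxit (sbranch f j)) y.
have d0 : @disk R 0 by rewrite /disk /= !mxE expr0n addr0.
apply: (two_le_card (p := bret (sbranch f j) a x 0) (q := bret (sbranch f j) b y 0)).
- by exists j => //; exists a, x.
- by exists j => //; exists b, y.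
by move=> /(proj1 (tube_inj (bret_emb (sbranch f j)) ax d0 yb d0)) [].
Qed.

Lemma nonzero_sum_point (A : nzRingType) (j : 'I_k.-1) (F : singt f j -> A) :
  \sum_(p \in [set: singt f j]) F p != 0 -> exists x : singt f j, True.
Proof.
move=> s0; apply: contrapT => nx; case/eqP: s0.
by rewrite fsbig1 // => x; case: nx; exists x.
Qed.

End LowerBounds.

(** * Coverings with the prescribed counts, and the lower bounds *)

Section Realization.
Variables (R : realType) (G : str_group) (n i : nat) (i2 : (2 <= i <= n.+1)%N).

Definition optimal_covering : surface_covering R G n.+1 :=
  tiling_surface_covering R (@ord0 n) (base_sheetP i2) (@other_sheets n i i2) G (card_ord n.+1).

Lemma card_optimal_singular_points :
  (singular_points optimal_covering #= `I_(if odd i then 1%N else 2%N))%card.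
Proof.
apply: card_tiling_singular_points; rewrite -(card_ramified i2).
by apply: eq_card => c; rewrite !inE ramificationE.
Qed.

Lemma optimal_count (A : nzRingType) (j : 'I_n) :
  \sum_(p \in [set: singt optimal_covering j]) (1 : A) =
  ((j.+2 == i) + (~~ odd i && (j.+2 == 2)))%:R.
Proof.
rewrite card_singt -(card_ramification i2) //; congr _%:R.
by apply: eq_card => c; rewrite !inE ramificationE.
Qed.

End Realization.

Lemma optimal_sign (R : realType) n i (i2 : (2 <= i <= n.+1)%N) (j : 'I_n)
    (p : singt (optimal_covering R SO2 i2) j) : point_sign p = 1.
Proof. by rewrite /point_sign; case: asboolP => // -[a _]. Qed.

Lemma g_vecE (A : nzRingType) k i (j : 'I_k.-1) :
  ((j.+2 == i) + (~~ odd i && (j.+2 == 2)))%:R = g_vec A k i 0 j.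
Proof.
rewrite mxE; have [->|i2] := eqVneq i 2; first by rewrite /= natrD mulr2n.
case: (odd i); first by rewrite addn0.
have [ji|_] := eqVneq j.+2 i; first by rewrite ji (negPf i2).
by rewrite add0n orbF.
Qed.

Lemma c_optimal_SO (R : realType) n i (i2 : (2 <= i <= n.+1)%N) :
  c_SO (optimal_covering R SO2 i2) = g_vec int n.+1 i.
Proof.
apply/rowP => j; rewrite -g_vecE -(optimal_count R SO2 i2) mxE.
by apply: eq_fsbigr => p _; exact: optimal_sign.
Qed.

Lemma c_optimal_O (R : realType) n i (i2 : (2 <= i <= n.+1)%N) :
  c_O (optimal_covering R O2 i2) = g_vec 'F_2 n.+1 i.
Proof. by apply/rowP => j; rewrite -g_vecE -(optimal_count R O2 i2) mxE. Qed.

(** Stated with integral entries for both groups; the mod 2 case is brought to this form by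
    [g_vec_F2]. *)
Lemma singular_lower_bound (R : realType) (G : str_group) n i
    (f : surface_covering R G n.+1) :
  (3 <= i <= n.+1)%N ->
  (forall j, g_vec int n.+1 i 0 j != 0 -> exists x : singt f j, True) ->
  (`I_(if odd i then 1%N else 2%N) #<= singular_points f)%card.
Proof.
move=> /andP[i3 ik] nz.
(* Entry i - 2 belongs to the exponent i and entry 0 to the exponent 2. For even i > 2 both are
   nonzero, giving two points of different types. *)
have iE : i.-2.+2 = i by lia.
have jlt : (i.-2 < n)%N by lia.
have [x _] : exists x : singt f (Ordinal jlt), True.
  by apply: nz; rewrite -g_vecE /= iE eqxx; case: (_ && _).
case: ifPn => oi; first exact: one_singular_point x.
have n0 : (0 < n)%N by lia.
have [y _] : exists y : singt f (Ordinal n0), True.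
  by apply: nz; rewrite -g_vecE oi [_ == i]ltn_eqF.
by apply: (two_singular_types x y); rewrite -val_eqE /=; lia.
Qed.

(** Apart from g_2, the entries are 0 or 1 and survive reduction modulo 2. *)
Lemma g_vec_F2 k i (j : 'I_k.-1) : i != 2 ->
  g_vec int k i 0 j != 0 -> g_vec 'F_2 k i 0 j != 0.
Proof. by rewrite !mxE => /negPf ->; case: (odd i); [case: (_ == i)|case: (_ || _)]. Qed.

Lemma singular_lower_bound_SO (R : realType) n i (f : surface_covering R SO2 n.+1) :
  (2 <= i <= n.+1)%N -> c_SO f = g_vec int n.+1 i ->
  (`I_(if odd i then 1%N else 2%N) #<= singular_points f)%card.
Proof.
move=> /andP[]; rewrite leq_eqVlt => /orP[/eqP <- ik|i3 ik] cf; last first.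
  apply: singular_lower_bound => [|j]; first by rewrite i3.
  by rewrite -cf mxE; exact: nonzero_sum_point.
have n0 : (0 < n)%N by lia.
have s2 : \sum_(p \in [set: singt f (Ordinal n0)]) point_sign p = 2.
  by have /rowP/(_ (Ordinal n0)) := cf; rewrite !mxE.
have [x _] : exists x : singt f (Ordinal n0), True.
  by apply: (@nonzero_sum_point _ _ _ _ _ _ (@point_sign R _)); rewrite s2.
(* A single point would contribute 1 or -1, never 2. *)
have [y xy] : exists y, x <> y.
  apply: contrapT => ny; move: s2; rewrite (_ : [set: _] = [set x]).
    by rewrite fsbig_set1 /point_sign; case: ifP.
  apply/seteqP; split=> // y _; apply: contrapT => xy; apply: ny; exists y => e.
  exact: xy.
exact: two_singular_points xy.
Qed.

(** [f] represents a class with the prescribed count, so the uniqueness contained in [is_alpha]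
    identifies this class with [alpha]. *)
Lemma class_unique (R : realType) (G : str_group) k i (A : nzRingType)
    (c : surface_covering R G k -> 'rV[A]_(k.-1)) f :
  c f = g_vec A k i -> forall alpha, is_alpha c i alpha -> cob_class f = alpha.
Proof. by move=> cf alpha [_ u]; rewrite (u (cob_class f)) //; exists f. Qed.

Local Open Scope card_scope.
Local Open Scope ring_scope.
Theorem theorem4p16 (R : realType) (k : nat) (hk : (2 <= k)%N) :
  (forall i : nat, (2 <= i <= k)%N ->
     exists f : surface_covering R SO2 k,
       [/\ c_SO f = g_vec int k i,
           (forall alpha : Cob1 R SO2 k, is_alpha (@c_SO R k) i alpha ->
              cob_class f = alpha),
           singular_points f #= `I_(if odd i then 1%N else 2%N)
         & forall f' : surface_covering R SO2 k, c_SO f' = g_vec int k i ->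
             singular_points f #<= singular_points f'])
  /\
  (forall i : nat, (3 <= i <= k)%N ->
     exists f : surface_covering R O2 k,
       [/\ c_O f = g_vec 'F_2 k i,
           (forall alpha : Cob1 R O2 k, is_alpha (@c_O R k) i alpha ->
              cob_class f = alpha),
           singular_points f #= `I_(if odd i then 1%N else 2%N)
         & forall f' : surface_covering R O2 k, c_O f' = g_vec 'F_2 k i ->
             singular_points f #<= singular_points f']).
Proof.
(* Writing k = n + 1 makes the set of sheets ['I_n.+1] visibly inhabited. *)
case: k hk => [//|n] _; split=> i ik.
  exists (optimal_covering R SO2 ik); have cf := c_optimal_SO R ik; split=> //.
  - exact: class_unique cf.
  - exact: card_optimal_singular_points.
  move=> f' cf'; rewrite (card_le_eql (card_optimal_singular_points R SO2 ik)).
  exact: singular_lower_bound_SO cf'.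
have ik2 : (2 <= i <= n.+1)%N by lia.
exists (optimal_covering R O2 ik2); have cf := c_optimal_O R ik2; split=> //.
- exact: class_unique cf.
- exact: card_optimal_singular_points.
move=> f' cf'; rewrite (card_le_eql (card_optimal_singular_points R O2 ik2)).
apply: singular_lower_bound => // j /g_vec_F2 gj.
have : c_O f' 0 j != 0 by rewrite cf' gj //; lia.
by rewrite mxE; exact: nonzero_sum_point.
Qed.
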